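(* Let $d\ge1$, $m>0$, $\gamma\in\big[0,\frac{d+1}{2}\big)$ and let $f(x)=e^{-m|x|}g(|x|)$, $x\in\mathbb{R}^d$, with $g(r)=r^{-\gamma}$ or $g(r)=(1\vee r)^{-\gamma}$. Set $$D_1=C/2,\ D_2=1\ \text{ if } d=1,\qquad D_1=CM_4/2,\ D_2=M_3\ \text{ if } d>1,$$ $$\rho_1=d-\gamma,\ \kappa_1=D_1\Gamma(d-\gamma)\ \text{ for } g(r)=r^{-\gamma},\qquad \rho_1=d,\ \kappa_1=D_1\Gamma(d)\ \text{ for } g(r)=(1\vee r)^{-\gamma},$$ $$\rho_2=\frac{d+1}{2}-\gamma,\qquad \kappa_2=D_2\,\Gamma\Big(\frac{d+1}{2}-\gamma\Big),$$ where the constants $C,M_2,M_3,M_4$ are defined in the context. Then the following estimates hold. (1) For $|x|\ge1$ and $n\in\mathbb{N}$, $$D_1^{n-1}\frac{\Gamma(\rho_1)^n}{\Gamma(\rho_1n)}\le\frac{f^{n\star}(x)}{f(x)|x|^{(\frac{d+1}{2}-\gamma)(n-1)}}\le D_2^{n-1}\frac{\Gamma(\rho_2)^n}{\Gamma(\rho_2n)}+\frac{2M_2\,n\,(M_2+\kappa_2)^{n-1}}{D_2|x|^{\frac{d+1}{2}-\gamma}}.$$ In particular, $$D_1^{n-1}\frac{\Gamma(\rho_1)^n}{\Gamma(\rho_1n)}\le\liminf_{|x|\to\infty}\frac{f^{n\star}(x)}{f(x)|x|^{(\frac{d+1}{2}-\gamma)(n-1)}}\le\limsup_{|x|\to\infty}\frac{f^{n\star}(x)}{f(x)|x|^{(\frac{d+1}{2}-\gamma)(n-1)}}\le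 D_2^{n-1}\frac{\Gamma(\rho_2)^n}{\Gamma(\rho_2n)}.$$ (2) If $|x|\ge1$ and $\lambda>0$, then $$\phi\big(\rho_1,0;\kappa_1\lambda|x|^{\frac{d+1}{2}-\gamma}\big)\le\frac{p_\lambda(x)}{e^{-\lambda\|f\|_1}e^{-m|x|}|x|^{-\frac{d+1}{2}}}\le e^{M_2\lambda}\,\phi\big(\rho_2,0;\kappa_2\lambda|x|^{\frac{d+1}{2}-\gamma}\big).$$
   Context: $\mathbb{N}=\{1,2,\dots\}$, $a\vee b=\max(a,b)$, $a\wedge b=\min(a,b)$; $|x|$ is the Euclidean norm, $\|f\|_1$ the $L^1(\mathbb{R}^d)$ norm; $\lfloor b\rfloor$, $\lceil b\rceil$ are floor and ceiling and $\{b\}=b-\lfloor b\rfloor$. Convolutions: $f^{1\star}:=f$, $f^{n\star}(x):=\int_{\mathbb{R}^d}f(x-y)f^{(n-1)\star}(y)\,dy$ for $n\ge2$. For $\lambda>0$ the density of the compound Poisson measure built for $f$ is $p_\lambda(x)=e^{-\lambda\|f\|_1}\sum_{n=1}^\infty\frac{\lambda^nf^{n\star}(x)}{n!}$. Generalized Bessel (Wright) function: $\phi(\rho,\beta;t):=\sum_{n=0}^\infty\frac{t^n}{\Gamma(\rho n+\beta)\,n!}$ for $\rho>0$, $\beta\ge0$, $t>0$, with the convention $1/\Gamma(0)=0$. Constants: - $M_2:=(C_1\vee C_2)\|f\|_1$, where $C_1,C_2\ge1$ are constants such that $f(x)\le C_1f(y)$ for $1\le|x|\le|y|\le|x|+1$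 and $f(x)\le C_2f(2x)$ for $|x|\le1$ (such constants exist for these $f$). - For $d\ge2$: $M_3:=1\vee\left(\frac{2\pi^{\frac{d-1}{2}}}{\Gamma(\frac{d-1}{2})}\int_0^\infty\exp\left(-\frac{m}{\pi^2}\frac{s^2}{\sqrt{1+s^2}}\right)s^{d-2}ds\right)$. - For $d\ge2$: $M_4:=1\wedge\left(\frac{2^{d-1}}{C_3\pi^{\frac{d-3}{2}}\Gamma(\frac{d-1}{2})}\right)$, where $C_3\ge1$ is a constant such that $g(r)\le C_3g(2r)$ for all $r>0$. - $C:=1$ if $d=1$ and $C:=\frac{e^{-mr_0}}{d-1}$ if $d>1$, where $$r_0:=\left(\frac{8\lceil b\rceil^{\lfloor b\rfloor}}{a_0^{1-\{b\}}}\right)^{\frac1{a_0}}\big(2^{\frac1{a_0}}e^{\frac1e}\big)^{2\lfloor b\rfloor}$$ with $a_0=b=d-\gamma$ in the case $g(r)=r^{-\gamma}$, and with $a_0=1$, $b=d$ in the case $g(r)=(1\vee r)^{-\gamma}$. *)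

(* Defs.v *)
From HB Require Import structures.
From mathcomp Require Import all_boot all_order all_algebra.
From mathcomp Require Import all_classical all_reals all_analysis.

Set Implicit Arguments.
Unset Strict Implicit.
Unset Printing Implicit Defensive.

Import Order.TTheory GRing.Theory Num.Theory.
Import numFieldNormedType.Exports.

Local Open Scope classical_set_scope.
Local Open Scope ring_scope.

Definition rV_display : measure_display.
Proof. exact: default_measure_display. Qed.

(* The sigma-algebra on 'rV[R]_n generated by the coordinate maps; it is the
   Borel sigma-algebra of R^n. *)
Section measurable_rV.
Context {R : realType} {n : nat}.

Let coord (i : 'I_n) (v : 'rV[R]_n) : measurableTypeR R := v ord0 i.

Let rV_set0 : g_sigma_preimage coord set0.
Proof. exact: sigma_algebra0. Qed.

Let rV_setC A : g_sigma_preimage coord A -> g_sigma_preimage coord (~` A).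
Proof. exact: sigma_algebraC. Qed.

Let rV_bigcup (F : _^nat) : (forall i, g_sigma_preimage coord (F i)) ->
  g_sigma_preimage coord (\bigcup_i (F i)).
Proof. exact: sigma_algebra_bigcup. Qed.

HB.instance Definition _ := @isMeasurable.Build rV_display
  'rV[R]_n (g_sigma_preimage coord) rV_set0 rV_setC rV_bigcup.

End measurable_rV.

Section lebesgue_rV_def.
Context {R : realType}.
Local Open Scope ereal_scope.

Definition consrV n (p : measurableTypeR R * 'rV[R]_n) : 'rV[R]_n.+1 :=
  row_mx (p.1 : R)%:M p.2.

Lemma measurable_coord n (i : 'I_n) :
  measurable_fun [set: 'rV[R]_n] (fun v => v ord0 i : measurableTypeR R).
Proof.
move=> _ Y mY; rewrite setTI; apply: sub_sigma_algebra => /=.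
rewrite -bigcup_seq/=; exists i => /=; first by rewrite mem_index_enum.
by exists Y => //; rewrite setTI.
Qed.

Lemma measurable_fun_rVP d (T : measurableType d) n (f : T -> 'rV[R]_n) :
  measurable_fun [set: T] f <->
  forall i, measurable_fun [set: T] (fun t => f t ord0 i : measurableTypeR R).
Proof.
split=> [mf i|mf].
  exact: (measurableT_comp (measurable_coord i) mf).
pose G := image_set_system [set: T] f (@measurable _ T).
have sG : sigma_algebra [set: 'rV[R]_n] G.
  exact: sigma_algebra_image (sigma_algebra_measurable T).
move=> _ A mA; suff : G A by [].
move: A mA; apply: smallest_sub => // A.
rewrite -bigcup_seq => -[i _ [B mB <-]].
by rewrite /G /image_set_system/= setTI; exact: mf.
Qed.

Lemma consrVE0 n p : (consrV p : 'rV[R]_n.+1) ord0 ord0 = p.1.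
Proof.
rewrite /consrV.
have -> : (ord0 : 'I_n.+1) = lshift n (ord0 : 'I_1) by exact: val_inj.
by rewrite (@row_mxEl _ 1 1 n) mxE mulr1n.
Qed.

Lemma consrVES n p j :
  (consrV p : 'rV[R]_n.+1) ord0 (lift ord0 j) = p.2 ord0 j.
Proof.
rewrite /consrV.
have -> : lift ord0 j = rshift 1 j by exact: val_inj.
by rewrite (@row_mxEr _ 1 1 n).
Qed.

Lemma measurable_consrV n : measurable_fun [set: _ * _] (@consrV n).
Proof.
apply/measurable_fun_rVP => i; case: (unliftP ord0 i) => [j|] ->.
  rewrite (_ : (fun _ => _) = (fun v : 'rV[R]_n => v ord0 j : measurableTypeR R)
    \o snd); last by apply/funext => p /=; rewrite consrVES.
  by apply: measurableT_comp => //; exact: measurable_coord.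
rewrite (_ : (fun _ => _) = fst); first exact: measurable_fst.
by apply/funext => p /=; rewrite consrVE0.
Qed.

Definition unconsrV n (v : 'rV[R]_n.+1) : measurableTypeR R * 'rV[R]_n :=
  (v ord0 ord0, \row_j v ord0 (lift ord0 j))%R.

Lemma consrVK n : cancel (@consrV n) (@unconsrV n).
Proof.
move=> [a v]; rewrite /unconsrV consrVE0; congr (_, _).
by apply/rowP => j; rewrite mxE consrVES.
Qed.

Lemma unconsrVK n : cancel (@unconsrV n) (@consrV n).
Proof.
move=> v; apply/rowP => i; case: (unliftP ord0 i) => [j|] ->.
  by rewrite consrVES mxE.
by rewrite consrVE0.
Qed.

Lemma measurable_unconsrV n : measurable_fun [set: _] (@unconsrV n).
Proof.
apply/measurable_fun_pairP; split; first exact: (measurable_coord ord0).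
apply/measurable_fun_rVP => i.
rewrite (_ : (fun _ => _) = (fun v : 'rV[R]_n.+1 =>
  v ord0 (lift ord0 i) : measurableTypeR R)); first exact: measurable_coord.
by apply/funext => v /=; rewrite mxE.
Qed.

(* Lebesgue measure on R^n, as the iterated product of the Lebesgue measure
   on R. *)
Fixpoint lebesgue_rV n : set 'rV[R]_n -> \bar R :=
  match n with
  | 0 => \d_(0%R : 'rV[R]_0)
  | k.+1 => pushforward ((@lebesgue_measure R) \x (@lebesgue_rV k)) (@consrV k)
  end.

End lebesgue_rV_def.

Section lebesgue_rV_step.
Context {R : realType} (n : nat) (mu : {sigma_finite_measure set 'rV[R]_n -> \bar R}).
Local Open Scope ereal_scope.

Let P : {measure set (measurableTypeR R * 'rV[R]_n)%type -> \bar R} :=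
  (@lebesgue_measure R) \x mu.

Definition prod_consrV := pushforward P (@consrV R n).

Let prod_consrV0 : prod_consrV set0 = 0.
Proof. by rewrite /prod_consrV /pushforward preimage_set0 measure0. Qed.

Let prod_consrV_ge0 A : 0 <= prod_consrV A.
Proof. by rewrite /prod_consrV /pushforward; apply: measure_ge0. Qed.

Let prod_consrV_sigma_additive : semi_sigma_additive prod_consrV.
Proof.
move=> F mF tF mUF; rewrite /prod_consrV /pushforward preimage_bigcup.
have mc A : measurable A -> measurable (@consrV R n @^-1` A).
  by move=> mA; rewrite -[X in measurable X]setTI; exact: measurable_consrV.
apply: measure_semi_sigma_additive.
- by move=> k; exact: mc.
- apply/trivIsetP => /= i j _ _ ij; rewrite -preimage_setI.
  by move/trivIsetP : tF => /(_ _ _ _ _ ij) ->//; rewrite preimage_set0.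
- by rewrite -preimage_bigcup; exact: mc.
Qed.

HB.instance Definition _ := isMeasure.Build _ _ _ prod_consrV
  prod_consrV0 prod_consrV_ge0 prod_consrV_sigma_additive.

Let prod_consrV_sigma_finite : sigma_finite setT prod_consrV.
Proof.
have /sigma_finiteP[F [TF ndF Foo]] := sigma_finiteT (@lebesgue_measure R).
have /sigma_finiteP[G [TG ndG Goo]] := sigma_finiteT mu.
exists (fun k => @unconsrV R n @^-1` (F k `*` G k)).
  rewrite -preimage_bigcup -(preimage_setT (@unconsrV R n)); congr (_ @^-1` _).
  rewrite -setXTT TF TG predeqE => -[x y]; split=> [[/= [i _ Fx] [j _ Gy]]|].
    exists (maxn i j) => //; split.
      by move: x Fx; exact/subsetPset/ndF/leq_maxl.
    by move: y Gy; exact/subsetPset/ndG/leq_maxr.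
  by move=> [i _ []/= ? ?]; split; exists i.
move=> k; have [mF Fk] := Foo k; have [mG Gk] := Goo k; split.
  by rewrite -[X in measurable X]setTI; apply: measurable_unconsrV => //;
    exact: measurableX.
rewrite /prod_consrV /pushforward -comp_preimage.
rewrite (_ : _ \o _ = id); last by apply/funext => p /=; rewrite consrVK.
by rewrite preimage_id /P /= product_measure1E// lte_mul_pinfty// ge0_fin_numE.
Qed.

HB.instance Definition _ := Measure_isSigmaFinite.Build _ _ _ prod_consrV
  prod_consrV_sigma_finite.

End lebesgue_rV_step.

Section lebesgue_rV_measure.
Context {R : realType} (n : nat).
Local Open Scope ereal_scope.

Let lebesgue_rV_spec :
  exists mu : {sigma_finite_measure set 'rV[R]_n -> \bar R},
    @lebesgue_rV R n = mu :> (set _ -> _).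
Proof.
elim: n => [|k [mu muE]]; first by exists (\d_(0%R : 'rV[R]_0)).
by exists (prod_consrV mu) => /=; rewrite muE.
Qed.

Let lebesgue_rV0 : @lebesgue_rV R n set0 = 0.
Proof. by have [mu ->] := lebesgue_rV_spec; rewrite measure0. Qed.

Let lebesgue_rV_ge0 A : 0 <= @lebesgue_rV R n A.
Proof. by have [mu ->] := lebesgue_rV_spec; exact: measure_ge0. Qed.

Let lebesgue_rV_sigma_additive : semi_sigma_additive (@lebesgue_rV R n).
Proof.
by have [mu ->] := lebesgue_rV_spec; exact: measure_semi_sigma_additive.
Qed.

HB.instance Definition _ := isMeasure.Build _ _ _ (@lebesgue_rV R n)
  lebesgue_rV0 lebesgue_rV_ge0 lebesgue_rV_sigma_additive.

Let lebesgue_rV_sigma_finite : sigma_finite setT (@lebesgue_rV R n).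
Proof. by have [mu ->] := lebesgue_rV_spec; exact: sigma_finiteT. Qed.

HB.instance Definition _ := Measure_isSigmaFinite.Build _ _ _ (@lebesgue_rV R n)
  lebesgue_rV_sigma_finite.

End lebesgue_rV_measure.

Lemma lebesgue_rV_box {R : realType} n (A : 'I_n -> set (measurableTypeR R)) :
  (forall i, measurable (A i)) ->
  lebesgue_rV [set v : 'rV[R]_n | forall i, A i (v ord0 i)] =
  (\prod_(i < n) lebesgue_measure (A i))%E.
Proof.
elim: n A => [|n IH] A mA.
  rewrite big_ord0 /= diracE mem_set//; by case.
have mB : measurable [set v : 'rV[R]_n | forall i, A (lift ord0 i) (v ord0 i)].
  rewrite (_ : [set _ | _] = \big[setI/setT]_(i < n)
      ((fun v : 'rV[R]_n => v ord0 i : measurableTypeR R) @^-1` A (lift ord0 i))).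
    apply: bigsetI_measurable => i _.
    by rewrite -[X in measurable X]setTI; exact: measurable_coord.
  apply/seteqP; split => v /=; rewrite -bigcap_seq /=.
    by move=> vA i _; exact: vA.
  by move=> vA i; apply: vA; rewrite /= mem_index_enum.
rewrite big_ord_recl -IH// /= /pushforward.
rewrite -product_measure1E//; congr (_ _).
apply/seteqP; split => -[a v] /=.
  by move=> pA; split=> [|i]; [have := pA ord0; rewrite consrVE0
    |have := pA (lift ord0 i); rewrite consrVES].
move=> [Aa Av] i; case: (unliftP ord0 i) => [j|] ->.
  by rewrite consrVES; exact: Av.
by rewrite consrVE0.
Qed.

Arguments lebesgue_rV R n : clear implicits.

Section euclidean.
Context {R : realType} {d : nat}.
Implicit Types x : 'rV[R]_d.

(* The library's norm `|x| on 'rV[R]_d is the sup norm. *)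
Definition enorm x : R := Num.sqrt (\sum_(i < d) x ord0 i ^+ 2).

Definition enorm_pinfty : set_system 'rV[R]_d :=
  filter_from [set: R] (fun r => [set x | r <= enorm x]).

Definition L1norm (f : 'rV[R]_d -> R) : R :=
  fine ('N[lebesgue_rV R d]_1 [EFin \o f])%E.

(* Convolutions take values in \bar R: for the singular profile the iterated
   convolutions of f may be infinite at the origin. *)
Definition conv (f : 'rV[R]_d -> R) (h : 'rV[R]_d -> \bar R) x : \bar R :=
  (\int[lebesgue_rV R d]_y ((f (x - y)%R)%:E * h y))%E.

(* Meaningful for n >= 1 only; the first convolution power is f itself. *)
Definition convn (f : 'rV[R]_d -> R) (n : nat) : 'rV[R]_d -> \bar R :=
  iter n.-1 (conv f) (EFin \o f).

Definition cpoisson_density (f : 'rV[R]_d -> R) (lambda : R) x : \bar R :=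
  ((expR (- (lambda * L1norm f)))%:E *
   \sum_(1 <= n <oo) ((lambda ^+ n / n`!%:R)%:E * convn f n x))%E.

End euclidean.

Section special_functions.
Context {R : realType}.

(* Euler's integral, used for s > 0. *)
Definition Gamma (s : R) : R :=
  \int[lebesgue_measure]_(t in `]0, +oo[) (t `^ (s - 1) * expR (- t)).

Definition invGamma (s : R) : R := if s == 0 then 0 else (Gamma s)^-1.

(* A series of nonnegative terms for the arguments considered here. *)
Definition wright (rho beta t : R) : \bar R :=
  (\sum_(0 <= n <oo)
    (t ^+ n * invGamma (rho * n%:R + beta) / n`!%:R)%:E)%E.

End special_functions.

Variant profile := pure_power | cut_power.

Section constants.
Context {R : realType} (d : nat) (m gamma : R) (k : profile).

Definition radial (r : R) : R :=
  match k with
  | pure_power => r `^ (- gamma)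
  | cut_power => (Num.max 1 r) `^ (- gamma)
  end.

(* With [pure_power] and gamma > 0 the value at the origin is 0 instead of
   +oo, since 0 `^ a = 0 for a != 0; this is the value at a single point. *)
Definition density (x : 'rV[R]_d) : R :=
  expR (- (m * enorm x)) * radial (enorm x).

Definition rho1 : R :=
  match k with pure_power => d%:R - gamma | cut_power => d%:R end.

Definition rho2 : R := (d%:R + 1) / 2 - gamma.

Definition cst_a0 : R :=
  match k with pure_power => d%:R - gamma | cut_power => 1 end.

Definition cst_b : R :=
  match k with pure_power => d%:R - gamma | cut_power => d%:R end.

Definition cst_r0 : R :=
  let a0 := cst_a0 in let b := cst_b in
  let fl := Num.floor b in let ce := Num.ceil b in
  let frac := b - fl%:~R in
  ((8 * ce%:~R ^ fl) / a0 `^ (1 - frac)) `^ a0^-1 *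
  (2 `^ a0^-1 * expR (expR 1)^-1) ^ (2 * fl).

Definition cst_C : R :=
  if d == 1%N then 1 else expR (- (m * cst_r0)) / (d%:R - 1).

Definition cst_M2 (C1 C2 : R) : R := Num.max C1 C2 * L1norm density.

Definition cst_M3 : R :=
  Num.max 1 (2 * pi `^ ((d%:R - 1) / 2) / Gamma ((d%:R - 1) / 2) *
    \int[lebesgue_measure]_(s in `]0, +oo[)
      (expR (- (m / pi ^+ 2 * (s ^+ 2 / Num.sqrt (1 + s ^+ 2)))) *
       s ^+ (d - 2))).

Definition cst_M4 (C3 : R) : R :=
  Num.min 1 (2 ^+ (d - 1) /
    (C3 * pi `^ ((d%:R - 3) / 2) * Gamma ((d%:R - 1) / 2))).

Definition cst_D1 (C3 : R) : R :=
  if d == 1%N then cst_C / 2 else cst_C * cst_M4 C3 / 2.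

Definition cst_D2 : R := if d == 1%N then 1 else cst_M3.

End constants.

(* Main.v *)
Require Import Defs.
From mathcomp Require Import all_boot all_order all_algebra.
From mathcomp Require Import all_classical all_reals all_analysis.
From mathcomp Require Import measurable_realfun ring lra.

(** Every estimate compares f^{(n+1)*}(x), the integral of f(x - y) f^{n*}(y), with
    f(x). Since |x - y| + |y| >= |x|, with equality on the segment from 0 to x, the
    exponential factors of the integrand are at most exp(- m |x|), and the mass
    sits near that segment. At the point of the segment at distance r from 0 the
    transversal deviations have size about (r (|x| - r) / |x|)^(1/2), in dimension
    d - 1; so the integral is governed by the integral over r of
    r^(a - 1) (|x| - r)^(b - 1) for suitable a and b. This is a Beta integral, and
    each step of the induction turns Gamma(rho)^n / Gamma(rho n) into
    Gamma(rho)^(n+1) / Gamma(rho (n+1)).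

    Two facts make the induction possible. Integrals of functions of |x - y| and
    |y| can be computed with x on the first axis (ge0_integral_axis), and then in
    polar coordinates for the other variables (ge0_integral_radial); and f^{n*} is
    again radial and decreasing in |x| (radial_decreasing_convn), by a reflection
    argument.

    Upper bound. The integral is split into the part where y is near 0, the part
    where y is near x or beyond, and the bulk. In the first two the large factor is
    comparable with its value at x, so that each of them costs a factor M2. In the
    bulk (bulk_integral_cst_D2) the excess of |x - y| + |y| over |x| is bounded
    below on every sphere around 0, and the resulting transversal integral is the
    one in the constant M3. The induction (convn_le_upper_bound) gives a binomial
    sum in M2 and in the coefficients D2^(k-1) Gamma(rho2)^k / Gamma(rho2 k), from
    which both the error term of (1) and the factor e^(M2 lambda) of (2) follow:
    the series of the binomial sums is a Cauchy product.

    Lower bound. Only the points in a tube around the segment are kept, thin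
    enough for the exponential to lose at most a constant factor and for the
    radial factors to stay comparable with those on the segment
    (tube_integral_ge); the volume of the sections of the tube supplies the
    transversal factor. The constants C, M4 leave enough room for all the
    losses (cst_D1_le_tube_cst). Convolution powers are evaluated near 0 as well, so
    the induction (convn_ge_lower) needs a bound at all x <> 0, where |x|^rho2 is
    replaced by its minimum with |x|^rho1. *)

Set Implicit Arguments.
Unset Strict Implicit.
Unset Printing Implicit Defensive.

Import Order.TTheory GRing.Theory Num.Theory.
Import numFieldNormedType.Exports.
Local Open Scope classical_set_scope.
Local Open Scope ring_scope.

(** * Changes of variables on the line *)

Section OneD.
Context {R : realType}.
Local Notation mu := (@lebesgue_measure R).
Local Open Scope ereal_scope.

Lemma ge0_integral_shift (c : R) (f : R -> \bar R) :
  measurable_fun [set: R] f -> (forall r, 0 <= f r) ->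
  \int[mu]_t f (t + c)%R = \int[mu]_t f t.
Proof.
move=> mf f0.
have ms : measurable_fun [set: R] (fun t : R => t + c)%R by exact: measurable_funD.
have H A : measurable A -> pushforward mu ((fun t : R => (t + c)%R) : _ -> measurableTypeR R) A = mu A.
  move=> mA; apply/esym/lebesgue_measure_unique => //= _ [[a b]] _ <-.
  rewrite /pushforward [X in _ = mu X](_ : _ = `]a - c, b - c]%classic)%R.
    rewrite !lebesgue_measure_itv/= !lte_fin ltrD2r; case: ifP => // _.
    by rewrite -!EFinD; congr (_%:E); ring.
  by apply/seteqP; split => x /=; rewrite !in_itv/= ltrBlDr lerBrDr.
transitivity (\int[pushforward mu ((fun t : R => (t + c)%R) : _ -> measurableTypeR R)]_t f t).
  by rewrite ge0_integral_pushforward// preimage_setT.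
by apply: eq_measure_integral => A mA _; exact: H.
Qed.

Lemma ge0_integral_opp (f : R -> \bar R) :
  measurable_fun [set: R] f -> (forall r, 0 <= f r) ->
  \int[mu]_t f (- t)%R = \int[mu]_t f t.
Proof.
move=> mf f0.
have ms : measurable_fun [set: R] (fun t : R => - t)%R by exact: oppr_measurable.
transitivity (\int[pushforward mu ((fun t : R => (- t)%R) : _ -> measurableTypeR R)]_t f t).
  by rewrite ge0_integral_pushforward// preimage_setT.
by apply: eq_measure_integral => A mA _; exact: lebesgue_measureN.
Qed.

Lemma ge0_integral_scale (c : R) (f : R -> \bar R) : (0 < c)%R ->
  measurable_fun [set: R] f -> (forall r, 0 <= f r) ->
  \int[mu]_t f t = c%:E * \int[mu]_t f (c * t)%R.
Proof.
move=> c0 mf f0.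
have ms : measurable_fun [set: R] (fun t : R => c * t)%R by exact: measurable_funM.
have ms' : measurable_fun [set: R] ((fun t : R => (c * t)%R) : _ -> measurableTypeR R) by exact: ms.
pose nu := measure_function_pushforward__canonical__measure_function_Measure mu ms'.
have cn : (0 <= c)%R by exact: ltW.
have H A : measurable A -> mscale (NngNum cn) nu A = mu A.
  move=> mA; apply/esym/lebesgue_measure_unique => //= _ [[a b]] _ <-.
  rewrite /mscale /= /pushforward [X in _ = _ * mu X](_ : _ = `]a / c, b / c]%classic)%R.
    rewrite !lebesgue_measure_itv/= !lte_fin ltr_pM2r ?invr_gt0//; case: ifP => // _.
      by rewrite -!EFinD -EFinM; congr (_%:E); field; rewrite gt_eqF.
    by rewrite mule0.
  by apply/seteqP; split => x /=; rewrite !in_itv/= ltr_pdivrMr// ler_pdivlMr// [(x * c)%R]mulrC.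
transitivity (\int[mscale (NngNum cn) nu]_t f t).
  by apply: eq_measure_integral => A mA _; exact/esym/H.
rewrite ge0_integral_mscale//=; congr (_ * _).
by rewrite ge0_integral_pushforward// preimage_setT.
Qed.

Lemma integral_id_itv (a b : R) : (a <= b)%R ->
  \int[mu]_(x in `]a, b]) (2 * x)%:E = (b ^+ 2 - a ^+ 2)%:E.
Proof.
rewrite le_eqVlt => /predU1P[->|ab].
  by rewrite set_itvoc0 integral_set0 subrr.
rewrite integral_itv_obnd_cbnd; last first.
  by apply/measurable_EFinP; apply: measurable_funM.
have dF (x : R) : is_derive x 1%R (fun z : R => z ^+ 2)%R (2 * x)%R.
  by apply: is_derive_eq; rewrite /GRing.scale/= mulr1 mulr_natl.
rewrite (@continuous_FTC2 _ _ (fun z => z ^+ 2)%R) ?EFinB//.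
- apply: continuous_subspaceT => x; apply: cvgM; [exact: cvg_cst|exact: cvg_id].
- split.
  + by move=> x _; apply: ex_derive.
  + by apply: cvg_at_right_filter; apply: exprn_continuous.
  + by apply: cvg_at_left_filter; apply: exprn_continuous.
- by move=> x _; rewrite derive1E derive_val.
Qed.

Lemma integral_if d (T : measurableType d) (m : {measure set T -> \bar R}) (D : set T)
    (P : T -> bool) (f : T -> \bar R) : (forall x, D x <-> P x) ->
  \int[m]_(x in D) f x = \int[m]_x (if P x then f x else 0).
Proof.
move=> DP; rewrite integral_mkcond; apply: eq_integral => t _; rewrite patchE.
case: ifPn => [|/negP]; first by rewrite inE => /DP ->.
by case: ifPn => // Pt; case; rewrite inE; apply/DP.
Qed.

Lemma integral_itv0y (f : R -> \bar R) :
  \int[mu]_(t in `]0%R, +oo[) f t = \int[mu]_t (if (0 < t)%R then f t else 0).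
Proof.
rewrite integral_mkcond; apply: eq_integral => t _.
by rewrite patchE mem_setE in_itv/= andbT.
Qed.

Lemma measurable_ltr2 d (T : measurableType d) (f g : T -> R) :
  measurable_fun [set: T] f -> measurable_fun [set: T] g -> measurable [set x | (f x < g x)%R].
Proof.
move=> mf mg; have := measurable_fun_ltr mf mg.
move=> /(_ measurableT [set true] I).
by rewrite setTI (_ : _ @^-1` _ = [set x | (f x < g x)%R]).
Qed.

Lemma sqrtr_lt_sqr (a z : R) : (0 < z)%R -> (Num.sqrt a < z)%R = (a < z ^+ 2)%R.
Proof.
move=> z0; have [a0|a0] := leP 0%R a.
  by rewrite -[z in LHS](ger0_norm (ltW z0)) -sqrtr_sqr ltr_sqrt// exprn_gt0.
by rewrite ltr0_sqrtr// z0 (lt_trans a0) ?exprn_gt0.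
Qed.

(** The measure 2 z dz on z > 0 is carried by z |-> z^2 to a measure that agrees
    with Lebesgue measure on bounded intervals, hence everywhere on v > 0; no
    continuity of H is needed. In the proof 2 z dz is itself obtained as an image
    measure, that of the area of 0 < w < 2 z. *)
Lemma ge0_integral_sqr (H : R -> \bar R) :
  measurable_fun [set: R] H -> (forall r, 0 <= H r) ->
  \int[mu]_v (if (0 < v)%R then H v else 0) =
  \int[mu]_z (if (0 < z)%R then (2 * z)%:E * H (z ^+ 2)%R else 0).
Proof.
move=> mH H0.
pose U := [set p : R * R | (0 < p.2)%R] `&` [set p : R * R | (p.2 < 2 * p.1)%R].
have mU : measurable U.
  apply: measurableI; apply: measurable_ltr2 => //.
  by apply: measurable_funM.
pose P := (mu \x mu)%E.
pose D := `]0%R, +oo[%classic : set R.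
pose phi := (fun p : R * R => if (0 < p.2)%R && (p.2 < 2 * p.1)%R then p.1 ^+ 2 else -1)%R.
have mphi : measurable_fun setT (phi : _ -> measurableTypeR R).
  apply: measurable_fun_ifT => //.
    by apply: measurable_and; apply: measurable_fun_ltr => //; exact: measurable_funM.
  by apply: (measurable_funX 2); exact: measurable_fst.
pose nu1 := measure_function_pushforward__canonical__measure_function_Measure P mphi.
have mD : measurable (D : set (measurableTypeR R)) by exact: measurable_itv.
have mN : measurable (`]-oo, 0%R]%classic : set (measurableTypeR R)) by exact: measurable_itv.
have intP (f : R -> \bar R) : measurable_fun [set: R] f -> (forall r, 0 <= f r) ->
   \int[nu1]_(v in D) f v = \int[mu]_z (if (0 < z)%R then (2 * z)%:E * f (z ^+ 2)%R else 0).
  move=> mf f0.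
  rewrite ge0_integral_pushforward//; last exact: measurable_funTS.
  rewrite (@integral_if _ _ P _ (fun p => 0 < phi p)%R); last by move=> p; rewrite /D/= in_itv/= andbT.
  rewrite fubini_tonelli1.
  - apply: eq_integral => z _; rewrite /fubini_F /phi/=.
    rewrite -[RHS](_ : \int[mu]_(w in `]0%R, (2 * z)%R[) (cst (f (z ^+ 2)%R)) w = _); last first.
      rewrite integral_cst//= lebesgue_measure_itv/= lte_fin pmulr_rgt0//.
      by case: ifPn => _; rewrite ?mule0// oppr0 addr0 muleC.
    rewrite [RHS](@integral_if _ _ mu _ (fun w => 0 < w < 2 * z)%R); last by move=> w; rewrite /= in_itv.
    apply: eq_integral => w _; case: (boolP (0 < w < 2 * z)%R) => [/andP[w0 wz]|h].
      by rewrite exprn_gt0//; lra.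
    by rewrite ltr0N1.
  - apply: measurable_fun_ifT => //; last exact: measurableT_comp.
    exact: measurable_fun_ltr.
  - by move=> x; case: ifPn => // _; exact: f0.
have H1 A : measurable A -> mu A = measure_add (mrestr nu1 mD) (mrestr mu mN) A.
  apply: lebesgue_measure_unique => // _ [[a b]] _ <-/=.
  have [ba|ab] := leP b a; first by rewrite set_itv_ge ?measure0//= -leNgt bnd_simp.
  transitivity (mrestr nu1 mD `]a, b]%classic + mrestr mu mN `]a, b]%classic); last by rewrite -measure_addE.
  have mab : measurable (`]a, b]%classic : set R) by exact: measurable_itv.
  rewrite /mrestr.
  have -> : nu1 (`]a, b]%classic `&` D) = ((Num.sqrt b) ^+ 2 - (Num.sqrt a) ^+ 2)%:E.
    transitivity (\int[nu1]_(v in D) (\1_(`]a, b]%classic : set R) v)%:E).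
      by rewrite integral_indic.
    rewrite intP; [|exact/measurable_EFinP/measurable_indic|by move=> r; rewrite lee_fin].
    have mm : (Num.sqrt a <= Num.sqrt b)%R by exact/ler_wsqrtr/ltW.
    transitivity (\int[mu]_(x in `]Num.sqrt a, Num.sqrt b]) (2 * x)%:E).
      rewrite [RHS](@integral_if _ _ mu _ (fun x => Num.sqrt a < x <= Num.sqrt b)%R);
        last by move=> x; rewrite /= in_itv.
      apply: eq_integral => z _.
      have [z0|z0] := ltP 0%R z; last first.
        by rewrite ltNge (le_trans z0 (sqrtr_ge0 a)).
      rewrite indicE mem_setE in_itv/= sqrtr_lt_sqr// [(z <= _)%R]leNgt sqrtr_lt_sqr// -leNgt.
      by case: ifP => _; rewrite ?mule1 ?mule0.
    by rewrite integral_id_itv.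
  rewrite (_ : _ `&` _ = `]a, (Num.min b 0)%R]%classic); last first.
    by apply/seteqP; split => x /=; rewrite !in_itv/= le_min; [move=> [/andP[-> ->] ->]|move=> /and3P[-> -> ->]].
  rewrite !lebesgue_measure_itv/= !lte_fin lt_min.
  have [b0|b0] := leP 0%R b; have [a0|a0] := leP 0%R a;
    rewrite ?(sqr_sqrtr b0) ?(sqr_sqrtr a0) ?(ltr0_sqrtr b0) ?(ltr0_sqrtr a0) ?expr0n/=
      ab ?andbF ?a0 ?andbT ?(ltNge a) ?a0/= -?EFinD; congr (_%:E); lra.
transitivity (\int[mu]_(v in D) H v); first by rewrite integral_itv0y.
rewrite -intP//; apply: eq_measure_integral => A mA AD; transitivity (measure_add (mrestr nu1 mD) (mrestr mu mN) A); first exact: H1.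
rewrite measure_addE; change (nu1 (A `&` D) + mu (A `&` `]-oo, 0%R]%classic) = nu1 A).
rewrite (setIidl AD) (_ : A `&` _ = set0) ?measure0 ?adde0//.
rewrite -subset0 => x [/AD]; rewrite /D/= !in_itv/= andbT; lra.
Qed.

(** The substitution v = z^2: the two square roots of v contribute equally, so
    that the weight is v^(-1/2), not v^(-1/2) / 2. *)
Lemma ge0_integral_comp_sqr (F : R -> \bar R) :
  measurable_fun [set: R] F -> (forall r, 0 <= F r) ->
  \int[mu]_z F (z ^+ 2)%R =
  \int[mu]_v (if (0 < v)%R then (v `^ (- 2^-1))%:E * F v else 0).
Proof.
move=> mF F0.
have mFs : measurable_fun [set: R] (fun z => F (z ^+ 2)%R) by exact: (measurableT_comp mF).
have mif (P : R -> bool) : measurable_fun setT P ->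
    measurable_fun [set: R] (fun z : R => if P z then F (z ^+ 2)%R else 0).
  by move=> mP; apply: measurable_fun_ifT.
have F0s : \int[mu]_z F (z ^+ 2)%R = \int[mu]_z (if (0 < z)%R then F (z ^+ 2)%R else 0)
   + \int[mu]_z (if (z < 0)%R then F (z ^+ 2)%R else 0).
  rewrite -ge0_integralD//=; last 4 first.
    by move=> x _; case: ifP.
    by apply: mif; exact: measurable_fun_ltr.
    by move=> x _; case: ifP.
    by apply: mif; exact: measurable_fun_ltr.
  apply: ae_eq_integral => //.
  - by apply: emeasurable_funD; apply: mif; exact: measurable_fun_ltr.
  - exists [set 0%R]; split => //; first exact: lebesgue_measure_set1.
    move=> z /=; apply: contra_notP => /eqP z0 _.
    by case: (ltrgt0P z) z0 => //; rewrite ?adde0 ?add0e.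
rewrite F0s; have -> : \int[mu]_z (if (z < 0)%R then F (z ^+ 2)%R else 0) =
   \int[mu]_z (if (0 < z)%R then F (z ^+ 2)%R else 0).
  rewrite -ge0_integral_opp; last 2 first.
    by apply: mif; exact: measurable_fun_ltr.
    by move=> x; case: ifP.
  by apply: eq_integral => z _; rewrite oppr_lt0 sqrrN.
rewrite [RHS](@ge0_integral_sqr (fun v => (v `^ (- 2^-1))%:E * F v)); last 2 first.
  by apply: emeasurable_funM => //; apply/measurable_EFinP; exact: measurable_powR.
  by move=> r; rewrite mule_ge0// lee_fin powR_ge0.
rewrite -ge0_integralD//=; last 4 first.
    by move=> x _; case: ifP.
    by apply: mif; exact: measurable_fun_ltr.
    by move=> x _; case: ifP.
    by apply: mif; exact: measurable_fun_ltr.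
apply: eq_integral => z _; case: ifPn => z0; last by rewrite adde0.
rewrite muleA -EFinM -powR_mulrn ?(ltW z0)// -powRrM.
rewrite (_ : 2%:R * - 2^-1 = - 1)%R ; last by field.
by rewrite powR_inv1 ?(ltW z0)// mulfK ?gt_eqF// -mule2n mule_natl.
Qed.

End OneD.

(** * Powers, the Gamma function and Beta integrals *)

(** With powers extended by 0 to the whole line, Beta integrals are
    convolutions over R, and translations need no change of bounds. *)
Definition ppow {R : realType} (s t : R) : R := if 0 < t then t `^ s else 0.

Lemma measurable_ppow {R : realType} (s : R) : measurable_fun [set: R] (ppow s).
Proof.
apply: measurable_fun_ifT => //.
exact: (measurable_fun_ltr (f := fun=> 0) (g := id)).
Qed.

Lemma measurable_sqrtr {R : realType} : measurable_fun [set: R] (@Num.sqrt R).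
Proof. by apply: continuous_measurable_fun => x; exact: sqrt_continuous. Qed.

(* Measurability by the syntax of the function; what it cannot decide, such as
   the nonnegativity of the integrand of an inner integral, is left as a goal. *)
Ltac mes_step :=
  match goal with
  | H : measurable_fun _ ?F |- measurable_fun _ ?F => exact: H
  | H : measurable_fun _ ?F |- measurable_fun _ (fun x => ?F (@?b x)) => apply: (measurableT_comp H)
  | |- measurable_fun _ (fun x => (@?b x && @?c x)%B) => apply: measurable_and
  | |- measurable_fun _ (fun x => (@?b x < @?c x)%R) => apply: measurable_fun_ltr
  | |- measurable_fun _ (fun x => (@?b x <= @?c x)%R) => apply: measurable_fun_ler
  | |- measurable_fun _ (fun x => (@?b x)%:E) => apply/measurable_EFinP
  | |- measurable_fun _ (fun x => (@?b x * @?c x)%E) => apply: emeasurable_funM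
  | |- measurable_fun _ (fun x => (@?b x + @?c x)%E) => apply: emeasurable_funD
  | |- measurable_fun _ (fun x => (@?b x * @?c x)%R) => apply: measurable_funM
  | |- measurable_fun _ (fun x => (@?b x - @?c x)%R) => apply: measurable_funB
  | |- measurable_fun _ (fun x => (@?b x + @?c x)%R) => apply: measurable_funD
  | |- measurable_fun _ (fun x => (- @?b x)%R) => apply: (measurableT_comp (@oppr_measurable _ setT))
  | |- measurable_fun _ (fun x => (@?b x ^+ ?n)%R) => apply: measurable_funX
  | |- measurable_fun _ (fun x => expR (@?b x)) => apply: (measurableT_comp (@measurable_expR _))
  | |- measurable_fun _ (fun x => (@?b x) `^ ?p) => apply: (measurableT_comp (@measurable_powR _ p))
  | |- measurable_fun _ (fun x => ppow ?p (@?b x)) => apply: (measurableT_comp (measurable_ppow p))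
  | |- measurable_fun _ (ppow ?p) => exact: measurable_ppow
  | |- measurable_fun _ (fun x => Num.sqrt (@?b x)) => apply: (measurableT_comp measurable_sqrtr)
  | |- measurable_fun _ (fun x => fst (@?b x)) => apply: (measurableT_comp measurable_fst)
  | |- measurable_fun _ (fun x => snd (@?b x)) => apply: (measurableT_comp measurable_snd)
  | |- measurable_fun _ (fun x => (@?b x, @?c x)) => apply: measurable_fun_pair
  | |- measurable_fun ?D (fun _ => _) => apply: measurable_fun_ifT
  | |- measurable_fun ?D (fun _ => _) => apply: emeasurable_funD
  | |- measurable_fun ?D (fun _ => _) => apply: emeasurable_funM
  | |- measurable_fun ?D (@Order.lt ?a ?b ?c) => change (measurable_fun D (fun x => @Order.lt a b c x))
  | |- measurable_fun ?D (@Order.le ?a ?b ?c) => change (measurable_fun D (fun x => @Order.le a b c x))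
  | |- measurable_fun ?D (@GRing.mul ?a ?b) => change (measurable_fun D (fun x => @GRing.mul a b x))
  | |- measurable_fun ?D (@GRing.add ?a ?b) => change (measurable_fun D (fun x => @GRing.add a b x))
  end.
Ltac mes := repeat first [done | mes_step].

(* The integration variable lives in a measurable space with carrier R, which
   ring and lra do not see through. *)
Ltac rint t := intros t _; match goal with R : realType |- _ => change (Real.sort R) in t end.

Lemma tonelli d1 d2 (T1 : measurableType d1) (T2 : measurableType d2) (R : realType)
    (m1 : {sigma_finite_measure set T1 -> \bar R}) (m2 : {sigma_finite_measure set T2 -> \bar R})
    (f : T1 -> T2 -> \bar R) :
  measurable_fun [set: T1 * T2] (fun p => f p.1 p.2) -> (forall x y, 0 <= f x y)%E ->
  (\int[m1]_x \int[m2]_y f x y = \int[m2]_y \int[m1]_x f x y)%E.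
Proof. by move=> mf f0; exact: (fubini_tonelli (fun p => f p.1 p.2)). Qed.

Section GammaBeta.
Context {R : realType}.
Local Notation mu := (@lebesgue_measure R).

Lemma ppow_ge0 (s t : R) : (0 <= ppow s t)%R.
Proof. by rewrite /ppow; case: ifP => // _; exact: powR_ge0. Qed.

Lemma ppow_pos (s t : R) : (0 < t)%R -> ppow s t = t `^ s.
Proof. by rewrite /ppow => ->. Qed.

Lemma ppow_npos (s t : R) : (t <= 0)%R -> ppow s t = 0.
Proof. by rewrite /ppow => t0; rewrite ltNge t0. Qed.

Lemma ppowM (s c t : R) : (0 < c)%R -> ppow s (c * t) = (c `^ s * ppow s t)%R.
Proof.
move=> c0; rewrite /ppow pmulr_rgt0//; case: ifPn => t0; last by rewrite mulr0.
by rewrite powRM// ltW.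
Qed.

Lemma gt0_powRD (x r s : R) : 0 < x -> x `^ (r + s) = x `^ r * x `^ s.
Proof. by move=> x0; rewrite powRD// (gt_eqF x0) implybT. Qed.

(** The substitution t = z^2 replaces s by 2 s; after n steps the exponent is
    nonnegative and the integrand bounded. *)
Lemma integral_01_lty n (s : R) : (2^-1 ^+ n <= s)%R ->
  (\int[mu]_t (if 0 < t < 1 then t `^ (s - 1) else 0)%:E < +oo)%E.
Proof.
elim: n s => [|n IH] s sn.
  move: sn; rewrite expr0 => sn.
  apply: (@le_lt_trans _ _ (\int[mu]_t (if 0 < t < 1 then 1 else 0)%:E)%E).
    apply: ge0_le_integral => //=.
    - by move=> t _; case: ifP => _; rewrite lee_fin ?powR_ge0.
    - mes.
    - mes.
    - move=> t _; case: ifPn => // /andP[t0 t1]; rewrite lee_fin.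
      apply: (@le_trans _ _ (t `^ 0)); last by rewrite powRr0.
      by apply: ger_powR; [rewrite t0 ltW|rewrite subr_ge0].
  have -> : (\int[mu]_t (if 0 < t < 1 then 1 else 0)%:E =
      \int[mu]_t (if (0 < t < 1)%R then (cst 1%E) t else 0%E))%E.
    by apply: eq_integral => t _; case: ifP.
  rewrite -(@integral_if _ _ _ mu `]0%R, 1%R[%classic); last by move=> x; rewrite /= in_itv.
  by rewrite integral_cst//= lebesgue_measure_itv/= lte_fin ltr01 oppr0 addr0 mul1e ltey.
have -> : (\int[mu]_t (if 0 < t < 1 then t `^ (s - 1) else 0)%:E =
  2%:E * \int[mu]_t (if 0 < t < 1 then t `^ (2 * s - 1) else 0)%:E)%E.
  pose H t : \bar R := (if (t < 1)%R then t `^ (s - 1) else 0)%:E.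
  transitivity (\int[mu]_v (if (0 < v)%R then H v else 0))%E.
    by apply: eq_integral => t _; rewrite /H; case: (0 < t)%R.
  rewrite ge0_integral_sqr; last 2 first.
    by rewrite /H; mes.
    by move=> r; rewrite /H; case: ifP => _; rewrite lee_fin ?powR_ge0.
  rewrite -ge0_integralZl_EFin//; last 2 first.
    by move=> t _; case: ifP => _; rewrite lee_fin ?powR_ge0.
    by mes.
  apply: eq_integral; rint z; case: ifPn => z0; last by rewrite mule0.
  rewrite /H /= -!EFinM.
  rewrite expr_lt1 ?(ltW z0)//; case: ifPn => // z1; last by rewrite !mulr0.
  congr (_%:E).
  rewrite -mulrA; congr (_ * _)%R.
  rewrite -powR_mulrn ?(ltW z0)// -powRrM -{1}(powRr1 (ltW z0)) -powRD; last by rewrite (gt_eqF z0) implybT.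
  by congr (_ `^ _)%R; ring.
rewrite lte_mul_pinfty// IH//.
move: sn; rewrite exprS; lra.
Qed.

Lemma integral_expRN_lty (c : R) : (0 < c)%R ->
  (\int[mu]_t (if 0 < t then expR (- (c * t)) else 0)%:E < +oo)%E.
Proof.
move=> c0.
have -> : (\int[mu]_t (if 0 < t then expR (- (c * t)) else 0)%:E =
   c^-1%:E * \int[mu]_t (if 0 < t then exponential_pdf c t else 0)%:E)%E.
  rewrite -ge0_integralZl_EFin//.
  - apply: eq_integral => t _; rewrite -EFinM; congr (_%:E).
    case: ifPn => t0; last by rewrite mulr0.
    by rewrite exponential_pdfE ?ltW// mulrA mulVf ?gt_eqF// mul1r mulNr.
  - by move=> t _; rewrite lee_fin; case: ifP => // _; apply: exponential_pdf_ge0; exact: ltW.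
  - have mE := measurable_exponential_pdf c; mes.
  - by rewrite invr_ge0 ltW.
apply: lte_mul_pinfty; rewrite ?lee_fin ?invr_ge0 ?(ltW c0)//.
apply: (@le_lt_trans _ _ (\int[mu]_t (exponential_pdf c t)%:E)%E).
  have mE := measurable_exponential_pdf c.
  apply: ge0_le_integral => //=; [|by mes|by mes|].
    by move=> t _; rewrite lee_fin; case: ifP => // _; apply: exponential_pdf_ge0; exact: ltW.
  by move=> t _; case: ifP => // _; rewrite lee_fin; apply: exponential_pdf_ge0; exact: ltW.
by rewrite integral_exponential_pdf// ltry.
Qed.

(** For t >= 1 the power is absorbed by half of the exponential; below 1 the
    exponential is at most 1. *)
Lemma integral_ppow_expR_lty (s c : R) : 0 < s -> 0 < c ->
  (\int[mu]_t (ppow (s - 1) t * expR (- (c * t)))%:E < +oo)%E.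
Proof.
move=> s0 c0.
have [n sn] : exists n, 2^-1 ^+ n <= s.
  have [n] : exists n, s^-1 < n%:R by exists (Num.truncn s^-1).+1; exact: truncnS_gt.
  move=> sn; exists n; rewrite exprVn -[leRHS]invrK lef_pV2 ?posrE ?exprn_gt0 ?invr_gt0//.
  apply: (le_trans (ltW sn)); rewrite -natrX ler_nat ltnW//; exact: ltn_expl.
have [N sN] : exists N : nat, s - 1 <= N.+1%:R.
  by exists (Num.truncn (s - 1)); rewrite ltW// truncnS_gt.
pose K := N.+1`!%:R / (c / 2) ^+ N.+1.
have K0 : 0 < K by rewrite divr_gt0 ?ltr0n ?fact_gt0// exprn_gt0// divr_gt0.
have h (t : R) : 1 <= t -> ppow (s - 1) t * expR (- (c * t)) <= K * expR (- ((c / 2) * t)).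
  move=> t1; have t0 : 0 < t by lra.
  rewrite ppow_pos//.
  have e1 : t `^ (s - 1) <= K * expR (c / 2 * t).
    apply: (le_trans (ler_powR t1 sN)); rewrite powR_mulrn ?(ltW t0)//.
    have ct0 : 0 <= c / 2 * t by rewrite mulr_ge0 ?(ltW t0)//; lra.
    have := expR_ge1Dxn N ct0.
    rewrite -lerBrDl => /le_trans/(_ (_ : _ <= expR (c / 2 * t))) H.
    have {}H : (c / 2 * t) ^+ N.+1 / N.+1`!%:R <= expR (c / 2 * t) by apply: H; lra.
    by rewrite -ler_pdivrMl// (le_trans _ H)// /K invf_div mulrAC -exprMn lexx.
  have -> : - (c * t) = - (c / 2 * t) + - (c / 2 * t) by field.
  rewrite expRD mulrA ler_wpM2r ?expR_ge0//.
  by rewrite -(ler_pM2r (expR_gt0 (c / 2 * t))) -[leLHS]mulrA expRN mulVf ?gt_eqF ?expR_gt0// mulr1.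
apply: (@le_lt_trans _ _ (\int[mu]_t ((if 0 < t < 1 then t `^ (s - 1) else 0)%:E +
    K%:E * (if 0 < t then expR (- (c / 2 * t)) else 0)%:E))%E).
  apply: ge0_le_integral => //=.
  - by move=> t _; rewrite lee_fin mulr_ge0 ?ppow_ge0 ?expR_ge0.
  - mes.
  - by mes.
  - move=> t _; rewrite -EFinM -EFinD lee_fin.
    have [t0|t0] := ltP 0 t; last by rewrite ppow_npos// mul0r mulr0 addr0.
    have [t1|t1] /= := ltP t 1; last by rewrite add0r h.
    rewrite ppow_pos// -[leLHS]addr0 lerD//; last by rewrite mulr_ge0 ?expR_ge0 ?ltW.
    by rewrite ler_piMr ?powR_ge0// expR_le1 oppr_le0 mulr_ge0 ?ltW.
rewrite ge0_integralD//; last 4 first.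
- by move=> t _; case: ifP => _; rewrite lee_fin ?powR_ge0.
- by mes.
- move=> t _; rewrite mule_ge0 ?lee_fin//; first exact: ltW.
  by case: ifP => // _; exact: expR_ge0.
- by mes.
rewrite lte_add_pinfty//; first exact: integral_01_lty sn.
rewrite ge0_integralZl_EFin//; last 3 first.
- by move=> t _; case: ifP => _; rewrite lee_fin ?expR_ge0.
- by mes.
- exact: ltW.
by rewrite lte_mul_pinfty ?lee_fin ?ltW//; apply: integral_expRN_lty; lra.
Qed.

Lemma GammaE (s : R) : 0 < s ->
  (Gamma s)%:E = (\int[mu]_t (ppow (s - 1) t * expR (- t))%:E)%E.
Proof.
move=> s0; rewrite /Gamma /Rintegral.
have -> : (\int[mu]_(t in `]0%R, +oo[) (t `^ (s - 1) * expR (- t))%:E =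
   \int[mu]_t (ppow (s - 1) t * expR (- t))%:E)%E.
  rewrite integral_itv0y; apply: eq_integral => t _.
  by rewrite /ppow; case: ifP => _; rewrite ?mul0r.
rewrite fineK// ge0_fin_numE.
  have := integral_ppow_expR_lty s0 ltr01.
  by under eq_integral do rewrite mul1r.
by apply: integral_ge0 => t _; rewrite lee_fin mulr_ge0 ?ppow_ge0 ?expR_ge0.
Qed.

(** Restricting Euler's integral to (0, 1], to (0, 3] or to (1, 3], according to
    the position of s with respect to 1 and 2, the power can be replaced by 1 or
    t, and the integrals are explicit. *)
Lemma Gamma_ge_half (s : R) : 0 < s -> 2^-1 <= Gamma s.
Proof.
move=> s0; rewrite -lee_fin GammaE//.
pose q : R := expR (-1).
have [x1 x2] : (3/4) ^+ 4 <= q /\ q <= (4/5) ^+ 4.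
  have -> : q = expR (- 4^-1) ^+ 4 by rewrite -expRM_natl; congr expR; field.
  split; rewrite lerXn2r ?nnegrE ?expR_ge0//.
    by have := expR_ge1Dx (- 4^-1 : R); lra.
  rewrite expRN -[leRHS]invrK lef_pV2 ?posrE ?invr_gt0 ?expR_gt0//.
  by have := expR_ge1Dx (4^-1 : R); lra.
have x3 : expR (-3) = q ^+ 3 by rewrite -expRM_natl; congr expR; ring.
have lb (A : R -> bool) (h : R -> R) : measurable_fun setT A -> measurable_fun setT h ->
  (forall t, A t -> 0 <= h t <= ppow (s - 1) t * expR (- t)) ->
  (\int[mu]_t (if A t then h t else 0)%:E <= \int[mu]_t (ppow (s - 1) t * expR (- t))%:E)%E.
  move=> mA mh Ah; apply: ge0_le_integral => //=.
  - by move=> t _; rewrite lee_fin; case: ifP => // /Ah /andP[].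
  - by mes.
  - by mes.
  - move=> t _; rewrite lee_fin; case: ifPn => [/Ah/andP[]//|_].
    by rewrite mulr_ge0 ?ppow_ge0 ?expR_ge0.
have dE (x : R) : is_derive x 1 (fun z : R => - expR (- z)) (expR (- x)).
  by apply: is_derive_eq; rewrite /GRing.scale/=; ring.
have dE' (x : R) : is_derive x 1 (fun z : R => - ((z + 1) * expR (- z))) (x * expR (- x)).
  by apply: is_derive_eq; rewrite /GRing.scale/=; ring.
have ftc (F f : R -> R) (u v : R) : u < v -> (forall x : R, is_derive x 1 F (f x)) -> continuous f ->
    (\int[mu]_t (if (u < t <= v)%R then f t else 0)%:E)%E = (F v - F u)%:E.
  move=> uv dF cf.
  have cF : continuous F by move=> z; apply/differentiable_continuous/derivable1_diffP/ex_derive.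
  transitivity (\int[mu]_(t in `]u, v]) (f t)%:E)%E.
    rewrite [RHS](@integral_if _ _ _ mu _ (fun t => u < t <= v)); last by move=> z; rewrite /= in_itv.
    by apply: eq_integral => t _; case: ifP.
  rewrite integral_itv_obnd_cbnd; last first.
    by apply/measurable_EFinP; apply: measurable_funTS; exact: continuous_measurable_fun.
  rewrite (@continuous_FTC2 _ f F) ?EFinB//.
  - exact: continuous_subspaceT.
  - by split; [move=> z _; apply: ex_derive|apply: cvg_at_right_filter; exact: cF|apply: cvg_at_left_filter; exact: cF].
  - by move=> z _; rewrite derive1E; apply: derive_val.
have c1 : continuous (fun z : R => expR (- z)).
  by move=> z; apply: continuous_comp; [exact: opp_continuous|exact: continuous_expR].
have c2 : continuous (fun z : R => z * expR (- z)).
  by move=> z; apply: cvgM; [exact: cvg_id|exact: c1].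
have [s1|s1] := leP s 1.
  apply: le_trans (lb (fun t => 0 < t <= 1) (fun t => expR (- t)) _ _ _).
  - rewrite (ftc _ _ _ _ ltr01 dE c1) lee_fin oppr0 expR0 -/q; lra.
  - by mes.
  - by mes.
  - move=> t /andP[t0 t1]; rewrite expR_ge0/= ppow_pos// ler_peMl ?expR_ge0//.
    by apply: (@le_trans _ _ (t `^ 0)); [rewrite powRr0|apply: ger_powR; [rewrite t0|lra]].
have [s2|s2] := leP s 2.
  pose h (t : R) : R := if t <= 1 then t * expR (- t) else expR (- t).
  apply: le_trans (lb (fun t => 0 < t <= 3) h _ _ _).
  - rewrite (eq_integral (fun t : measurableTypeR R => (if 0 < (t : R) <= 1 then t * expR (- t) else 0)%:E +
        (if 1 < t <= 3 then expR (- t) else 0)%:E)%E); last first.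
      move=> t _; rewrite /h -EFinD; congr (_%:E).
      have [t1|t1] := leP t 1; first by rewrite addr0 (le_trans t1) ?andbT//; lra.
      by rewrite andbF add0r (lt_trans ltr01 t1).
    rewrite ge0_integralD//; last 4 first.
    + by move=> t _; case: ifP => // /andP[t0 _]; rewrite lee_fin mulr_ge0 ?expR_ge0 ?ltW.
    + by mes.
    + by move=> t _; case: ifP => // _; rewrite lee_fin ?expR_ge0.
    + by mes.
    rewrite (ftc _ _ _ _ ltr01 dE' c2) (ftc _ _ _ _ _ dE c1) ?ltr1n//.
    rewrite -EFinD lee_fin x3 oppr0 expR0 -/q; nra.
  - by mes.
  - by rewrite /h; mes.
  - move=> t /andP[t0 _]; rewrite /h ppow_pos//; case: (leP t 1) => t1.
      rewrite (mulr_ge0 (ltW t0) (expR_ge0 _)) ler_wpM2r ?expR_ge0//.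
      by apply: (@le_trans _ _ (t `^ 1)); [rewrite (powRr1 (ltW t0))|apply: ger_powR; [rewrite t0|lra]].
    rewrite expR_ge0/= ler_peMl ?expR_ge0//.
    by apply: (@le_trans _ _ (t `^ 0)); [rewrite powRr0|apply: ler_powR; lra].
apply: le_trans (lb (fun t => 1 < t <= 3) (fun t => t * expR (- t)) _ _ _).
- rewrite (ftc _ _ _ _ _ dE' c2) ?ltr1n// lee_fin x3 -/q.
  have h1 : 0 <= (q - (3/4)^+4) * ((4/5)^+4 - q) by apply: mulr_ge0; lra.
  have h2 : 0 <= (q - (3/4)^+4) * ((4/5)^+4 - q) * q by apply: mulr_ge0 => //; lra.
  nra.
- by mes.
- by mes.
- move=> t /andP[t1 _]; rewrite mulr_ge0 ?expR_ge0//=; last lra.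
  rewrite ppow_pos ?ler_wpM2r ?expR_ge0//; last lra.
  by apply: (@le_trans _ _ (t `^ 1)); [rewrite powRr1; lra|apply: ler_powR; lra].
Qed.

(** The left-hand side is homogeneous in x of degree a + b - 1, so only its value
    at 1 is unknown; integrated against exp(- x), it factors by Tonelli's theorem
    into Gamma a * Gamma b. *)
Lemma ppow_beta (a b x : R) : 0 < a -> 0 < b ->
  (\int[mu]_t (ppow (a - 1) t * ppow (b - 1) (x - t))%:E)%E =
  (Gamma a * Gamma b / Gamma (a + b) * ppow (a + b - 1) x)%:E.
Proof.
move=> a0 b0; have G0 (s : R) : 0 < s -> 0 < Gamma s by move=> /Gamma_ge_half; lra.
pose K x := (\int[mu]_t (ppow (a - 1) t * ppow (b - 1) (x - t))%:E)%E.
have K0 (y : R) : (0 <= K y)%E by apply: integral_ge0 => t _; rewrite lee_fin mulr_ge0 ?ppow_ge0.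
have Kscale (y : R) : 0 < y -> K y = ((y `^ (a + b - 1))%:E * K 1%R)%E.
  move=> y0; rewrite {1}/K [LHS](ge0_integral_scale y0); last 2 first.
    by mes.
    by move=> t; rewrite lee_fin mulr_ge0 ?ppow_ge0.
  have -> : (y `^ (a + b - 1)) = y * y `^ (a - 1) * y `^ (b - 1).
    rewrite -{2}(powRr1 (ltW y0)) -!gt0_powRD//.
    by congr (_ `^ _); ring.
  rewrite -!mulrA EFinM -muleA; congr (_ * _)%E.
  rewrite -ge0_integralZl_EFin//; last 3 first.
  - by move=> t _; rewrite lee_fin mulr_ge0 ?ppow_ge0.
  - by mes.
  - by rewrite mulr_ge0 ?powR_ge0.
  apply: eq_integral => t _; rewrite -EFinM; congr (_%:E).
  by rewrite -{2}[y]mulr1 -mulrBr !ppowM//; ring.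
have Kneg (y : R) : y <= 0 -> K y = 0%E.
  move=> y0; rewrite /K integral0_eq// => t _.
  have [t0|t0] := ltP 0 t; last by rewrite ppow_npos// mul0r.
  by rewrite mulrC ppow_npos ?mul0r//; lra.
have H : ((Gamma a * Gamma b)%:E = K 1%R * (Gamma (a + b))%:E)%E.
  rewrite EFinM [in RHS]GammaE ?addr_gt0// muleC (GammaE b0).
  transitivity (\int[mu]_t \int[mu]_u (ppow (a - 1) t * ppow (b - 1) (u - t) * expR (- u))%:E)%E.
    rewrite (GammaE a0) -ge0_integralZl//; last 3 first.
    - by mes.
    - by move=> t _; rewrite lee_fin mulr_ge0 ?ppow_ge0 ?expR_ge0.
    - by apply: integral_ge0 => t _; rewrite lee_fin mulr_ge0 ?ppow_ge0 ?expR_ge0.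
    apply: eq_integral; rint t; rewrite muleC -ge0_integralZl_EFin//; last 3 first.
    - by move=> u _; rewrite lee_fin mulr_ge0 ?ppow_ge0 ?expR_ge0.
    - by mes.
    - by rewrite mulr_ge0 ?ppow_ge0 ?expR_ge0.
    rewrite -(@ge0_integral_shift _ t); last 2 first.
    - by mes.
    - by move=> u; rewrite lee_fin !mulr_ge0 ?ppow_ge0 ?expR_ge0.
    apply: eq_integral; rint u; rewrite -EFinM addrK; congr (_%:E).
    by rewrite opprD expRD; ring.
  rewrite tonelli; last 2 first.
  - by mes.
  - by move=> t u; rewrite lee_fin !mulr_ge0 ?ppow_ge0 ?expR_ge0.
  rewrite -ge0_integralZl//; last 2 first.
  - by mes.
  - by move=> t _; rewrite lee_fin mulr_ge0 ?ppow_ge0 ?expR_ge0.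
  apply: eq_integral; rint u.
  transitivity (K u * (expR (- u))%:E)%E.
    rewrite muleC -ge0_integralZl_EFin ?expR_ge0//; last 2 first.
    - by move=> t _; rewrite lee_fin mulr_ge0 ?ppow_ge0.
    - by mes.
    by apply: eq_integral => t _; rewrite -EFinM mulrC.
  have [u0|u0] := ltP 0 u; last by rewrite Kneg// ppow_npos// mul0r mule0 mul0e.
  by rewrite Kscale// ppow_pos// EFinM muleA [(K 1%R * _)%E]muleC.
have KE : K 1 = (Gamma a * Gamma b / Gamma (a + b))%:E.
  have g0 : Gamma (a + b) != 0 by rewrite gt_eqF// G0// addr_gt0.
  move: H; case: (K 1) (K0 1) => [r _ [->]|_|//].
    by rewrite mulfK.
  by rewrite gt0_mulye ?lte_fin ?G0 ?addr_gt0.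
rewrite -/(K x); have [x0|x0] := ltP 0 x; last by rewrite Kneg// ppow_npos// mulr0.
by rewrite Kscale// KE ppow_pos// -EFinM mulrC.
Qed.

Lemma Gamma_half : Gamma (2^-1 : R) = Num.sqrt pi.
Proof.
have h0 : 0 < (2^-1 : R) by rewrite invr_gt0.
apply/EFin_inj; rewrite GammaE// -integralT_gauss.
rewrite [RHS](@ge0_integral_comp_sqr _ (fun v => (expR (- v))%:E)); last 2 first.
- by mes.
- by move=> v; rewrite lee_fin expR_ge0.
apply: eq_integral => t _; rewrite /ppow; case: ifP => _; rewrite ?mul0r//.
by rewrite -EFinM; congr (_ `^ _ * _)%:E; field.
Qed.

End GammaBeta.

(** * Polar and axial coordinates in R^n *)

Lemma measurable_comp2 d (T : measurableType d) (R : realType) d1 (U : measurableType d1) (Phi : R -> R -> U) (f g : T -> R) :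
  measurable_fun [set: R * R] (fun p => Phi p.1 p.2) ->
  measurable_fun [set: T] f -> measurable_fun [set: T] g -> measurable_fun [set: T] (fun x => Phi (f x) (g x)).
Proof.
move=> mP mf mg.
exact: (measurableT_comp mP (measurable_fun_pair mf mg)).
Qed.

Lemma measurable_integral2 d1 d2 (T1 : measurableType d1) (T2 : measurableType d2) (R : realType)
    (m2 : {sigma_finite_measure set T2 -> \bar R}) (f : T1 -> T2 -> \bar R) :
  measurable_fun [set: T1 * T2] (fun p => f p.1 p.2) -> (forall x y, 0 <= f x y)%E ->
  measurable_fun [set: T1] (fun x => \int[m2]_y f x y)%E.
Proof.
move=> mf f0; exact: (measurable_fun_fubini_tonelli_F (fun p => f p.1 p.2)).
Qed.

Section Vectors.
Context {R : realType}.
Local Notation mu := (@lebesgue_measure R).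
Local Notation leb n := (@lebesgue_rV R n).

Definition sqn n (v : 'rV[R]_n) : R := \sum_(i < n) v ord0 i ^+ 2.

Lemma sqn_ge0 n (v : 'rV[R]_n) : 0 <= sqn v.
Proof. by apply: sumr_ge0 => i _; rewrite sqr_ge0. Qed.

Lemma enormE n (v : 'rV[R]_n) : enorm v = Num.sqrt (sqn v).
Proof. by []. Qed.

Lemma enorm_sqr n (v : 'rV[R]_n) : enorm v ^+ 2 = sqn v.
Proof. by rewrite enormE sqr_sqrtr ?sqn_ge0. Qed.

Lemma enorm_ge0 n (v : 'rV[R]_n) : 0 <= enorm v.
Proof. exact: sqrtr_ge0. Qed.

Lemma sqn_cons n (p : measurableTypeR R * 'rV[R]_n) : sqn (consrV p) = (p.1 : R) ^+ 2 + sqn p.2.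
Proof.
rewrite /sqn big_ord_recl consrVE0; congr (_ + _).
by apply: eq_bigr => i _; rewrite consrVES.
Qed.

Lemma sqn0 (v : 'rV[R]_0) : sqn v = 0.
Proof. by rewrite /sqn big_ord0. Qed.

Lemma measurable_sqn n : measurable_fun [set: 'rV[R]_n] (@sqn n).
Proof.
apply: measurable_sum => i; apply: measurable_funX; exact: measurable_coord.
Qed.

Lemma measurable_rVB d (T : measurableType d) n (f g : T -> 'rV[R]_n) :
  measurable_fun [set: T] f -> measurable_fun [set: T] g ->
  measurable_fun [set: T] (fun x => f x - g x).
Proof.
move=> mf mg; apply/measurable_fun_rVP => i.
under eq_fun do rewrite !mxE.
apply: measurable_funB.
  exact: (measurableT_comp (measurable_coord i) mf).
exact: (measurableT_comp (measurable_coord i) mg).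
Qed.

Lemma measurable_cons d (T : measurableType d) n (f : T -> R) (g : T -> 'rV[R]_n) :
  measurable_fun [set: T] f -> measurable_fun [set: T] g ->
  measurable_fun [set: T] (fun x => consrV (f x, g x)).
Proof.
by move=> mf mg; apply: (measurableT_comp (@measurable_consrV R n)); exact: measurable_fun_pair.
Qed.

Lemma consrVB n (p q : measurableTypeR R * 'rV[R]_n) :
  consrV p - consrV q = consrV ((p.1 : R) - q.1, p.2 - q.2).
Proof.
apply/rowP => i; transitivity ((consrV p : 'rV[R]_n.+1) ord0 i - (consrV q : 'rV[R]_n.+1) ord0 i).
  by rewrite [LHS]mxE [X in _ + X = _]mxE.
case: (unliftP ord0 i) => [j|] ->.
  by rewrite !consrVES !mxE.
by rewrite !consrVE0.
Qed.

Lemma ge0_integral_consrV n (F : 'rV[R]_n.+1 -> \bar R) :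
  measurable_fun setT F -> (forall v, 0 <= F v)%E ->
  (\int[leb n.+1]_v F v = \int[mu]_a \int[leb n]_w F (consrV (a, w)))%E.
Proof.
move=> mF F0.
pose P := (mu \x leb n)%E.
pose nu := measure_function_pushforward__canonical__measure_function_Measure P (@measurable_consrV R n).
transitivity (\int[nu]_v F v)%E; first by apply: eq_measure_integral.
rewrite ge0_integral_pushforward//.
rewrite preimage_setT fubini_tonelli1//; last by move=> p; exact: F0.
- exact: (measurableT_comp mF (@measurable_consrV R n)).
- exact: measurable_consrV.
Qed.

Lemma integral_rV0 (F : 'rV[R]_0 -> \bar R) : (\int[leb 0]_v F v = F 0%R)%E.
Proof.
rewrite (eq_measure_integral (\d_(0 : 'rV[R]_0))) //.
rewrite integral_dirac//; first by rewrite diracT mul1e.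
move=> _ Y mY; rewrite setTI.
have [h|h] := pselect (Y (F 0)).
  rewrite (_ : _ @^-1` _ = setT)//; apply/seteqP; split => // v _ /=.
  by rewrite (_ : v = 0)//; apply/rowP => -[].
rewrite (_ : _ @^-1` _ = set0)//; apply/seteqP; split => // v /=.
by rewrite (_ : v = 0)//; apply/rowP => -[].
Qed.

Lemma mule_congr (a b c : \bar R) : b = c -> (a * b = a * c)%E.
Proof. by move=> ->. Qed.

End Vectors.

Ltac mes_step_rV :=
  match goal with
  | H : measurable_fun _ (fun p => ?F (fst p) (snd p)) |- measurable_fun _ (fun x => ?F (@?b x) (@?c x)) =>
      apply: (measurable_comp2 H)
  | |- measurable_fun _ (@sqn _ ?n) => exact: measurable_sqn
  | |- measurable_fun _ (fun x => @sqn _ ?n (@?b x)) => apply: (measurableT_comp (@measurable_sqn _ n))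
  | |- measurable_fun _ (fun x => @enorm _ ?n (@?b x)) => apply: (measurableT_comp measurable_sqrtr (f := fun x => @sqn _ n (b x)))
  | |- measurable_fun _ (fun x => consrV (@?b x, @?c x)) => apply: measurable_cons
  | |- measurable_fun (T := ?T) (U := ?U) ?D (fun x => @?b x - @?c x)%R => apply: measurable_rVB
  | |- measurable_fun _ (fun x => \int[_]_y _)%E => apply: measurable_integral2
  | |- _ => mes_step
  end.
Ltac mes ::= repeat first [done | mes_step_rV].
(* Unification would otherwise try to unfold these definitions. *)
Opaque integral lebesgue_rV Gamma.

Section Vectors2.
Context {R : realType}.
Local Notation mu := (@lebesgue_measure R).
Local Notation leb n := (@lebesgue_rV R n).

Lemma ge0_integral_rV_sub n (x : 'rV[R]_n) (F : 'rV[R]_n -> \bar R) :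
  measurable_fun setT F -> (forall v, 0 <= F v)%E ->
  (\int[leb n]_v F (x - v)%R = \int[leb n]_v F v)%E.
Proof.
elim: n x F => [|n IH] x F mF F0.
  by rewrite !integral_rV0; congr F; apply/rowP => -[].
have mFx : measurable_fun setT (fun v : 'rV[R]_n.+1 => F (x - v)) by mes.
rewrite (ge0_integral_consrV mFx (fun v => F0 _)) (ge0_integral_consrV mF F0) -(unconsrVK x).
set x1 : R := (unconsrV x).1.
transitivity (\int[mu]_a (\int[leb n]_w F (consrV ((x1 - a)%R, w)))%E)%E.
  apply: eq_integral => a _.
  rewrite -(IH (unconsrV x).2 (fun w => F (consrV ((x1 - a)%R, w)))); last 2 first.
    by mes.
    by [].
  by apply: eq_integral => w _; rewrite consrVB.
have m1 : measurable_fun setT (fun a : R => \int[leb n]_w F (consrV (a, w)))%E by mes.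
have p1 (a : R) : (0 <= \int[leb n]_w F (consrV (a, w)))%E by exact: integral_ge0.
rewrite -[RHS](ge0_integral_opp m1 p1).
rewrite -[RHS](@ge0_integral_shift _ (- x1) (fun a => \int[leb n]_w F (consrV ((- a)%R, w)))%E); last 2 first.
  by mes.
  by move=> r; exact: p1.
by apply: eq_integral; rint a; rewrite opprD opprK addrC.
Qed.

(** Half the area of the unit sphere of R^n, since v = |x|^2 has dv = 2 r dr. *)
Definition kap (n : nat) : R := pi `^ (n%:R / 2) / Gamma (n%:R / 2).

(** By induction on the dimension: a new coordinate a has a^2 distributed as
    v^(-1/2) dv, and adding a^2 to the squared norm of the others convolves the
    two power weights, which is a Beta integral with parameters (n+1)/2 and 1/2. *)
Lemma ge0_integral_radial n (F : R -> \bar R) :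
  measurable_fun setT F -> (forall v, 0 <= F v)%E ->
  (\int[leb n.+1]_v F (sqn v) =
   (kap n.+1)%:E * \int[mu]_v ((ppow (n.+1%:R / 2 - 1) v)%:E * F v))%E.
Proof.
move=> mF F0; elim: n F mF F0 => [|n IH] F mF F0.
  rewrite ge0_integral_consrV//; last by mes.
  transitivity (\int[mu]_a F (a ^+ 2)%R)%E.
    by apply: eq_integral => a _; rewrite integral_rV0 sqn_cons sqn0 addr0.
  rewrite ge0_integral_comp_sqr// /kap mul1r Gamma_half powR12_sqrt ?pi_ge0// divff; last first.
    by rewrite gt_eqF// sqrtr_gt0 pi_gt0.
  rewrite mul1e; apply: eq_integral => v _.
  rewrite /ppow; case: ifP => _; rewrite ?mul0e//.
  by congr ((_ `^ _)%:E * _)%E; field.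
rewrite ge0_integral_consrV//; last by mes.
transitivity (\int[mu]_a \int[leb n.+1]_w F (a ^+ 2 + sqn w)%R)%E.
  by apply: eq_integral => a _; apply: eq_integral => w _; rewrite sqn_cons.
transitivity (\int[mu]_a ((kap n.+1)%:E * \int[mu]_v ((ppow (n.+1%:R / 2 - 1) v)%:E * F (a ^+ 2 + v)%R)))%E.
  by apply: eq_integral => a _; rewrite (IH (fun v => F (a ^+ 2 + v)))//; mes.
have g0 (s : R) : 0 < s -> 0 < Gamma s.
  by move=> /Gamma_ge_half; apply: lt_le_trans; rewrite invr_gt0.
have k0 m : 0 <= kap m.+1.
  by rewrite /kap divr_ge0 ?powR_ge0// ltW// g0// divr_gt0.
have nn s (v : R) a : (0 <= (ppow s v)%:E * F a)%E by rewrite mule_ge0 ?lee_fin ?ppow_ge0.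
rewrite ge0_integralZl_EFin; last 4 first.
- exact: measurableT.
- by move=> a _; apply: integral_ge0 => v _; exact: nn.
- by mes => x y; exact: nn.
- exact: k0.
rewrite tonelli; last 2 first.
  by mes.
  by move=> x y; exact: nn.
transitivity ((kap n.+1)%:E * \int[mu]_v \int[mu]_u ((ppow (n.+1%:R / 2 - 1) v * ppow (2^-1 - 1) (u - v))%:E * F u))%E.
  apply: mule_congr; apply: eq_integral; rint v.
  rewrite (@ge0_integral_comp_sqr _ (fun s => (ppow (n.+1%:R / 2 - 1) v)%:E * F (s + v)%R))%E; last 2 first.
    by mes.
    by move=> r; exact: nn.
  rewrite -[RHS](@ge0_integral_shift _ v); last 2 first.
    by mes.
    by move=> r; rewrite mule_ge0// lee_fin mulr_ge0 ?ppow_ge0.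
  apply: eq_integral; rint u; rewrite addrK {3}/ppow; case: ifP => _; last by rewrite mulr0 mul0e.
  by rewrite muleA -EFinM mulrC; congr ((_ * _ `^ _)%:E * _)%E; field.
rewrite tonelli; last 2 first.
  by mes.
  by move=> x y; rewrite mule_ge0// lee_fin mulr_ge0 ?ppow_ge0.
have -> : kap n.+2 = kap n.+1 * (Gamma (n.+1%:R / 2) * Gamma 2^-1 / Gamma (n.+1%:R / 2 + 2^-1)).
  have -> : n.+1%:R / 2 + 2^-1 = n.+2%:R / 2 :> R by rewrite -[n.+2%:R]natr1; field.
  rewrite /kap Gamma_half.
  have -> : n.+2%:R / 2 = n.+1%:R / 2 + 2^-1 :> R by rewrite -[n.+2%:R]natr1; field.
  rewrite gt0_powRD ?pi_gt0// powR12_sqrt ?pi_ge0//; field.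
  by rewrite !gt_eqF ?g0// ?addr_gt0 ?divr_gt0 ?invr_gt0.
rewrite [in RHS]EFinM -[RHS]muleA; apply: mule_congr.
rewrite -ge0_integralZl_EFin; last 4 first.
- by [].
- by move=> u _; exact: nn.
- by mes.
- by rewrite divr_ge0 ?mulr_ge0// ?ltW// g0// ?addr_gt0 ?divr_gt0 ?invr_gt0.
apply: eq_integral; rint u.
transitivity (F u * \int[mu]_v (ppow (n.+1%:R / 2 - 1) v * ppow (2^-1 - 1) (u - v))%:E)%E.
  rewrite -ge0_integralZl//; last 2 first.
    by mes.
    by move=> v _; rewrite lee_fin mulr_ge0 ?ppow_ge0.
  by apply: eq_integral => v _; rewrite muleC.
rewrite ppow_beta ?divr_gt0 ?invr_gt0// EFinM muleC -muleA; congr (_ * (_ * _))%E.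
by congr ((ppow _ u)%:E); rewrite -[n.+2%:R]natr1; field.
Qed.

(** A planar rotation is a product of three shears, each of which is a
    translation in one coordinate. *)
Lemma ge0_integral_rotation (G : R -> R -> \bar R) (c s : R) : c ^+ 2 + s ^+ 2 = 1 -> s != 0 ->
  measurable_fun setT (fun p : R * R => G p.1 p.2) -> (forall a b, 0 <= G a b)%E ->
  (\int[mu]_a \int[mu]_t G (c * a - s * t)%R (s * a + c * t)%R = \int[mu]_a \int[mu]_t G a t)%E.
Proof.
move=> cs s0.
have shear1 (k : R) (H : R -> R -> \bar R) : measurable_fun setT (fun p : R * R => H p.1 p.2) ->
    (forall a b, 0 <= H a b)%E ->
    (\int[mu]_a \int[mu]_t H (a + k * t)%R t = \int[mu]_a \int[mu]_t H a t)%E.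
  move=> mH H0; rewrite tonelli; last 2 first.
    by mes.
    by move=> a t; exact: H0.
  rewrite [RHS]tonelli; last 2 first.
    by mes.
    by move=> a t; exact: H0.
  apply: eq_integral; rint t.
  rewrite (@ge0_integral_shift _ (k * t) (fun a => H a t))//; by mes.
have shear2 (k : R) (H : R -> R -> \bar R) : measurable_fun setT (fun p : R * R => H p.1 p.2) ->
    (forall a b, 0 <= H a b)%E ->
    (\int[mu]_a \int[mu]_t H a (t + k * a)%R = \int[mu]_a \int[mu]_t H a t)%E.
  move=> mH H0; apply: eq_integral; rint a.
  rewrite (@ge0_integral_shift _ (k * a) (fun t => H a t))//; by mes.
move=> mG G0; pose k := (c - 1) / s.
rewrite -(shear1 k G mG G0).
rewrite -(shear2 s (fun a t => G (a + k * t)%R t)); last 2 first.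
  by mes.
  by move=> a t; exact: G0.
rewrite -(shear1 k (fun a t => G (a + k * (t + s * a))%R (t + s * a)%R)); last 2 first.
  by mes.
  by move=> a t; exact: G0.
apply: eq_integral; rint a; apply: eq_integral; rint t.
have e1 : s * a + c * t = t + s * (a + k * t).
  by rewrite /k; field.
rewrite -e1; congr (G _ _).
have ss : - s = (c ^+ 2 - 1) / s by rewrite -cs; field.
rewrite -mulNr ss /k; field.
exact: s0.
Qed.

(** The rotation taking (x0, r) to the first axis preserves a^2 + t^2. *)
Lemma ge0_integral_two_points (Psi : R -> R -> \bar R) (x0 r : R) : 0 <= r ->
  measurable_fun setT (fun p : R * R => Psi p.1 p.2) -> (forall a b, 0 <= Psi a b)%E ->
  (\int[mu]_a \int[mu]_t Psi ((x0 - a) ^+ 2 + (r - t) ^+ 2)%R (a ^+ 2 + t ^+ 2)%R =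
   \int[mu]_a \int[mu]_t Psi ((Num.sqrt (x0 ^+ 2 + r ^+ 2) - a) ^+ 2 + t ^+ 2)%R (a ^+ 2 + t ^+ 2)%R)%E.
Proof.
move=> r0 mP P0.
have [->|rn0] := eqVneq r 0.
  rewrite expr0n/= addr0 sqrtr_sqr.
  have [x00|x00] := leP 0 x0.
    by apply: eq_integral => a _; apply: eq_integral => t _; rewrite sub0r sqrrN (ger0_norm x00).
  rewrite (ltr0_norm x00) -[LHS](@ge0_integral_opp _ (fun a => \int[mu]_t Psi ((x0 - a) ^+ 2 + (0 - t) ^+ 2)%R (a ^+ 2 + t ^+ 2)%R)%E);
    last 2 first.
    by mes.
    by move=> a; exact: integral_ge0.
  apply: eq_integral; rint a; apply: eq_integral; rint t.
  by congr (Psi _ _); ring.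
set N := Num.sqrt _.
have NE : N ^+ 2 = x0 ^+ 2 + r ^+ 2 by rewrite sqr_sqrtr// addr_ge0 ?sqr_ge0.
have Np : 0 < N by rewrite sqrtr_gt0 ltr_wpDl ?sqr_ge0// exprn_gt0// lt_neqAle eq_sym rn0.
have N0 : N != 0 by rewrite gt_eqF.
rewrite -(@ge0_integral_rotation _ (x0 / N) (r / N)); last 4 first.
- by rewrite !expr_div_n -mulrDl -NE divff// expf_neq0.
- by rewrite mulf_neq0// invr_eq0.
- by mes.
- by move=> a b; exact: P0.
apply: eq_integral; rint a; apply: eq_integral; rint t.
have h : (x0 / N) ^+ 2 + (r / N) ^+ 2 = 1 by rewrite !expr_div_n -mulrDl -NE divff// expf_neq0.
have hx : x0 = x0 / N * N by rewrite divfK.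
have hr : r = r / N * N by rewrite divfK.
move: h hx hr; set c := x0 / N; set s := r / N => h -> ->.
congr (Psi _ _).
  transitivity ((c ^+ 2 + s ^+ 2) * ((N - a) ^+ 2 + t ^+ 2)); first by ring.
  by rewrite h mul1r.
transitivity ((c ^+ 2 + s ^+ 2) * (a ^+ 2 + t ^+ 2)); first by ring.
by rewrite h mul1r.
Qed.

(** Integrals of functions of the distances to 0 and to x only depend on the
    norm of x: x can be turned to the first axis. *)
Lemma ge0_integral_axis n (x : 'rV[R]_n.+1) (Phi : R -> R -> \bar R) :
  measurable_fun setT (fun p : R * R => Phi p.1 p.2) -> (forall a b, 0 <= Phi a b)%E ->
  (\int[leb n.+1]_y Phi (sqn (x - y)) (sqn y) =
   \int[mu]_t \int[leb n]_w Phi ((enorm x - t) ^+ 2 + sqn w)%R (t ^+ 2 + sqn w)%R)%E.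
Proof.
elim: n x Phi => [|n IH] x Phi mP P0.
  rewrite ge0_integral_consrV; last 2 first.
    by mes.
    by move=> v; exact: P0.
  rewrite -(unconsrVK x); set x1 : R := (unconsrV x).1.
  transitivity (\int[mu]_t Phi ((x1 - t) ^+ 2)%R (t ^+ 2)%R)%E.
    apply: eq_integral => t _; rewrite integral_rV0 consrVB !sqn_cons !sqn0 !addr0 //.
  have -> : enorm (consrV (unconsrV x)) = `|x1|.
    by rewrite enormE sqn_cons sqn0 addr0 sqrtr_sqr.
  transitivity (\int[mu]_t Phi ((`|x1| - t) ^+ 2)%R (t ^+ 2)%R)%E; last first.
    by apply: eq_integral => t _; rewrite integral_rV0 sqn0 !addr0.
  have [x00|x00] := leP 0 x1; first by rewrite (ger0_norm x00).
  rewrite (ltr0_norm x00).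
  rewrite -[LHS](@ge0_integral_opp _ (fun t => Phi ((x1 - t) ^+ 2)%R (t ^+ 2)%R)); last 2 first.
    by mes.
    by move=> t; exact: P0.
  by apply: eq_integral; rint t; congr (Phi _ _); ring.
have P0' (a b : 'rV[R]_n.+2) : (0 <= Phi (sqn a) (sqn b))%E by exact: P0.
rewrite ge0_integral_consrV; last 2 first.
  by mes.
  by move=> v; exact: P0.
rewrite -(unconsrVK x); set x1 : R := (unconsrV x).1; set x' := (unconsrV x).2.
pose Psi p q := (\int[leb n]_w Phi (p + sqn w)%R (q + sqn w)%R)%E.
have mPsi : measurable_fun setT (fun p : R * R => Psi p.1 p.2).
  by rewrite /Psi; mes.
have Psi0 a b : (0 <= Psi a b)%E by apply: integral_ge0 => w _; exact: P0.
transitivity (\int[mu]_a \int[mu]_t Psi ((x1 - a) ^+ 2 + (enorm x' - t) ^+ 2)%R (a ^+ 2 + t ^+ 2)%R)%E.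
  apply: eq_integral; rint a.
  transitivity (\int[leb n.+1]_w Phi ((x1 - a) ^+ 2 + sqn (x' - w))%R (a ^+ 2 + sqn w)%R)%E.
    by apply: eq_integral => w _; rewrite consrVB !sqn_cons.
  rewrite (IH x' (fun p q => Phi ((x1 - a) ^+ 2 + p)%R (a ^+ 2 + q)%R)); last 2 first.
    by mes.
    by move=> p q; exact: P0.
  by apply: eq_integral; rint t; apply: eq_integral => w _; rewrite !addrA.
rewrite ge0_integral_two_points//; last exact: enorm_ge0.
have -> : Num.sqrt (x1 ^+ 2 + enorm x' ^+ 2) = enorm (consrV (unconsrV x)).
  by rewrite [RHS]enormE sqn_cons enorm_sqr.
set N := enorm _.
apply: eq_integral; rint a.
rewrite ge0_integral_consrV; last 2 first.
  by mes.
  by move=> v; exact: P0.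
apply: eq_integral; rint t; apply: eq_integral => w _.
by rewrite sqn_cons !addrA.
Qed.

End Vectors2.

(** * Convolution powers of a radial decreasing function *)

(* The short name also denotes convex combinations. *)
Local Notation conv := Defs.conv.

Lemma convnS (R : realType) d (f : 'rV[R]_d -> R) n :
  convn f n.+2 = conv f (convn f n.+1).
Proof. by []. Qed.

Section Convolution.
Context {R : realType} (d : nat).
Local Notation mu := (@lebesgue_measure R).
Local Notation leb n := (@lebesgue_rV R n).
Variable F : R -> R.
Hypotheses (mF : measurable_fun [set: R] F) (F0 : forall p, 0 <= F p).
Hypothesis Fdec : forall p q, 0 < p -> p <= q -> F q <= F p.
Local Notation f := (fun x : 'rV[R]_d.+1 => F (sqn x)).

Lemma integral_conv (h : 'rV[R]_d.+1 -> \bar R) : measurable_fun setT h ->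
  (forall y, 0 <= h y)%E ->
  (\int[leb d.+1]_x conv f h x = \int[leb d.+1]_x (f x)%:E * \int[leb d.+1]_x h x)%E.
Proof.
move=> mh h0; rewrite /conv tonelli; last 2 first.
  by mes.
  by move=> x y; rewrite mule_ge0// lee_fin.
rewrite -ge0_integralZl; last 4 first.
- exact: measurableT.
- by [].
- by move=> y _.
- by apply: integral_ge0 => y _; rewrite lee_fin.
apply: eq_integral => y _; rewrite muleC.
rewrite -(@ge0_integral_rV_sub _ _ y (fun x => (f x)%:E)); last 2 first.
- by mes.
- by move=> v; rewrite lee_fin.
rewrite -ge0_integralZl; last 4 first.
- exact: measurableT.
- by mes.
- by move=> x _; rewrite lee_fin.
- exact: h0.
apply: eq_integral => x _; rewrite [RHS]muleC; congr ((F _)%:E * _)%E.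
by rewrite /sqn; apply: eq_bigr => i _; rewrite !mxE -opprB sqrrN.
Qed.

(** Monotonicity is not asked at 0, where f or its convolution powers may be
    singular. *)
Definition radial_decreasing (h : 'rV[R]_d.+1 -> \bar R) :=
  exists H : R -> \bar R, [/\ measurable_fun [set: R] H, forall p, (0 <= H p)%E,
    forall p q, 0 < p -> p <= q -> (H q <= H p)%E & forall x, h x = H (sqn x)].

Lemma rearrangement (A B : R) (h1 h2 : \bar R) : 0 <= B -> B <= A -> (0 <= h2)%E -> (h2 <= h1)%E ->
  (B%:E * h1 + A%:E * h2 <= A%:E * h1 + B%:E * h2)%E.
Proof.
move=> B0 BA h20 h21.
have h10 : (0 <= h1)%E by exact: le_trans h21.
have -> : A = B + (A - B) by ring.
have D0 : 0 <= A - B by rewrite subr_ge0.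
rewrite EFinD !ge0_muleDl ?lee_fin//.
rewrite -!addeA [X in (_ <= _ + X)%E]addeC; apply: leeD2l; apply: leeD2l.
exact: lee_wpmul2l.
Qed.

Lemma ge0_integral_reflect (c : R) (G : R -> \bar R) : measurable_fun setT G -> (forall t, 0 <= G t)%E ->
  (\int[mu]_t G t = \int[mu]_t (if (t < c)%R then G t + G (2 * c - t)%R else 0))%E.
Proof.
move=> mG G0.
have m1 : measurable_fun setT (fun t : R => if t < c then G t else 0%E) by mes.
have m2 : measurable_fun setT (fun t : R => if c < t then G t else 0%E) by mes.
transitivity (\int[mu]_t ((if (t < c)%R then G t else 0) + (if (c < t)%R then G t else 0)))%E.
  apply: ae_eq_integral; [exact: measurableT|exact: mG|by mes|].
  exists [set c]; split => //; first exact: lebesgue_measure_set1.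
  move=> z /=; apply: contra_notP => /eqP z0 _.
  by case: (ltrgtP z c) z0 => //; rewrite ?adde0 ?add0e.
rewrite ge0_integralD; last 5 first.
- exact: measurableT.
- by move=> t _; case: ifP.
- exact: m1.
- by move=> t _; case: ifP.
- exact: m2.
rewrite -[X in (_ + X)%E](@ge0_integral_opp _ (fun t => if c < t then G t else 0%E)); last 2 first.
- exact: m2.
- by move=> t; case: ifP.
rewrite -[X in (_ + X)%E](@ge0_integral_shift _ (- (2 * c)) (fun t => if c < - t then G (- t)%R else 0%E)); last 2 first.
- by mes.
- by move=> t; case: ifP.
rewrite -ge0_integralD; last 5 first.
- exact: measurableT.
- by move=> t _; case: ifP.
- exact: m1.
- by move=> t _; case: ifP.
- by mes.
apply: eq_integral; rint t; rewrite opprD opprK [(- t + _)%R]addrC.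
have -> : (c < 2 * c - t) = (t < c) by apply/idP/idP; lra.
by case: ifP => _; rewrite ?adde0.
Qed.

(** Reflection at the midpoint c of r and s exchanges the distances to r and to s,
    and moves the points t < c away from 0. So for each pair of mirror points the
    larger value of F meets the larger value of H on the right-hand side, and the
    rearrangement inequality compares the two integrands. The points 0 and r are
    left out since F and H need not be monotone at 0. *)
Lemma conv_line_decreasing (H : R -> \bar R) (b r s : R) : 0 <= b -> 0 < r -> r <= s ->
  measurable_fun [set: R] H -> (forall p, 0 <= H p)%E ->
  (forall p q, 0 < p -> p <= q -> (H q <= H p)%E) ->
  (\int[mu]_t ((F ((s - t) ^+ 2 + b))%:E * H (t ^+ 2 + b)%R) <=
   \int[mu]_t ((F ((r - t) ^+ 2 + b))%:E * H (t ^+ 2 + b)%R))%E.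
Proof.
move=> b0 r0 rs mH H0 Hdec.
have nn p q : (0 <= (F p)%:E * H q)%E by rewrite mule_ge0// lee_fin.
pose c := (r + s) / 2.
rewrite (@ge0_integral_reflect c); last 2 first.
- by mes.
- by move=> t; exact: nn.
rewrite [leRHS](@ge0_integral_reflect c); last 2 first.
- by mes.
- by move=> t; exact: nn.
apply: ae_ge0_le_integral.
- exact: measurableT.
- by move=> t _; case: ifP => // _; exact: adde_ge0.
- by mes.
- by move=> t _; case: ifP => // _; exact: adde_ge0.
- by mes.
have : (mu [set r; 0%R] = 0)%E.
  rewrite -(@countable_lebesgue_measure0 R [set r; 0])//.
  apply: finite_set_countable; exact: finite_set2.
move=> mrs0.
exists [set r; 0]; split => //.
  by apply: measurableU; exact: measurable_set1.
move=> t /=; apply: contra_notP => /not_orP[/eqP tr /eqP t0] _.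
have [tc|//] := ltP t c.
have e1 : s - (2 * c - t) = t - r by rewrite /c; field.
have e2 : r - (2 * c - t) = t - s by rewrite /c; field.
rewrite e1 e2 -(sqrrN (t - r)) -(sqrrN (t - s)) !opprB.
apply: rearrangement => //.
- apply: Fdec.
    by rewrite ltr_wpDr// lt_neqAle sqr_ge0 eq_sym sqrf_eq0 subr_eq0 eq_sym tr.
  rewrite lerD2r; rewrite /c in tc; nra.
- apply: Hdec.
    by rewrite ltr_wpDr// lt_neqAle sqr_ge0 eq_sym sqrf_eq0 t0.
  by rewrite lerD2r; rewrite /c in tc *; nra.
Qed.

(** In axial coordinates, conv_line_decreasing applies on every line parallel to
    the axis. *)
Lemma radial_decreasing_conv (h : 'rV[R]_d.+1 -> \bar R) : radial_decreasing h ->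
  radial_decreasing (conv f h).
Proof.
move=> [H [mH H0 Hdec hE]].
have nn p q : (0 <= (F p)%:E * H q)%E by rewrite mule_ge0// lee_fin.
pose T (r : R) := (\int[mu]_t \int[leb d]_w ((F ((r - t) ^+ 2 + sqn w))%:E * H (t ^+ 2 + sqn w)%R))%E.
have cE x : conv f h x = T (enorm x).
  rewrite /conv /T -(@ge0_integral_axis _ _ x (fun p q => (F p)%:E * H q)%E); last 2 first.
  - by mes.
  - exact: nn.
  by apply: eq_integral => y _; rewrite hE.
exists (fun p => T (Num.sqrt p)); split.
- rewrite /T; mes.
  by move=> p t; apply: integral_ge0 => w _; exact: nn.
- by move=> p; apply: integral_ge0 => t _; apply: integral_ge0 => w _; exact: nn.
- move=> p q p0 pq; rewrite /T tonelli; last 2 first.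
  + by mes.
  + by move=> t w; exact: nn.
  rewrite [leRHS]tonelli; last 2 first.
  + by mes.
  + by move=> t w; exact: nn.
  apply: ge0_le_integral.
  + exact: measurableT.
  + by move=> w _; apply: integral_ge0 => t _; exact: nn.
  + by mes => w t; exact: nn.
  + by mes => w t; exact: nn.
  move=> w _; apply: conv_line_decreasing => //; first exact: sqn_ge0.
  + by rewrite sqrtr_gt0.
  + by rewrite ler_wsqrtr.
- by move=> x; rewrite cE enormE.
Qed.

Lemma radial_decreasing_convn n : radial_decreasing (convn f n.+1).
Proof.
elim: n => [|n IH]; last by rewrite convnS; exact: radial_decreasing_conv.
exists (fun p => (F p)%:E); split; last by [].
- by mes.
- by move=> p; rewrite lee_fin.
- by move=> p q p0 pq; rewrite lee_fin Fdec.
Qed.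

Lemma convn_ge0 n x : (0 <= convn f n.+1 x)%E.
Proof. by have [H [_ H0 _ ->]] := radial_decreasing_convn n. Qed.

Lemma measurable_convn n : measurable_fun setT (convn f n.+1).
Proof.
have [H [mH _ _ hE]] := radial_decreasing_convn n.
have -> : convn f n.+1 = fun x => H (sqn x) by apply/funext => x; rewrite hE.
by mes.
Qed.

Lemma convn_le n x y : 0 < sqn x -> sqn x <= sqn y -> (convn f n.+1 y <= convn f n.+1 x)%E.
Proof. by have [H [_ _ Hd hE]] := radial_decreasing_convn n; rewrite !hE; exact: Hd. Qed.

Lemma integral_convn n :
  (\int[leb d.+1]_x convn f n.+1 x = (\int[leb d.+1]_x (f x)%:E) ^+ n.+1)%E.
Proof.
elim: n => [|n IH]; first by [].
rewrite convnS integral_conv; last 2 first.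
- exact: measurable_convn.
- exact: convn_ge0.
by rewrite IH -expeS.
Qed.

End Convolution.

(** * The convolution integral away from its two centres *)

Lemma eq_lee (R : realType) (a b : \bar R) : a = b -> (a <= b)%E.
Proof. by move=> ->. Qed.

Lemma ler_eq2 (R : numDomainType) (a b c d : R) : a = c -> b = d -> c <= d -> a <= b.
Proof. by move=> -> ->. Qed.

Lemma eq_ler (R : numDomainType) (a b : R) : a = b -> a <= b.
Proof. by move=> ->. Qed.

Ltac transitivity_le c := apply: (@le_trans _ _ c).

Section Bulk.
Context {R : realType}.
Local Notation mu := (@lebesgue_measure R).
Local Notation leb n := (@lebesgue_rV R n).

Lemma Gamma_gt0 (s : R) : 0 < s -> 0 < Gamma s.
Proof. by move=> /Gamma_ge_half; apply: lt_le_trans; rewrite invr_gt0. Qed.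

Lemma Gamma1 : Gamma (1 : R) = 1.
Proof.
apply/EFin_inj; rewrite GammaE// -(integral_exponential_pdf (ltr01 : 0 < (1 : R))).
apply: ae_eq_integral; [exact: measurableT|by mes| |].
  by have := measurable_exponential_pdf (1 : R) => mE; mes.
exists [set 0]; split => //; first exact: lebesgue_measure_set1.
move=> z /=; apply: contra_notP => /eqP z0 _; congr (_%:E).
case: (ltgtP z 0) z0 => // zz _.
  by rewrite lt0_exponential_pdf// ppow_npos ?mul0r ?ltW.
rewrite ppow_pos// subrr powRr0 mul1r exponential_pdfE ?ltW//.
by rewrite mul1r mulN1r.
Qed.

(** The excess of the length of a path over a straight segment is of order v for
    small deviations and of order sqrt v for large ones; psi interpolates. *)
Definition psi (v : R) : R := v / Num.sqrt (1 + v).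

(** For c = m / pi^2 and b = (d - 3) / 2 this is twice the integral in the
    constant M3, in the variable v = s^2. *)
Definition tail_integral (c b : R) : \bar R := (\int[mu]_v (ppow b v * expR (- (c * psi v)))%:E)%E.

Lemma measurable_psi : measurable_fun [set: R] psi.
Proof.
rewrite (_ : psi = fun v => v * (Num.sqrt (1 + v)) `^ (- 1)); first by mes.
by apply/funext => v; rewrite powR_inv1// sqrtr_ge0.
Qed.

Lemma psi_scale (k v : R) : 1 <= k -> 0 <= v -> psi (k * v) <= k * psi v.
Proof.
move=> k1 v0; rewrite /psi -mulrA ler_wpM2l ?(le_trans ler01)//.
rewrite ler_wpM2l// lef_pV2 ?posrE ?sqrtr_gt0; [|nra|nra].
by apply: ler_wsqrtr; nra.
Qed.

Lemma psi_sqr_ge (z : R) : 0 <= z -> z - 1 <= psi (z ^+ 2).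
Proof.
move=> z0; rewrite /psi.
have h : Num.sqrt (1 + z ^+ 2) <= 1 + z.
  rewrite -(ger0_norm (_ : 0 <= 1 + z)) ?addr_ge0// -sqrtr_sqr.
  by apply: ler_wsqrtr; nra.
have p : 0 < Num.sqrt (1 + z ^+ 2) by rewrite sqrtr_gt0; nra.
rewrite ler_pdivlMr//; nra.
Qed.

(** With S the square root and T that of 1 + u / a, the left-hand side is
    u / (2 a T), the right-hand side is u / (S + a), and S <= a T. *)
Lemma sqrt_sub_ge_psi (a u : R) : 1 <= a -> 0 <= u ->
  2^-1 * psi (u / a) <= Num.sqrt (a ^+ 2 + u) - a.
Proof.
move=> a1 u0; have a0 : 0 < a by lra.
set S := Num.sqrt (a ^+ 2 + u).
have SS : S ^+ 2 = a ^+ 2 + u by rewrite sqr_sqrtr// addr_ge0// sqr_ge0.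
have S0 : 0 <= S by exact: sqrtr_ge0.
have aS : a <= S.
  rewrite -(ger0_norm (ltW a0)) -sqrtr_sqr ler_wsqrtr// lerDl//.
set T := Num.sqrt (1 + u / a).
have TT : T ^+ 2 = 1 + u / a by rewrite sqr_sqrtr// addr_ge0// divr_ge0// ltW.
have T0 : 0 <= T by exact: sqrtr_ge0.
have ua0 : 0 <= u / a by rewrite divr_ge0// ltW.
have T1 : 1 <= T by rewrite -sqrtr1 ler_wsqrtr// lerDl.
have ST : S <= a * T.
  rewrite -(ler_pXn2r (n:=2)) ?nnegrE ?mulr_ge0 ?(ltW a0)// SS exprMn TT.
  have -> : a ^+ 2 * (1 + u / a) = a ^+ 2 + a * u by field; rewrite gt_eqF.
  by rewrite lerD2l ler_peMl.
rewrite /psi -/T.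
have -> : 2^-1 * (u / a / T) = u / (2 * (a * T)).
  by field; rewrite !gt_eqF//; lra.
rewrite ler_pdivrMr; last by rewrite !mulr_gt0//; lra.
have -> : u = (S - a) * (S + a) by rewrite -subr_sqr SS; ring.
by apply: ler_wpM2l; lra.
Qed.

(** The substitution v = s^2; the integral converges since psi (s^2) >= s - 1. *)
Lemma tail_integral_lty (n : nat) (c : R) : 0 < c ->
  (tail_integral c (n.+1%:R / 2 - 1) < +oo)%E /\
  tail_integral c (n.+1%:R / 2 - 1) =
   (2%:E * (\int[mu]_(s in `]0%R, +oo[) (expR (- (c * (s ^+ 2 / Num.sqrt (1 + s ^+ 2)))) * s ^+ n)%:E))%E.
Proof.
move=> c0; have mpsi := measurable_psi.
have E : tail_integral c (n.+1%:R / 2 - 1) =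
   (2%:E * (\int[mu]_(s in `]0%R, +oo[) (expR (- (c * (s ^+ 2 / Num.sqrt (1 + s ^+ 2)))) * s ^+ n)%:E))%E.
  rewrite integral_itv0y /tail_integral.
  transitivity (\int[mu]_v (if (0 < v)%R then (ppow (n.+1%:R / 2 - 1) v * expR (- (c * psi v)))%:E else 0))%E.
    apply: eq_integral; rint v; case: ifPn => // v0.
    by rewrite ppow_npos ?mul0r// leNgt.
  rewrite [LHS]ge0_integral_sqr; last 2 first.
  - by mes.
  - by move=> r; rewrite lee_fin mulr_ge0 ?ppow_ge0 ?expR_ge0.
  rewrite -ge0_integralZl_EFin; last 4 first.
  - exact: measurableT.
  - by move=> t _; case: ifP => // t0; rewrite lee_fin mulr_ge0 ?expR_ge0// exprn_ge0// ltW.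
  - have -> : (fun t : R => if (0 < t)%R then (expR (- (c * (t ^+ 2 / Num.sqrt (1 + t ^+ 2)))) * t ^+ n)%:E else 0%E)
      = (fun t : R => if (0 < t)%R then (expR (- (c * psi (t ^+ 2))) * t ^+ n)%:E else 0%E) by [].
    by mes.
  - by [].
  apply: eq_integral; rint z; case: ifPn => [z0|_]; last by rewrite mule0.
  rewrite -!EFinM; congr (_%:E).
  have key : z * (z ^+ 2) `^ (n.+1%:R / 2 - 1) = z ^+ n.
    rewrite -[RHS]powR_mulrn ?(ltW z0)// -[z ^+ 2]powR_mulrn ?(ltW z0)// -powRrM.
    rewrite -[X in X * _](powRr1 (ltW z0)) -gt0_powRD//.
    by congr (_ `^ _); rewrite -natr1; field.
  by rewrite -key ppow_pos ?exprn_gt0// /psi; ring.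
split=> //; rewrite E lte_mul_pinfty// integral_itv0y.
have h := @integral_ppow_expR_lty R n.+1%:R c (ltr0Sn _ _) c0.
apply: (@le_lt_trans _ _ ((expR c)%:E * \int[mu]_t (ppow (n.+1%:R - 1) t * expR (- (c * t)))%:E)%E); last first.
  by rewrite lte_mul_pinfty// lee_fin expR_ge0.
rewrite -ge0_integralZl_EFin; last 4 first.
- exact: measurableT.
- by move=> t _; rewrite lee_fin mulr_ge0 ?ppow_ge0 ?expR_ge0.
- by mes.
- exact: expR_ge0.
apply: ge0_le_integral.
- exact: measurableT.
- by move=> t _; case: ifP => // t0; rewrite lee_fin mulr_ge0 ?expR_ge0// exprn_ge0// ltW.
- have -> : (fun t : R => if (0 < t)%R then (expR (- (c * (t ^+ 2 / Num.sqrt (1 + t ^+ 2)))) * t ^+ n)%:E else 0%E)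
      = (fun t : R => if (0 < t)%R then (expR (- (c * psi (t ^+ 2))) * t ^+ n)%:E else 0%E) by [].
  by mes.
- by mes.
- rint t; case: ifPn => t0; last first.
    by rewrite -EFinM lee_fin !mulr_ge0 ?ppow_ge0 ?expR_ge0.
  rewrite -EFinM lee_fin ppow_pos// -natr1 addrK powR_mulrn ?(ltW t0)//.
  rewrite [leLHS]mulrC [leRHS]mulrCA -expRD ler_wpM2l ?exprn_ge0 ?(ltW t0)// ler_expR.
  have := psi_sqr_ge (ltW t0); rewrite /psi; set q := t ^+ 2 / _ => h1; nra.
Qed.

Lemma cst_M3_ge1 n (m : R) : 1 <= cst_M3 n m.
Proof. by rewrite /cst_M3 le_max lexx. Qed.

Lemma cst_M3_ge n (m : R) : 0 < m ->
  ((kap n.+1)%:E * tail_integral (m / pi ^+ 2) (n.+1%:R / 2 - 1) <= (cst_M3 n.+2 m)%:E)%E.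
Proof.
move=> m0; have c0 : 0 < m / pi ^+ 2 by rewrite divr_gt0// exprn_gt0// pi_gt0.
have [fin E] := tail_integral_lty n c0.
rewrite /cst_M3 EFin_max le_max; apply/orP; right.
have -> : (n.+2%:R - 1) / 2 = n.+1%:R / 2 :> R by rewrite -[n.+2%:R]natr1 addrK.
rewrite subn2 /= [X in (_ <= X)%E]EFinM /Rintegral fineK; last first.
  rewrite ge0_fin_numE; last first.
    apply: integral_ge0 => t; rewrite /= in_itv/= andbT => t0.
    by rewrite lee_fin mulr_ge0 ?expR_ge0// exprn_ge0// ltW.
  move: fin; rewrite E; case: (integral _ _ _) => [r _|h|//]; first exact: ltry.
  by move: h; rewrite gt0_muley.
by rewrite E muleA -EFinM /kap mulrAC [pi `^ _ * 2]mulrC.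
Qed.

Lemma ppow_mul (b p q : R) : 0 < p + q -> ppow b (p * q) = ppow b p * ppow b q.
Proof.
move=> pq; rewrite /ppow; case: (ltP 0 p) => p0; case: (ltP 0 q) => q0.
- by rewrite mulr_gt0// powRM ?ltW.
- by rewrite mulr0 ifF//; apply/negbTE; rewrite -leNgt; nra.
- by rewrite mul0r ifF//; apply/negbTE; rewrite -leNgt; nra.
- by rewrite mul0r ifF//; apply/negbTE; rewrite -leNgt; nra.
Qed.

Lemma integral_ppow_Nhalf (L : R) : 0 < L ->
  (\int[mu]_p (if p < L then ppow (- 2^-1) p else 0)%:E = (2 * Num.sqrt L)%:E)%E.
Proof.
move=> L0.
transitivity (\int[mu]_z (if z ^+ 2 < L then 1 else 0)%:E)%E.
  rewrite (@ge0_integral_comp_sqr _ (fun v => (if v < L then 1 else 0)%:E)); last 2 first.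
  - by mes.
  - by move=> r; case: ifP; rewrite lee_fin.
  apply: eq_integral; rint v; rewrite /ppow; have [v0|v0] := ltP 0 v; last by case: ifP.
  by rewrite -EFinM; case: ifP; rewrite ?mulr1 ?mulr0.
transitivity (\int[mu]_(z in `](- Num.sqrt L)%R, (Num.sqrt L)%R[) (cst 1%E z))%E.
  rewrite [RHS](@integral_if _ _ _ mu _ (fun z : R => - Num.sqrt L < z < Num.sqrt L)); last first.
    by move=> z; rewrite /= in_itv.
  apply: eq_integral; rint z.
  rewrite -ltr_norml -sqrtr_sqr ltr_sqrt//; by case: ifP.
rewrite integral_cst; last exact: measurable_itv.
have s0 : 0 < Num.sqrt L by rewrite sqrtr_gt0.
rewrite /= lebesgue_measure_itv/= lte_fin ifT; last lra.
by rewrite mul1e -EFinD; congr (_%:E); ring.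
Qed.

(** The weight (L - p)^(-1/2) increases on (0, L) while F decreases, so by
    Chebyshev's integral inequality for p^(-1/2) dp the weight may be replaced by
    its mean, pi / (2 sqrt L). The slightly larger constant allows a direct
    proof: the constant W below is the value of the weight at p0, so that weight
    minus W and F p0 - F p have the same sign everywhere. *)
Lemma arcsine_weight_le (L : R) (F : R -> R) : 0 < L -> measurable_fun setT F ->
  (forall p, 0 <= F p) -> (forall p q, 0 < p -> p <= q -> F q <= F p) ->
  (\int[mu]_p (ppow (- 2^-1) p * ppow (- 2^-1) (L - p) * F p)%:E <=
   (5 / 8 * pi * L `^ (- 2^-1))%:E * \int[mu]_p (ppow (- 2^-1) p * F p)%:E)%E.
Proof.
move=> L0 mF F0 Fdec.
have pi2 := @pi_ge2 R.
pose k : R := 5 / 8 * pi; have k1 : 1 < k by rewrite /k; lra.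
pose W := k * L `^ (- 2^-1); pose p0 := L * (1 - k^-1 ^+ 2).
have W0 : 0 < W by rewrite mulr_gt0 ?powR_gt0//; lra.
pose G p := if p < L then ppow (- 2^-1) p else 0.
have G0 p : 0 <= G p by rewrite /G; case: ifP => // _; exact: ppow_ge0.
have mG : measurable_fun setT G by rewrite /G; mes.
have kV : 0 < k^-1 < 1 by rewrite invr_gt0 invf_lt1; lra.
have WE : (L - p0) `^ (- 2^-1) = W.
  have -> : L - p0 = L * k^-1 ^+ 2 by rewrite /p0; ring.
  rewrite powRM ?(ltW L0) ?exprn_ge0//; last lra.
  rewrite -[k^-1 ^+ 2]powR_mulrn -?powRrM; last lra.
  by rewrite mulrN mulfV// powR_inv1 ?invrK 1?mulrC//; lra.
have p00 : 0 < p0.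
  by rewrite mulr_gt0// subr_gt0 expr_lt1//; lra.
have p0L : p0 < L.
  by rewrite /p0 mulrBr mulr1 ltrBlDr ltrDl mulr_gt0// exprn_gt0//; lra.
pose F1 := F p0.
have F10 : 0 <= F1 by exact: F0.
have W00 : 0 <= W by exact: ltW.
have FW0 : 0 <= F1 * W by exact: mulr_ge0.
(* F - F1 and the weight minus W change sign at the same point p0 *)
have key p : 0 < p -> p < L -> F p * (L - p) `^ (- 2^-1) + F1 * W <= F p * W + F1 * (L - p) `^ (- 2^-1).
  move=> p1 pL; have Lp : 0 < L - p by lra.
  suff : (F p - F1) * ((L - p) `^ (- 2^-1) - W) <= 0 by nra.
  have [pp|pp] := leP p p0.
    have h1 : F1 <= F p by exact: Fdec.
    have h2 : (L - p) `^ (- 2^-1) <= W.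
      rewrite -WE !powRN lef_pV2 ?posrE ?powR_gt0//; last by lra.
      by apply: ge0_ler_powR; rewrite ?nnegrE//; lra.
    nra.
  have h1 : F p <= F1 by apply: Fdec => //; exact: ltW.
  have h2 : W <= (L - p) `^ (- 2^-1).
    rewrite -WE !powRN lef_pV2 ?posrE ?powR_gt0//; last by lra.
    by apply: ge0_ler_powR; rewrite ?nnegrE//; lra.
  nra.
have nuE : (\int[mu]_p (G p)%:E = (2 * Num.sqrt L)%:E)%E by exact: integral_ppow_Nhalf.
have wE : (\int[mu]_p (ppow (- 2^-1) p * ppow (- 2^-1) (L - p))%:E = pi%:E)%E.
  have h : 0 < 2^-1 :> R by rewrite invr_gt0.
  have := ppow_beta L h h.
  have -> : 2^-1 - 1 = - 2^-1 :> R by field.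
  have -> : 2^-1 + 2^-1 = 1 :> R by field.
  move=> ->; rewrite Gamma_half Gamma1 divr1 -expr2 sqr_sqrtr ?pi_ge0// subrr ppow_pos//.
  by rewrite powRr0 mulr1.
have lhs0 p : 0 <= ppow (- 2^-1) p * ppow (- 2^-1) (L - p) * F p.
  by rewrite !mulr_ge0 ?ppow_ge0.
have H : (\int[mu]_p (ppow (- 2^-1) p * ppow (- 2^-1) (L - p) * F p)%:E + (F1 * W)%:E * \int[mu]_p (G p)%:E
   <= W%:E * \int[mu]_p (ppow (- 2^-1) p * F p)%:E +
      F1%:E * \int[mu]_p (ppow (- 2^-1) p * ppow (- 2^-1) (L - p))%:E)%E.
  rewrite -[X in (_ + X <= _)%E]ge0_integralZl_EFin; last 4 first.
  - exact: measurableT.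
  - by move=> p _; rewrite lee_fin.
  - by mes.
  - by rewrite mulr_ge0// ltW.
  rewrite -[X in (_ <= X + _)%E]ge0_integralZl_EFin; last 4 first.
  - exact: measurableT.
  - by move=> p _; rewrite lee_fin mulr_ge0 ?ppow_ge0.
  - by mes.
  - exact: ltW.
  rewrite -[X in (_ <= _ + X)%E]ge0_integralZl_EFin; last 4 first.
  - exact: measurableT.
  - by move=> p _; rewrite lee_fin mulr_ge0 ?ppow_ge0.
  - by mes.
  - exact: F10.
  rewrite -[leLHS]ge0_integralD; last 5 first.
  - exact: measurableT.
  - by move=> p _; rewrite lee_fin.
  - by mes.
  - by move=> p _; rewrite -EFinM lee_fin mulr_ge0.
  - by mes.
  rewrite -[leRHS]ge0_integralD; last 5 first.
  - exact: measurableT.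
  - by move=> p _; rewrite -EFinM lee_fin (mulr_ge0 W00)// mulr_ge0 ?ppow_ge0.
  - by mes.
  - by move=> p _; rewrite -EFinM lee_fin (mulr_ge0 F10)// mulr_ge0 ?ppow_ge0.
  - by mes.
  apply: ge0_le_integral.
  - exact: measurableT.
  - by move=> p _; rewrite -EFinM -EFinD lee_fin addr_ge0// mulr_ge0.
  - by mes.
  - by mes.
  rint p; rewrite -!EFinM -!EFinD lee_fin.
  have [p1|p1] := ltP 0 p; last first.
    by rewrite /G ppow_npos// !mul0r; case: ifP; rewrite !mulr0 !addr0.
  have [pL|pL] := ltP p L; last first.
    rewrite /G ltNge pL/= (@ppow_npos _ _ (L - p)) ?subr_le0// !mulr0 mul0r !addr0.
    by rewrite (mulr_ge0 W00)// mulr_ge0 ?ppow_ge0.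
  rewrite /G pL (ppow_pos _ p1) (@ppow_pos _ _ (L - p)) ?subr_gt0//.
  have := key p p1 pL; have := powR_gt0 (- 2^-1) p1; set x := p `^ _; set y := (L - p) `^ _ => x0 h.
  have := ler_wpM2l (ltW x0) h; lra.
move: H; rewrite nuE wE -!EFinM -/W.
have -> : F1 * W * (2 * Num.sqrt L) = F1 * (5 / 4 * pi).
  rewrite /W /k powRN powR12_sqrt ?(ltW L0)//; field.
  by rewrite gt_eqF// sqrtr_gt0.
move=> H.
have H2 : ((F1 * pi)%:E <= (F1 * (5 / 4 * pi))%:E)%E by rewrite lee_fin ler_wpM2l//; lra.
rewrite -(leeD2rE (x := (F1 * pi)%:E))//.
apply: le_trans H; exact: leeD2l.
Qed.

Lemma tail_integral_scale (c b k : R) : 0 < k ->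
  (\int[mu]_p (ppow b p * expR (- (c * psi (k * p))))%:E = (k `^ (- b - 1))%:E * tail_integral c b)%E.
Proof.
move=> k0; have mpsi := measurable_psi.
rewrite /tail_integral [X in (_ * X)%E](ge0_integral_scale k0); last 2 first.
- by mes.
- by move=> r; rewrite lee_fin mulr_ge0 ?ppow_ge0 ?expR_ge0.
rewrite muleA -EFinM -ge0_integralZl_EFin; last 4 first.
- exact: measurableT.
- by move=> r _; rewrite lee_fin mulr_ge0 ?ppow_ge0 ?expR_ge0.
- by mes.
- by rewrite mulr_ge0 ?powR_ge0 ?ltW.
apply: eq_integral; rint p; rewrite -EFinM; congr (_%:E).
rewrite ppowM//.
have kk : k `^ (- b - 1) * k * k `^ b = 1.
  rewrite -{2}(powRr1 (ltW k0)) -!gt0_powRD//.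
  by rewrite (_ : _ + _ = 0) ?powRr0//; ring.
transitivity (k `^ (- b - 1) * k * k `^ b * (ppow b p * expR (- (c * psi (k * p))))).
  by rewrite kk mul1r.
by ring.
Qed.

(** The integral over the sphere of radius r, in the coordinate p = r - y_1. For
    d >= 3 the factor 2 r - p is bounded by 2 r. For d = 2 its exponent is -1/2
    and it is singular at p = 2 r; arcsine_weight_le replaces it by a constant at
    the price of a factor 5 pi / 8, which the passage from m / 2 to m / pi^2 in
    the exponential compensates through the scaling of tail_integral. *)
Lemma tail_integral_cst_M3 n (m a r N : R) : 0 < m -> 1 <= a -> 0 < r -> 0 < N ->
  ((kap n.+1)%:E * \int[mu]_p (ppow (n.+1%:R / 2 - 1) (p * (2 * r - p)) * expR (- (m / 2 * psi (2 * N / a * p))))%:E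
   <= (cst_M3 n.+2 m * (2 * r) `^ (n.+1%:R / 2 - 1) * (a / (2 * N)) `^ (n.+1%:R / 2))%:E)%E.
Proof.
move=> m0 a1 r0 N0; set b : R := n.+1%:R / 2 - 1.
have mpsi := measurable_psi.
have pi2 := @pi_ge2 R.
have a0 : 0 < a by lra.
have r20 : 0 < 2 * r by lra.
have K0 : 0 < 2 * N / a by rewrite divr_gt0//; lra.
have psi0 (v : R) : 0 <= v -> 0 <= psi v by move=> v0; rewrite /psi divr_ge0 ?sqrtr_ge0.
have psi_mono (p q : R) : 0 < p -> p <= q -> psi p <= psi q.
  move=> p0 pq; rewrite /psi.
  have sp : 0 < Num.sqrt (1 + p) by rewrite sqrtr_gt0; lra.
  have sq : 0 < Num.sqrt (1 + q) by rewrite sqrtr_gt0; lra.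
  rewrite ler_pdivrMr// mulrAC ler_pdivlMr//.
  rewrite -(ler_pXn2r (n:=2)) ?nnegrE ?mulr_ge0 ?(ltW sp) ?(ltW sq)//; try lra.
  rewrite !exprMn !sqr_sqrtr; [|lra|lra].
  have : 0 <= (q - p) * (q + p + p * q) by apply: mulr_ge0; nra.
  nra.
have kap0 : 0 <= kap n.+1 :> R.
  by rewrite /kap divr_ge0 ?powR_ge0// ltW// Gamma_gt0// divr_gt0.
pose Fp p := expR (- (m / 2 * psi (2 * N / a * p))).
have [k [kb kM]] : exists k : R, (\int[mu]_p (ppow b (p * (2 * r - p)) * Fp p)%:E <=
    (k * (2 * r) `^ b)%:E * \int[mu]_p (ppow b p * Fp p)%:E)%E /\
    (k%:E * tail_integral (m / 2) b <= tail_integral (m / pi ^+ 2) b)%E /\ 0 <= k.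
  case: n @b kap0 => [|n] b kap0.
    have bE : b = - 2^-1 by rewrite /b; field.
    exists (5 / 8 * pi); split.
      rewrite bE; apply: le_trans (arcsine_weight_le r20 _ _ _).
      - apply: ge0_le_integral.
        + exact: measurableT.
        + by move=> p _; rewrite lee_fin mulr_ge0 ?ppow_ge0 ?expR_ge0.
        + by rewrite /Fp; mes.
        + by rewrite /Fp; mes.
        + by move=> p _; rewrite ppow_mul// addrC subrK.
      - by rewrite /Fp; mes.
      - by move=> p; exact: expR_ge0.
      - move=> p q p0 pq; rewrite ler_expR lerN2 ler_pM2l ?divr_gt0//.
        by apply: psi_mono; [exact: mulr_gt0|rewrite ler_pM2l].
    pose k : R := 5 / 8 * pi; have k1 : 1 < k by rewrite /k; lra.
    have k0 : 0 < k by lra.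
    rewrite -/k; split; last exact: ltW.
    have kk : 0 < k ^+ 2 by rewrite exprn_gt0.
    have := tail_integral_scale (m / pi ^+ 2) b kk.
    have -> : (k ^+ 2) `^ (- b - 1) = k^-1.
      rewrite -powR_mulrn ?ltW// -powRrM bE (_ : 2%:R * _ = -1); last by field.
      by rewrite powR_inv1 ?ltW.
    move=> E.
    have -> : tail_integral (m / pi ^+ 2) b = (k%:E *
        \int[mu]_p (ppow b p * expR (- (m / pi ^+ 2 * psi (k ^+ 2 * p))))%:E)%E.
      by rewrite E muleA -EFinM divff ?gt_eqF// mul1e.
    apply: lee_wpmul2l; first by rewrite lee_fin ltW.
    apply: ge0_le_integral.
    - exact: measurableT.
    - by move=> p _; rewrite lee_fin mulr_ge0 ?ppow_ge0 ?expR_ge0.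
    - by mes.
    - by mes.
    rint v; rewrite lee_fin.
    have [v0|v0] := ltP 0 v; last by rewrite ppow_npos// !mul0r.
    apply: ler_wpM2l; first exact: ppow_ge0.
    rewrite ler_expR lerN2.
    have pi0 : 0 < pi ^+ 2 :> R by rewrite exprn_gt0// pi_gt0.
    apply: (@le_trans _ _ (m / pi ^+ 2 * (k ^+ 2 * psi v))).
      by rewrite ler_pM2l ?divr_gt0// psi_scale ?ltW// expr_gt1// ltW.
    have -> : m / pi ^+ 2 * (k ^+ 2 * psi v) = 25 / 64 * m * psi v.
      rewrite /k; have := lt0r_neq0 (pi_gt0 R); move: (pi : R) => P P0; field.
      by rewrite P0.
    apply: ler_wpM2r; first exact/psi0/ltW.
    by lra.
  have b0 : 0 <= b.
    rewrite /b -natr1 -[n.+1%:R]natr1; have : 0 <= n%:R :> R by []; lra.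
  exists 1; split.
    rewrite mul1r -ge0_integralZl_EFin; last 4 first.
    - exact: measurableT.
    - by move=> p _; rewrite lee_fin mulr_ge0 ?ppow_ge0 ?expR_ge0.
    - by rewrite /Fp; mes.
    - exact: powR_ge0.
    apply: ge0_le_integral.
    - exact: measurableT.
    - by move=> p _; rewrite lee_fin mulr_ge0 ?ppow_ge0 ?expR_ge0.
    - by rewrite /Fp; mes.
    - by rewrite /Fp; mes.
    rint p; rewrite -EFinM lee_fin mulrA ler_wpM2r ?expR_ge0//.
    rewrite ppow_mul; last by rewrite addrC subrK.
    rewrite mulrC; have [p0|p0] := ltP 0 p; last by rewrite [ppow b p]ppow_npos// !mulr0.
    apply: ler_wpM2r; first exact: ppow_ge0.
    rewrite /ppow; case: ifPn => // hp; last exact: powR_ge0.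
    by apply: ge0_ler_powR; rewrite ?nnegrE//; lra.
  split => //; rewrite mul1e; apply: ge0_le_integral.
  - exact: measurableT.
  - by move=> p _; rewrite lee_fin mulr_ge0 ?ppow_ge0 ?expR_ge0.
  - by mes.
  - by mes.
  rint v; rewrite lee_fin.
  have [v0|v0] := ltP 0 v; last by rewrite ppow_npos// !mul0r.
  apply: ler_wpM2l; first exact: ppow_ge0.
  rewrite ler_expR lerN2; apply: ler_wpM2r; first exact/psi0/ltW.
  rewrite ler_pM2l// lef_pV2 ?posrE//; [nra|rewrite exprn_gt0//; lra].
have IE : (\int[mu]_p (ppow b p * Fp p)%:E = ((2 * N / a) `^ (- b - 1))%:E * tail_integral (m / 2) b)%E.
  by rewrite /Fp tail_integral_scale.
have := @cst_M3_ge n m m0; rewrite -/b => M3.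
apply: (@le_trans _ _ ((kap n.+1)%:E * (((2 * r) `^ b * (2 * N / a) `^ (- b - 1))%:E * (k%:E * tail_integral (m / 2) b)))%E).
  rewrite lee_wpmul2l ?lee_fin//; apply: (le_trans kb).
  have comm (X Y : R) T : ((k * X)%:E * (Y%:E * T) = (X * Y)%:E * (k%:E * T))%E.
    by rewrite !muleA -!EFinM; congr (_%:E * _)%E; ring.
  by rewrite IE comm lexx.
rewrite muleCA; have -> : (a / (2 * N)) `^ (n.+1%:R / 2) = (2 * N / a) `^ (- b - 1).
  have -> : - b - 1 = - (n.+1%:R / 2) by rewrite /b; ring.
  by rewrite -[a / _]invf_div -(powR_inv1 (ltW K0)) -powRrM mulN1r.
rewrite -[X in (_ <= X%:E)%E]mulrA [X in (_ <= X%:E)%E]mulrC [X in (_ <= X)%E]EFinM.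
apply: lee_wpmul2l; first by rewrite lee_fin mulr_ge0 ?powR_ge0.
apply: le_trans M3; rewrite lee_wpmul2l ?lee_fin//.
by case: kM.
Qed.

(** The integrand at a point y with |x - y|^2 = p and |y|^2 = q, where x has norm
    N; the condition q <= (N - 1)^2 keeps y at distance at least 1 from x. *)
Definition bulk_kernel (m g e N : R) (p q : R) : R :=
  if [&& 1 <= q, q <= (N - 1) ^+ 2 & p <= N ^+ 2] then
    (expR (- (m * Num.sqrt p)) * Num.sqrt p `^ (- g)) *
    (expR (- (m * Num.sqrt q)) * Num.sqrt q `^ e) else 0.

Lemma bulk_kernel_ge0 m g e N p q : 0 <= bulk_kernel m g e N p q.
Proof. by rewrite /bulk_kernel; case: ifP => // _; rewrite !mulr_ge0 ?expR_ge0 ?powR_ge0. Qed.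

Lemma measurable_bulk_kernel m g e N :
  measurable_fun [set: R * R] (fun p => bulk_kernel m g e N p.1 p.2).
Proof. by rewrite /bulk_kernel; mes. Qed.

(** On the sphere of radius r around 0, the point with first coordinate r - p has
    |x - y|^2 = (N - r)^2 + 2 N p. By sqrt_sub_ge_psi and tail_integral_cst_M3 the
    sphere contributes at most a multiple of r^(s - 1) (N - r)^(dl - 1), and the
    integral over r is a Beta integral. *)
Lemma bulk_integral n (m g s : R) (x : 'rV[R]_n.+2) (dl := (n.+2%:R + 1) / 2 - g) :
  0 < m -> 0 <= g -> 0 < dl -> 0 < s -> 2 < enorm x ->
  (\int[leb n.+2]_y (bulk_kernel m g (s - dl - g) (enorm x) (sqn (x - y)) (sqn y))%:E <=
   (cst_M3 n.+2 m * (Gamma s * Gamma dl / Gamma (s + dl)) *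
     (expR (- (m * enorm x)) * enorm x `^ (s - g)))%:E)%E.
Proof.
move=> m0 g0 dl0 s0 N2; set N := enorm x; set e := s - dl - g.
set K := bulk_kernel m g e N; set b : R := n.+1%:R / 2 - 1.
have mK : measurable_fun [set: R * R] (fun p => K p.1 p.2) by exact: measurable_bulk_kernel.
have K0 p q : 0 <= K p q by exact: bulk_kernel_ge0.
have KE : K = bulk_kernel m g e N by [].
clearbody K.
have M30 : 0 <= cst_M3 n.+2 m by apply: le_trans (cst_M3_ge1 _ _).
have kap0 : 0 <= kap n.+1 :> R.
  by rewrite /kap divr_ge0 ?powR_ge0// ltW// Gamma_gt0// divr_gt0.
rewrite (@ge0_integral_axis _ _ x (fun p q => (K p q)%:E)); last 2 first.
- by mes.
- by move=> p q; rewrite lee_fin.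
transitivity_le (\int[mu]_q \int[mu]_t ((kap n.+1 * (ppow b (q - t ^+ 2) * K ((N - t) ^+ 2 + (q - t ^+ 2)) q)))%:E)%E.
  rewrite [leRHS]tonelli; last 2 first.
  - by mes.
  - by move=> q t; rewrite lee_fin (mulr_ge0 kap0)// mulr_ge0 ?ppow_ge0.
  apply/eq_lee/eq_integral; rint t.
  rewrite (@ge0_integral_radial _ n (fun v => (K ((N - t) ^+ 2 + v) (t ^+ 2 + v))%:E)); last 2 first.
  - by mes.
  - by move=> v; rewrite lee_fin.
  rewrite -ge0_integralZl_EFin; last 4 first.
  - exact: measurableT.
  - by move=> v _; rewrite -EFinM lee_fin mulr_ge0 ?ppow_ge0.
  - by mes.
  - exact: kap0.
  rewrite -(@ge0_integral_shift _ (- t ^+ 2)); last 2 first.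
  - by mes.
  - move=> v; rewrite -!EFinM lee_fin.
    exact: (mulr_ge0 kap0 (mulr_ge0 (ppow_ge0 _ _) (K0 _ _))).
  apply: eq_integral; rint q; rewrite -!EFinM; congr (_%:E).
  by congr (_ * (_ * K _ _)); ring.
pose A := cst_M3 n.+2 m * expR (- (m * N)) * N `^ (- (b + 1)).
have A0 : 0 <= A by rewrite !mulr_ge0 ?expR_ge0 ?powR_ge0.
(* the contribution of the sphere of radius r = sqrt q, with t = r - p *)
have sphere r : 1 <= r -> r <= N - 1 ->
   (\int[mu]_t ((kap n.+1 * (ppow b (r ^+ 2 - t ^+ 2) * K ((N - t) ^+ 2 + (r ^+ 2 - t ^+ 2)) (r ^+ 2))))%:E
   <= (A * (2 * r)^-1 * (r `^ (s - 1) * (N - r) `^ (dl - 1)))%:E)%E.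
  move=> r1 rN; set a := N - r; have a1 : 1 <= a by rewrite /a; lra.
  have r0 : 0 < r by lra.
  have a0 : 0 < a by lra.
  have N0 : 0 < N by lra.
  pose B := expR (- (m * N)) * a `^ (- g) * r `^ e.
  have B0 : 0 <= B by rewrite !mulr_ge0 ?expR_ge0 ?powR_ge0.
  rewrite -(ge0_integral_opp (f := fun t => (kap n.+1 * (ppow b (r ^+ 2 - t ^+ 2) * K ((N - t) ^+ 2 + (r ^+ 2 - t ^+ 2)) (r ^+ 2)))%:E));
    last 2 first.
  - by mes.
  - move=> t; rewrite lee_fin.
    exact: (mulr_ge0 kap0 (mulr_ge0 (ppow_ge0 _ _) (K0 _ _))).
  rewrite -(ge0_integral_shift (- r) (f := fun t => (kap n.+1 * (ppow b (r ^+ 2 - (- t) ^+ 2) * K ((N - - t) ^+ 2 + (r ^+ 2 - (- t) ^+ 2)) (r ^+ 2)))%:E));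
    last 2 first.
  - by mes.
  - move=> t; rewrite lee_fin.
    exact: (mulr_ge0 kap0 (mulr_ge0 (ppow_ge0 _ _) (K0 _ _))).
  have mpsi := measurable_psi.
  transitivity_le (B%:E * ((kap n.+1)%:E * \int[mu]_p (ppow b (p * (2 * r - p)) * expR (- (m / 2 * psi (2 * N / a * p))))%:E))%E.
    rewrite -ge0_integralZl_EFin; last 4 first.
    - exact: measurableT.
    - by move=> p _; rewrite lee_fin mulr_ge0 ?ppow_ge0 ?expR_ge0.
    - by mes.
    - exact: kap0.
    rewrite -ge0_integralZl_EFin; last 4 first.
    - exact: measurableT.
    - by move=> p _; rewrite -EFinM lee_fin (mulr_ge0 kap0)// mulr_ge0 ?ppow_ge0 ?expR_ge0.
    - by mes.
    - exact: B0.
    apply: ge0_le_integral.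
    - exact: measurableT.
    - move=> p _; rewrite lee_fin.
      exact: (mulr_ge0 kap0 (mulr_ge0 (ppow_ge0 _ _) (K0 _ _))).
    - by mes.
    - by mes.
    rint p; rewrite -!EFinM lee_fin [leRHS]mulrCA.
    apply: (ler_wpM2l kap0).
    have -> : r ^+ 2 - (- (p - r)) ^+ 2 = p * (2 * r - p) by ring.
    have -> : (N - - (p - r)) ^+ 2 + p * (2 * r - p) = a ^+ 2 + 2 * N * p.
      by rewrite /a; ring.
    have [hp|hp] := leP (p * (2 * r - p)) 0.
      by rewrite ppow_npos// !mul0r mulr0.
    have p0 : 0 < p by nra.
    rewrite [leRHS]mulrCA; apply: (ler_wpM2l (ppow_ge0 _ _)).
    rewrite KE /bulk_kernel; case: ifP => _; last by rewrite mulr_ge0 ?expR_ge0.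
    rewrite [Num.sqrt (r ^+ 2)]sqrtr_sqr (ger0_norm (ltW r0)).
    have Np0 : 0 <= 2 * N * p by rewrite !mulr_ge0// ltW.
    have h1 := sqrt_sub_ge_psi a1 Np0.
    rewrite mulrAC in h1.
    set S := Num.sqrt _ in h1 *.
    have p1 : 0 <= psi (2 * N / a * p).
      rewrite /psi divr_ge0 ?sqrtr_ge0// (mulr_ge0 _ (ltW p0))// divr_ge0 ?ltW// mulr_gt0//.
    have aS : a <= S by lra.
    have S0 : 0 < S by lra.
    have h2 : S `^ (- g) <= a `^ (- g).
      rewrite !powRN lef_pV2 ?posrE ?powR_gt0//.
      by apply: ge0_ler_powR; rewrite ?nnegrE//; exact: ltW.
    have h3 : expR (- (m * S)) * expR (- (m * r)) <= expR (- (m * N)) * expR (- (m / 2 * psi (2 * N / a * p))).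
      rewrite -!expRD ler_expR; move: h1 p1; rewrite /a; set z := psi _ => h1 _; nra.
    have := ler_pM _ _ h3 h2; rewrite !mulr_ge0 ?expR_ge0 ?powR_ge0// => /(_ isT isT) h.
    have := ler_wpM2r (powR_ge0 r e) h; rewrite /B.
    by apply: ler_eq2; ring.
  apply: le_trans.
    apply: lee_wpmul2l; first by rewrite lee_fin.
    exact: (tail_integral_cst_M3 n m0 a1 r0 N0).
  rewrite -EFinM lee_fin; apply/eq_ler.
  have n20 : 0 < 2 * N by lra.
  have r20 : 0 < 2 * r by lra.
  have bE : n.+1%:R / 2 = b + 1 by rewrite /b; ring.
  have -> : (2 * r) `^ b = (2 * r) `^ (b + 1) * (2 * r)^-1.
    by rewrite gt0_powRD// powRr1 ?ltW// mulfK// gt_eqF.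
  have -> : (a / (2 * N)) `^ (n.+1%:R / 2) = a `^ (b + 1) * 2 `^ (- (b + 1)) * N `^ (- (b + 1)).
    rewrite bE powRM ?invr_ge0 ?ltW// -mulrA -(powRM _ (ltW (ltr0Sn R 1)) (ltW N0)).
    by rewrite -[(2 * N)^-1](powR_inv1 (ltW n20)) -powRrM mulN1r.
  have -> : (2 * r) `^ (b + 1) = 2 `^ (b + 1) * r `^ (b + 1) by rewrite powRM ?ltW.
  have -> : s - 1 = e + (b + 1).
    by rewrite /e /b /dl -[n.+2%:R]natr1; field.
  have -> : dl - 1 = - g + (b + 1) by rewrite /b /dl -[n.+2%:R]natr1; field.
  have two0 : 0 < 2 :> R by [].
  rewrite (gt0_powRD e (b + 1) r0) (gt0_powRD (- g) (b + 1) a0).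
  rewrite /A /B; have := gt0_powRD (b + 1) (- (b + 1)) two0.
  rewrite addrN powRr0; set P := 2 `^ (b + 1); set Q := 2 `^ _.
  set M := cst_M3 _ _; set X1 := expR _; set X2 := N `^ _; set X3 := a `^ _.
  set X4 := a `^ _; set X5 := r `^ _; set X6 := r `^ _; set X7 := (2 * r)^-1.
  move=> PQ; transitivity (M * X1 * X2 * X7 * (X5 * X6 * (X3 * X4)) * (P * Q)); last by rewrite -PQ mulr1.
  by ring.
rewrite -/N in N2; have N0 : 0 < N by exact: lt_trans N2.
pose H q : \bar R := (A * (2 * Num.sqrt q)^-1 * (ppow (s - 1) (Num.sqrt q) * ppow (dl - 1) (N - Num.sqrt q)))%:E.
have H0 q : (0 <= H q)%E.
  rewrite lee_fin; apply: mulr_ge0; last by rewrite mulr_ge0 ?ppow_ge0.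
  by rewrite mulr_ge0// invr_ge0 mulr_ge0// sqrtr_ge0.
have HE : H = fun q => (A * (2^-1 * (Num.sqrt q) `^ (-1)) * (ppow (s - 1) (Num.sqrt q) * ppow (dl - 1) (N - Num.sqrt q)))%:E.
  by apply/funext => q; rewrite powR_inv1 ?sqrtr_ge0// -invfM.
have mH : measurable_fun setT H.
  by rewrite HE; mes; exact: measurable_sqrtr.
transitivity_le (\int[mu]_q (if (0 < q)%R then H q else 0))%E.
  apply: ge0_le_integral.
  - exact: measurableT.
  - move=> q _; apply: integral_ge0 => t _; rewrite lee_fin.
    exact: (mulr_ge0 kap0 (mulr_ge0 (ppow_ge0 _ _) (K0 _ _))).
  - apply: measurable_integral2; first by mes.
    move=> q t; rewrite lee_fin.
    exact: (mulr_ge0 kap0 (mulr_ge0 (ppow_ge0 _ _) (K0 _ _))).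
  - by mes.
  rint q; case: (boolP ((1 <= q) && (q <= (N - 1) ^+ 2))) => [/andP[q1 q2]|hq]; last first.
    rewrite integral0_eq; first by case: ifP.
    rint t; rewrite KE /bulk_kernel andbA (negbTE hq) /=.
    by rewrite !mulr0.
  have q0 : 0 < q by lra.
  rewrite q0 /H -{1 2 3}(sqr_sqrtr (ltW q0)).
  have r1 : 1 <= Num.sqrt q by rewrite -[leLHS]sqrtr1 ler_wsqrtr.
  have r2 : Num.sqrt q <= N - 1.
    by rewrite -[leRHS]ger0_norm; [rewrite -sqrtr_sqr ler_wsqrtr|lra].
  rewrite (ppow_pos _ (_ : 0 < Num.sqrt q)); last by lra.
  rewrite (ppow_pos _ (_ : 0 < N - Num.sqrt q)); last by lra.
  exact: (sphere (Num.sqrt q)).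
rewrite ge0_integral_sqr//.
apply/eq_lee.
transitivity (\int[mu]_z (A * (ppow (s - 1) z * ppow (dl - 1) (N - z)))%:E)%E.
  apply: eq_integral; rint z; case: ifPn => z0; last first.
    by rewrite ppow_npos ?mul0r ?mulr0// leNgt.
  rewrite /H sqrtr_sqr (ger0_norm (ltW z0)) -EFinM; congr (_%:E).
  have : 2 * z != 0 by rewrite gt_eqF// mulr_gt0.
  set z2 := 2 * z; set X := ppow _ _ * _ => z20.
  by rewrite [A / z2 * X]mulrAC [LHS]mulrC divfK.
transitivity (A%:E * \int[mu]_z (ppow (s - 1) z * ppow (dl - 1) (N - z))%:E)%E.
rewrite -ge0_integralZl_EFin; last 4 first.
- exact: measurableT.
- by move=> z _; rewrite lee_fin mulr_ge0 ?ppow_ge0.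
- by mes.
- exact: A0.
  by apply: eq_integral; rint z; rewrite EFinM.
rewrite ppow_beta// -EFinM ppow_pos//; congr (_%:E).
have -> : s - g = s + dl - 1 + - (b + 1) by rewrite /b /dl -[n.+2%:R]natr1; field.
rewrite (gt0_powRD (s + dl - 1) (- (b + 1)) N0) /A; set X1 := _ / _; set X2 := expR _; set X3 := N `^ _; set X4 := N `^ _.
by ring.
Qed.

(** In dimension 1 the region is 1 <= y <= N - 1, where |x - y| + |y| = N exactly. *)
Lemma bulk_integral1 (m g s : R) (x : 'rV[R]_1) (dl := (1%:R + 1) / 2 - g) :
  0 < dl -> 0 < s -> 2 < enorm x ->
  (\int[leb 1]_y (bulk_kernel m g (s - dl - g) (enorm x) (sqn (x - y)) (sqn y))%:E <=
   (Gamma s * Gamma dl / Gamma (s + dl) *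
     (expR (- (m * enorm x)) * enorm x `^ (s - g)))%:E)%E.
Proof.
move=> dl0 s0; set N := enorm x; set e := s - dl - g => N2.
have dlE : dl - 1 = - g by rewrite /dl; field.
have eE : e = s - 1 by rewrite /e /dl; field.
set K := bulk_kernel m g e N.
have mK : measurable_fun [set: R * R] (fun p => K p.1 p.2) by exact: measurable_bulk_kernel.
have K0 p q : 0 <= K p q by exact: bulk_kernel_ge0.
have KE : K = bulk_kernel m g e N by [].
clearbody K.
rewrite (@ge0_integral_axis _ _ x (fun p q => (K p q)%:E)); last 2 first.
- by mes.
- by move=> p q; rewrite lee_fin.
have N0 : 0 < N by exact: lt_trans N2.
transitivity_le ((expR (- (m * N)))%:E * \int[mu]_t (ppow (s - 1) t * ppow (dl - 1) (N - t))%:E)%E; last first.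
  rewrite ppow_beta// -EFinM ppow_pos//; apply/eq_lee; congr (_%:E).
  have -> : s + dl - 1 = s - g by rewrite -addrA dlE.
  by rewrite mulrCA.
rewrite -ge0_integralZl_EFin; last 4 first.
- exact: measurableT.
- by move=> t _; rewrite lee_fin mulr_ge0 ?ppow_ge0.
- by mes.
- exact: expR_ge0.
apply: ge0_le_integral.
- exact: measurableT.
- by move=> t _; apply: integral_ge0 => w _; rewrite lee_fin.
- rewrite (_ : (fun _ => _) = fun t : R => (K ((N - t) ^+ 2) (t ^+ 2))%:E); first by mes.
  by apply/funext => t; rewrite integral_rV0 sqn0 !addr0.
- by mes.
rint t; rewrite integral_rV0 sqn0 !addr0 -EFinM lee_fin KE /bulk_kernel.
case: ifPn => [/and3P[q1 q2 p1]|_]; last first.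
  by apply: mulr_ge0; [exact: expR_ge0|rewrite mulr_ge0 ?ppow_ge0].
rewrite -/N in p1 *.
have t0 : 0 < t by rewrite ltNge; apply/negP => t0; nra.
have tN : 0 < N - t by rewrite ltNge; apply/negP => tN; nra.
rewrite !sqrtr_sqr (ger0_norm (ltW t0)) (ger0_norm (ltW tN)) !ppow_pos// dlE eE.
have -> : m * N = m * (N - t) + m * t by ring.
rewrite opprD expRD; apply/eq_ler; set X1 := expR _; set X2 := expR _; set X3 := _ `^ _; set X4 := _ `^ _.
by ring.
Qed.

Lemma cst_D2_ge1 d (m : R) : 1 <= cst_D2 d m.
Proof. by rewrite /cst_D2; case: ifP => // _; exact: cst_M3_ge1. Qed.

Lemma bulk_integral_cst_D2 d (m g s : R) (x : 'rV[R]_d.+1) (dl := (d.+1%:R + 1) / 2 - g) :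
  0 < m -> 0 <= g -> 0 < dl -> 0 < s -> 2 < enorm x ->
  (\int[leb d.+1]_y (bulk_kernel m g (s - dl - g) (enorm x) (sqn (x - y)) (sqn y))%:E <=
   (cst_D2 d.+1 m * (Gamma s * Gamma dl / Gamma (s + dl)) *
     (expR (- (m * enorm x)) * enorm x `^ (s - g)))%:E)%E.
Proof.
move=> m0 g0; rewrite /dl; case: d x {dl} => [|n] x dl0 s0 N2; last exact: bulk_integral.
by rewrite /cst_D2 eqxx mul1r; exact: bulk_integral1.
Qed.

End Bulk.

(** * The density and the Euclidean norm *)

Section RadialProfile.
Context {R : realType} (m gamma : R) (k : profile).
Hypotheses (m0 : 0 < m) (gamma0 : 0 <= gamma).
Local Notation mu := (@lebesgue_measure R).
Local Notation leb n := (@lebesgue_rV R n).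
Local Notation radial := (radial gamma k).

Lemma radial_gt0 r : 0 < r -> 0 < radial r.
Proof.
by move=> r0; rewrite /Defs.radial; case: k; rewrite powR_gt0// lt_max r0 ltr01.
Qed.

Lemma radial_ge0 r : 0 <= radial r.
Proof. by rewrite /Defs.radial; case: k; rewrite powR_ge0. Qed.

Lemma powRN_decreasing (g r s : R) : 0 <= g -> 0 < r -> r <= s -> s `^ (- g) <= r `^ (- g).
Proof.
move=> g0 r0 rs; have s0 : 0 < s by exact: lt_le_trans rs.
by rewrite !powRN lef_pV2 ?posrE ?powR_gt0// ge0_ler_powR// nnegrE ltW.
Qed.

Lemma radial_decreasing_profile r s : 0 < r -> r <= s -> radial s <= radial r.
Proof.
move=> r0 rs; rewrite /Defs.radial; case: k; first exact: powRN_decreasing.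
apply: powRN_decreasing => //; first by rewrite lt_max ltr01.
by rewrite ge_max le_max lexx/= le_max rs orbT.
Qed.

Lemma radial_le_powR r : 0 < r -> radial r <= r `^ (- gamma).
Proof.
move=> r0; rewrite /Defs.radial; case: k => //.
by apply: powRN_decreasing => //; rewrite le_max lexx orbT.
Qed.

Lemma radial_ge1 r : 1 <= r -> radial r = r `^ (- gamma).
Proof. by move=> r1; rewrite /Defs.radial; case: k => //; rewrite (max_idPr r1). Qed.

Definition profile_sqr (p : R) : R := expR (- (m * Num.sqrt p)) * radial (Num.sqrt p).

Lemma densityE d (x : 'rV[R]_d) : density m gamma k x = profile_sqr (sqn x).
Proof. by []. Qed.

Lemma profile_sqr_ge0 p : 0 <= profile_sqr p.
Proof. by rewrite mulr_ge0 ?expR_ge0 ?radial_ge0. Qed.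

Lemma measurable_radial : measurable_fun [set: R] radial.
Proof.
rewrite /Defs.radial; case: k; first by mes; exact: measurable_powR.
have mmax : measurable_fun [set: R] (fun r : R => Num.max 1 r).
  by apply: measurable_maxr; [exact: measurable_cst|exact: measurable_id].
by mes.
Qed.

Lemma measurable_profile_sqr : measurable_fun [set: R] profile_sqr.
Proof.
have mr := measurable_radial; have ms := @measurable_sqrtr R.
by rewrite /profile_sqr; mes.
Qed.

Lemma profile_sqr_decreasing p q : 0 < p -> p <= q -> profile_sqr q <= profile_sqr p.
Proof.
move=> p0 pq; have sp : 0 < Num.sqrt p by rewrite sqrtr_gt0.
have spq : Num.sqrt p <= Num.sqrt q by exact: ler_wsqrtr.
apply: ler_pM; rewrite ?expR_ge0 ?radial_ge0//.
  by rewrite ler_expR lerN2 ler_pM2l.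
exact: radial_decreasing_profile.
Qed.

Lemma density_gt0 d (x : 'rV[R]_d) : 0 < enorm x -> 0 < density m gamma k x.
Proof. by move=> x0; rewrite mulr_gt0 ?expR_gt0 ?radial_gt0. Qed.

Lemma density_ge0 d (x : 'rV[R]_d) : 0 <= density m gamma k x.
Proof. exact: profile_sqr_ge0. Qed.

Lemma density_ge1E d (x : 'rV[R]_d) : 1 <= enorm x ->
  density m gamma k x = expR (- (m * enorm x)) * enorm x `^ (- gamma).
Proof. by move=> x1; rewrite /density radial_ge1. Qed.

Lemma density_decreasing d (x y : 'rV[R]_d) : 0 < enorm x -> enorm x <= enorm y ->
  density m gamma k y <= density m gamma k x.
Proof.
move=> x0 xy; rewrite !densityE; apply: profile_sqr_decreasing; rewrite -!enorm_sqr ?exprn_gt0//.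
by rewrite ler_pXn2r ?nnegrE ?enorm_ge0.
Qed.

Lemma integral_density_lty d : gamma < (d.+1%:R + 1) / 2 ->
  (\int[leb d.+1]_x (density m gamma k x)%:E < +oo)%E.
Proof.
move=> hg.
have mF := measurable_profile_sqr.
rewrite (@ge0_integral_radial _ d (fun v => (profile_sqr v)%:E)); last 2 first.
- by mes.
- by move=> v; rewrite lee_fin profile_sqr_ge0.
apply: lte_mul_pinfty => //.
  by rewrite lee_fin /kap divr_ge0 ?powR_ge0// ltW// Gamma_gt0// divr_gt0.
have s0 : 0 < d.+1%:R - gamma.
  move: hg; rewrite -[d.+1%:R]natr1; have : 0 <= d%:R :> R by []; lra.
rewrite (_ : (\int[mu]_v _)%E = (\int[mu]_v (if (0 < v)%R then (ppow (d.+1%:R / 2 - 1) v * profile_sqr v)%:E else 0))%E); last first.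
  apply: eq_integral; rint v; rewrite -EFinM; case: ifPn => //.
  by rewrite -leNgt => v0; rewrite ppow_npos// mul0r.
rewrite ge0_integral_sqr; last 2 first.
- by mes.
- by move=> v; rewrite lee_fin mulr_ge0 ?ppow_ge0 ?profile_sqr_ge0.
apply: (@le_lt_trans _ _ (2%:E * \int[mu]_z (ppow (d.+1%:R - gamma - 1) z * expR (- (m * z)))%:E)%E); last first.
  by apply: lte_mul_pinfty => //; exact: integral_ppow_expR_lty.
rewrite -ge0_integralZl_EFin; last 4 first.
- exact: measurableT.
- by move=> t _; rewrite lee_fin mulr_ge0 ?ppow_ge0 ?expR_ge0.
- by mes.
- by [].
apply: ge0_le_integral.
- exact: measurableT.
- move=> z _; case: ifPn => // z0; rewrite -EFinM lee_fin mulr_ge0//; first by rewrite mulr_ge0// ltW.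
  by rewrite mulr_ge0 ?ppow_ge0 ?profile_sqr_ge0.
- by mes.
- by mes.
rint z; case: ifPn => z0; rewrite -?EFinM lee_fin; last first.
  by apply: mulr_ge0 => //; rewrite mulr_ge0 ?ppow_ge0 ?expR_ge0.
rewrite -mulrA ler_pM2l// /profile_sqr sqrtr_sqr (ger0_norm (ltW z0)) !ppow_pos ?exprn_gt0//.
have E0 : 0 <= expR (- (m * z)) by exact: expR_ge0.
rewrite [leLHS](_ : _ = expR (- (m * z)) * (z * (z ^+ 2) `^ (d.+1%:R / 2 - 1) * radial z)); last first.
  by set X1 := _ `^ _; set X2 := expR _; set X3 := radial _; ring.
rewrite [leRHS]mulrC; apply: (ler_wpM2l E0).
have -> : z `^ (d.+1%:R - gamma - 1) = z * (z ^+ 2) `^ (d.+1%:R / 2 - 1) * z `^ (- gamma).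
  rewrite -[z ^+ 2]powR_mulrn ?ltW// -powRrM -[X in X * _ * _]powRr1 ?ltW// -!gt0_powRD//.
  by congr (_ `^ _); field.
apply: ler_wpM2l; last exact: radial_le_powR.
by rewrite mulr_ge0 ?powR_ge0// ltW.
Qed.

Lemma L1norm_density d : gamma < (d.+1%:R + 1) / 2 ->
  ((L1norm (density m gamma k : 'rV[R]_d.+1 -> R))%:E =
   \int[leb d.+1]_x (density m gamma k x)%:E)%E.
Proof.
move=> hg; rewrite /L1norm Lnorm1.
have -> : (\int[leb d.+1]_x `|(EFin \o density m gamma k) x| = \int[leb d.+1]_x (density m gamma k x)%:E)%E.
  by apply: eq_integral => x _; rewrite gee0_abs// lee_fin density_ge0.
rewrite fineK// ge0_fin_numE ?integral_density_lty//.
by apply: integral_ge0 => x _; rewrite lee_fin density_ge0.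
Qed.

Lemma L1norm_density_ge0 d : 0 <= L1norm (density m gamma k : 'rV[R]_d -> R).
Proof. by rewrite /L1norm fine_ge0// Lnorm_ge0. Qed.

End RadialProfile.

Section Triangle.
Context {R : realType} {d : nat}.
Implicit Types x y : 'rV[R]_d.

(** The discriminant of t |-> |x - t y|^2. *)
Lemma cauchy_schwarz x y : (\sum_i x ord0 i * y ord0 i) ^+ 2 <= sqn x * sqn y.
Proof.
set P := \sum_i _.
have H t : 0 <= sqn x - 2 * t * P + t ^+ 2 * sqn y.
  rewrite (_ : _ + _ = \sum_i (x ord0 i - t * y ord0 i) ^+ 2); first by apply: sumr_ge0 => i _; rewrite sqr_ge0.
  rewrite /sqn /P !mulr_sumr -sumrB -big_split /=; apply: eq_bigr => i _; ring.
have y0 := sqn_ge0 y; have [y1|y1] := leP (sqn y) 0.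
  have yE : sqn y = 0 by apply/eqP; rewrite eq_le y1 y0.
  have [->|P0] := eqVneq P 0; first by rewrite expr0n mulr_ge0 ?sqn_ge0.
  have := H ((sqn x + 1) / P); have := sqn_ge0 x; rewrite yE mulr0 addr0 -mulrA divfK//.
  by move: (sqn x) => a a0; lra.
have := H (P / sqn y).
have -> : sqn x - 2 * (P / sqn y) * P + (P / sqn y) ^+ 2 * sqn y = (sqn x * sqn y - P ^+ 2) / sqn y.
  by field; rewrite gt_eqF.
by rewrite pmulr_lge0 ?invr_gt0// subr_ge0.
Qed.

Lemma enorm_triangle x y : enorm x <= enorm (x - y) + enorm y.
Proof.
set u := x - y; have -> : x = u + y by rewrite /u subrK.
rewrite -(ler_pXn2r (n:=2)) ?nnegrE ?addr_ge0 ?enorm_ge0// sqrrD !enorm_sqr.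
have -> : sqn (u + y) = sqn u + (\sum_i u ord0 i * y ord0 i) *+ 2 + sqn y.
  rewrite /sqn -sumrMnl -!big_split /=; apply: eq_bigr => i _; rewrite mxE; ring.
rewrite lerD2r lerD2l lerMn2r /=.
apply: le_trans (ler_norm _) _.
rewrite -(ler_pXn2r (n:=2)) ?nnegrE ?mulr_ge0 ?enorm_ge0// exprMn !enorm_sqr.
by rewrite -normrX ger0_norm ?sqr_ge0// cauchy_schwarz.
Qed.

Lemma enormZ a x : 0 <= a -> enorm (a *: x) = a * enorm x.
Proof.
move=> a0; rewrite /enorm -{2}(ger0_norm a0) -sqrtr_sqr -sqrtrM ?sqr_ge0//; congr Num.sqrt.
by rewrite mulr_sumr; apply: eq_bigr => i _; rewrite mxE exprMn.
Qed.

End Triangle.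

(** * Upper bound for the convolution powers *)

(** The total masses of h and of f account for the parts of the integral in which
    one of the two factors is nearly constant; K is the remaining part. *)
Lemma conv_le_split (R : realType) d (f : 'rV[R]_d -> R) (h K : 'rV[R]_d -> \bar R) (A B : R) (x : 'rV[R]_d) :
  measurable_fun setT f -> (forall y, 0 <= f y) ->
  measurable_fun setT h -> (forall y, 0 <= h y)%E ->
  measurable_fun setT K -> (forall y, 0 <= K y)%E -> 0 <= A -> 0 <= B ->
  (forall y, (f (x - y)%R)%:E * h y <= A%:E * h y + B%:E * (f (x - y)%R)%:E + K y)%E ->
  (conv f h x <= A%:E * \int[@lebesgue_rV R d]_y h y + B%:E * \int[@lebesgue_rV R d]_y (f y)%:E +
     \int[@lebesgue_rV R d]_y K y)%E.
Proof.
move=> mf f0 mh h0 mK K0 A0 B0 H; rewrite /Defs.conv.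
have P1 (y : 'rV[R]_d) : (0 <= A%:E * h y)%E by exact: mule_ge0.
have P2 (y : 'rV[R]_d) : (0 <= B%:E * (f (x - y))%:E)%E by rewrite -EFinM lee_fin mulr_ge0.
have m1 : measurable_fun setT (fun y : 'rV[R]_d => A%:E * h y)%E by mes.
have m2 : measurable_fun setT (fun y : 'rV[R]_d => B%:E * (f (x - y)%R)%:E)%E by mes.
have m12 : measurable_fun setT (fun y : 'rV[R]_d => A%:E * h y + B%:E * (f (x - y)%R)%:E)%E by mes.
transitivity_le (\int[@lebesgue_rV R d]_y (A%:E * h y + B%:E * (f (x - y)%R)%:E + K y))%E.
  apply: ge0_le_integral => //.
  - by move=> y _; rewrite mule_ge0// lee_fin.
  - by mes.
  - by mes.
rewrite ge0_integralD//; last by move=> y _; rewrite adde_ge0.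
rewrite ge0_integralD// ge0_integralZl_EFin// ge0_integralZl_EFin//; last 2 first.
- by move=> y _; rewrite lee_fin.
- by mes.
rewrite (ge0_integral_rV_sub x (F := fun y => (f y)%:E))//.
by mes.
Qed.

(** With n = j + 1, the factor D^(n-1) Gamma(s)^n / Gamma(s n) of both bounds. *)
Definition wright_coef (R : realType) (D s : R) (j : nat) : R :=
  D ^+ j * (Gamma s ^+ j.+1 / Gamma (s * j.+1%:R)).

Lemma wright_coef0 (R : realType) (D s : R) : 0 < s -> wright_coef D s 0 = 1.
Proof. by move=> s0; rewrite /wright_coef expr0 expr1 mul1r mulr1 divff// gt_eqF// Gamma_gt0. Qed.

Lemma wright_coef_gt0 (R : realType) (D s : R) j : 0 < D -> 0 < s -> 0 < wright_coef D s j.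
Proof.
move=> D0 s0; apply: mulr_gt0; first exact: exprn_gt0.
apply: divr_gt0; first by apply: exprn_gt0; exact: Gamma_gt0.
by apply: Gamma_gt0; exact: mulr_gt0.
Qed.

(** One more convolution multiplies by D and by the Beta integral B(s (j+1), s). *)
Lemma wright_coefS (R : realType) (D s : R) j : 0 < s ->
  wright_coef D s j * (D * (Gamma (s * j.+1%:R) * Gamma s / Gamma (s * j.+1%:R + s))) = wright_coef D s j.+1.
Proof.
move=> s0; rewrite /wright_coef.
have -> : s * j.+1%:R + s = s * j.+2%:R by rewrite -[in RHS]natr1; ring.
have : Gamma (s * j.+1%:R) != 0 by rewrite gt_eqF// Gamma_gt0// mulr_gt0.
have : Gamma (s * j.+2%:R) != 0 by rewrite gt_eqF// Gamma_gt0// mulr_gt0.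
set G1 := Gamma _; set G2 := Gamma _; set G := Gamma _ => g1 g2.
by rewrite [D ^+ j.+1]exprSr [G ^+ j.+2]exprSr; field; rewrite g1 g2.
Qed.

Opaque wright_coef.

Section UpperBound.
Context {R : realType} (d : nat) (m gamma : R) (k : profile) (C1 C2 : R).
Hypotheses (m0 : 0 < m) (gamma0 : 0 <= gamma) (hgamma : gamma < (d.+1%:R + 1) / 2).
Local Notation mu := (@lebesgue_measure R).
Local Notation leb n := (@lebesgue_rV R n).
Local Notation f := (density m gamma k : 'rV[R]_d.+1 -> R).
Local Notation I := (L1norm f).
Local Notation M2 := (cst_M2 d.+1 m gamma k C1 C2).
Local Notation D2 := (cst_D2 d.+1 m).
Local Notation r2 := (rho2 d.+1 gamma).
Hypothesis hC1 : 1 <= C1 /\ forall x y : 'rV[R]_d.+1,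
  1 <= enorm x -> enorm x <= enorm y -> enorm y <= enorm x + 1 -> f x <= C1 * f y.
Hypothesis hC2 : 1 <= C2 /\ forall x : 'rV[R]_d.+1, enorm x <= 1 -> f x <= C2 * f (2 *: x).

Local Notation mF := (measurable_profile_sqr m gamma k).
Local Notation F0 := (profile_sqr_ge0 m gamma k).
Local Notation Fdec := (profile_sqr_decreasing k m0 gamma0).

Lemma measurable_density : measurable_fun [set: 'rV[R]_d.+1] f.
Proof. by have := mF => mF'; rewrite (_ : f = fun x => profile_sqr m gamma k (sqn x)); first by mes. Qed.

Lemma density_convn_ge0 n x : (0 <= convn f n.+1 x)%E.
Proof. exact: (convn_ge0 mF F0 Fdec). Qed.

Lemma measurable_density_convn n : measurable_fun setT (convn f n.+1).
Proof. exact: (measurable_convn mF F0 Fdec). Qed.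

Lemma density_convn_le n x y : 0 < enorm x -> enorm x <= enorm y ->
  (convn f n.+1 y <= convn f n.+1 x)%E.
Proof.
move=> x0 xy; apply: (convn_le mF F0 Fdec); rewrite -!enorm_sqr ?exprn_gt0//.
by rewrite ler_pXn2r ?nnegrE ?enorm_ge0.
Qed.

Lemma integral_density_convn n : (\int[leb d.+1]_x convn f n.+1 x = (I ^+ n.+1)%:E)%E.
Proof. by rewrite (integral_convn d mF F0 Fdec) EFin_expe (L1norm_density k m0 gamma0 hgamma). Qed.

Lemma integral_density : (\int[leb d.+1]_y (f y)%:E = I%:E)%E.
Proof. by rewrite L1norm_density. Qed.

Let I0 : 0 <= I.
Proof. exact: L1norm_density_ge0. Qed.

Let M2_ge (C : R) : C = C1 \/ C = C2 -> C * I <= M2.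
Proof. by rewrite /cst_M2 => -[] ->; apply: (ler_wpM2r I0); rewrite le_max lexx ?orbT. Qed.

Let M20 : 0 <= M2.
Proof. by apply: le_trans (M2_ge (or_introl erefl)); rewrite mulr_ge0// (le_trans ler01)//; case: hC1. Qed.

Let expI_le (C : R) n : 1 <= C -> C * I <= M2 -> C * I ^+ n.+1 <= M2 ^+ n.+1.
Proof.
move=> C1' CM; have C0 : 0 <= C by exact: le_trans C1'.
have CI0 : 0 <= C * I by exact: mulr_ge0.
have CM' : (C * I) ^+ n.+1 <= M2 ^+ n.+1 by rewrite ler_pXn2r ?nnegrE.
apply: le_trans CM'; rewrite exprMn; apply: ler_wpM2r; first exact: exprn_ge0.
by rewrite exprS ler_peMr// exprn_ege1.
Qed.

Opaque density convn cst_M2 L1norm.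

(** Either |x - y| or |y| is at least |x| / 2, and by monotonicity the
    corresponding factor is at most its value at x / 2, which the doubling
    property of f compares with its value at x. *)
Lemma convn_near_origin n x : 0 < enorm x -> enorm x <= 2 ->
  (convn f n.+1 x <= (n.+1%:R * M2 ^+ n * f x)%:E)%E.
Proof.
elim: n x => [|n IH] x x0 x2; first by rewrite expr0 !mul1r lexx.
have [C2_ge1 C2P] := hC2.
set z := 2^-1 *: x.
have zE : enorm z = enorm x / 2 by rewrite enormZ ?invr_ge0// mulrC.
have z0 : 0 < enorm z by rewrite zE; lra.
have z1 : enorm z <= 1 by rewrite zE; lra.
have fz : f z <= C2 * f x.
  have h2 : x = 2 *: z by rewrite /z scalerA mulfV ?pnatr_eq0 ?scale1r.
  rewrite [in leRHS]h2; exact: C2P.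
have mc := measurable_density_convn n; have mf := measurable_density.
have c0 := density_convn_ge0 n.
have C20 : 0 <= C2 by exact: le_trans C2_ge1.
have fx0 : 0 <= f x by exact: density_ge0.
have cz : (convn f n.+1 z <= (n.+1%:R * M2 ^+ n * (C2 * f x))%:E)%E.
  apply: le_trans (IH z z0 _) _; first by lra.
  by rewrite lee_fin; apply: ler_wpM2l fz; rewrite mulr_ge0// exprn_ge0.
set B := n.+1%:R * M2 ^+ n * (C2 * f x) in cz.
have B0 : 0 <= B by exact: (mulr_ge0 (mulr_ge0 (ler0n _ _) (exprn_ge0 _ M20)) (mulr_ge0 C20 fx0)).
have := @conv_le_split _ _ f (convn f n.+1) (cst 0%E) (C2 * f x) B x mf (@density_ge0 _ m gamma k _)
  mc c0 (measurable_cst _) (fun=> lexx _) (mulr_ge0 C20 fx0) B0.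
rewrite convnS integral0 adde0 => H; apply: le_trans (H _) _ => {H}.
  move=> y; rewrite adde0.
  have [h|h] := leP (enorm x / 2) (enorm (x - y)).
    apply: le_trans (leeDl _ _); last by rewrite -EFinM lee_fin; exact: (mulr_ge0 B0 (density_ge0 _ _ _ _)).
    apply: lee_wpmul2r; first exact: c0.
    rewrite lee_fin; apply: le_trans fz.
    by apply: (density_decreasing k m0 gamma0 z0); rewrite zE.
  apply: le_trans (leeDr _ _); last by apply: (mule_ge0 _ (c0 y)); rewrite lee_fin mulr_ge0.
  rewrite muleC; apply: lee_wpmul2r; first by rewrite lee_fin density_ge0.
  apply: le_trans cz; apply: density_convn_le; first exact: z0.
  rewrite zE.
  by have := enorm_triangle x y; lra.
rewrite integral_density_convn integral_density -!EFinM -EFinD lee_fin.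
have h1 := expI_le n C2_ge1 (M2_ge (or_intror erefl)).
have h2 : C2 * I <= M2 := M2_ge (or_intror erefl).
have -> : C2 * f x * I ^+ n.+1 + B * I = (C2 * I ^+ n.+1 + n.+1%:R * M2 ^+ n * (C2 * I)) * f x.
  by rewrite /B; ring.
apply: (ler_wpM2r fx0).
have -> : n.+2%:R * M2 ^+ n.+1 = M2 ^+ n.+1 + n.+1%:R * M2 ^+ n * M2.
  by rewrite -natr1 exprS; ring.
by apply: lerD => //; apply: ler_wpM2l h2; rewrite mulr_ge0// exprn_ge0.
Qed.

Local Notation T := (wright_coef D2 r2).
Local Notation c n j := ('C(n.+1, j.+1)%:R * M2 ^+ (n - j) * T j).

Let D20 : 0 < D2.
Proof. exact: lt_le_trans (cst_D2_ge1 _ _). Qed.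

Let r20 : 0 < r2.
Proof. by rewrite /rho2; move: hgamma; lra. Qed.

Let T0 j : 0 < T j.
Proof. exact: wright_coef_gt0. Qed.

Let c_ge0 n j : 0 <= c n j.
Proof. by apply: mulr_ge0 (ltW (T0 j)); apply: mulr_ge0 => //; exact: exprn_ge0. Qed.

Lemma bulk_coef j (y N : R) : 0 < N ->
  T j * (D2 * (Gamma (r2 * j.+1%:R) * Gamma r2 / Gamma (r2 * j.+1%:R + r2)) *
    (y * N `^ (r2 * j.+1%:R - gamma))) = T j.+1 * N `^ (r2 * j.+1%:R) * (y * N `^ (- gamma)).
Proof.
move=> N0; rewrite (gt0_powRD (r2 * j.+1%:R) (- gamma) N0) [LHS]mulrA wright_coefS//.
set N1 := _ `^ _; set N2 := _ `^ _; set t := wright_coef _ _ _.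
by rewrite mulrA mulrACA.
Qed.

Lemma integral_bulk_sum n (x : 'rV[R]_d.+1) : 2 < enorm x ->
  (\int[leb d.+1]_y (\sum_(j < n.+1) c n j *
      bulk_kernel m gamma (r2 * j.+1%:R - r2 - gamma) (enorm x) (sqn (x - y)) (sqn y))%:E <=
   (\sum_(j < n.+1) 'C(n.+1, j.+1)%:R * M2 ^+ (n - j) *
       (T j.+1 * enorm x `^ (r2 * j.+1%:R)) *
       (expR (- (m * enorm x)) * enorm x `^ (- gamma)))%:E)%E.
Proof.
move=> x2; have N0 : 0 < enorm x by exact: lt_trans x2.
pose K (j : nat) (y : 'rV[R]_d.+1) : \bar R :=
  ((c n j)%:E * (bulk_kernel m gamma (r2 * j.+1%:R - r2 - gamma) (enorm x) (sqn (x - y)) (sqn y))%:E)%E.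
have mB j : measurable_fun setT (fun y : 'rV[R]_d.+1 =>
    (bulk_kernel m gamma (r2 * j.+1%:R - r2 - gamma) (enorm x) (sqn (x - y)) (sqn y))%:E).
  have := measurable_bulk_kernel m gamma (r2 * j.+1%:R - r2 - gamma) (enorm x).
  by set B := bulk_kernel _ _ _ _; move=> mB; mes.
have B0 j p q : 0 <= bulk_kernel m gamma (r2 * j.+1%:R - r2 - gamma) (enorm x) p q by exact: bulk_kernel_ge0.
have K0 j y : (0 <= K j y)%E.
  by rewrite /K -EFinM lee_fin; apply: mulr_ge0; [exact: c_ge0|exact: B0].
have mK j : measurable_fun setT (K j).
  by apply: emeasurable_funM; [exact: measurable_cst|exact: mB].
rewrite (_ : (\int[_]_y _)%E = (\int[leb d.+1]_y \sum_(j < n.+1) K j y)%E); last first.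
  by apply: eq_integral => y _; rewrite -sumEFin; apply: eq_bigr => j _; rewrite EFinM.
rewrite ge0_integral_sum//.
rewrite -sumEFin; apply: lee_sum => j _.
rewrite /K ge0_integralZl_EFin; last 4 first.
- exact: measurableT.
- by move=> y _; rewrite lee_fin; exact: B0.
- exact: mB.
- exact: c_ge0.
have s0 : 0 < r2 * j.+1%:R by exact: mulr_gt0.
have := @bulk_integral_cst_D2 R d m gamma (r2 * j.+1%:R) x m0 gamma0 r20 s0 x2.
rewrite -/r2 => H; apply: le_trans (lee_wpmul2l _ H) _; first by rewrite lee_fin; exact: c_ge0.
rewrite -EFinM lee_fin; apply/eq_ler; rewrite -[LHS]mulrA.
by rewrite (bulk_coef j (expR (- (m * enorm x))) N0) [LHS]mulrA.
Qed.

(** Pascal's rule. *)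
Lemma binomial_sum_succ n (M : R) (a : nat -> R) :
  \sum_(j < n.+2) 'C(n.+2, j.+1)%:R * M ^+ (n.+1 - j) * a j =
  M * (\sum_(j < n.+1) 'C(n.+1, j.+1)%:R * M ^+ (n - j) * a j) + M ^+ n.+1 * a 0%N +
  \sum_(j < n.+1) 'C(n.+1, j.+1)%:R * M ^+ (n - j) * a j.+1.
Proof.
have -> : \sum_(j < n.+2) 'C(n.+2, j.+1)%:R * M ^+ (n.+1 - j) * a j =
   \sum_(j < n.+2) 'C(n.+1, j.+1)%:R * M ^+ (n.+1 - j) * a j +
   \sum_(j < n.+2) 'C(n.+1, j)%:R * M ^+ (n.+1 - j) * a j.
  by rewrite -big_split /=; apply: eq_bigr => j _; rewrite binS natrD; ring.
rewrite big_ord_recr /= bin_small// !mul0r addr0 -addrA; congr (_ + _).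
  rewrite mulr_sumr; apply: eq_bigr => j _; rewrite subSn -1?ltnS//.
  by rewrite exprS; ring.
by rewrite big_ord_recl /= bin0 subn0 mul1r.
Qed.

(** Of the n + 1 steps that lead from 0 to x in f^{(n+1)*}, j + 1 are long and
    share the distance to x, which produces the coefficient and the power of r;
    each of the others costs a factor M2. *)
Definition upper_bound n (r : R) : R :=
  \sum_(j < n.+1) 'C(n.+1, j.+1)%:R * M2 ^+ (n - j) * (T j * r `^ (r2 * j%:R)).

Lemma upper_bound_ge0 n r : 0 <= upper_bound n r.
Proof.
apply: sumr_ge0 => j _; rewrite mulrA; apply: mulr_ge0; last exact: powR_ge0.
exact: c_ge0.
Qed.

Lemma upper_bound_mono n r s : 0 < r -> r <= s -> upper_bound n r <= upper_bound n s.
Proof.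
move=> r0 rs; apply: ler_sum => j _; rewrite ![_ * (T j * _)]mulrA.
apply: ler_wpM2l; first exact: c_ge0.
have s0 : 0 < s by exact: lt_le_trans rs.
apply: ge0_ler_powR rs; rewrite ?nnegrE; [|exact: ltW|exact: ltW].
by apply: mulr_ge0 => //; exact: ltW.
Qed.

Lemma upper_boundS n r : upper_bound n.+1 r = M2 * upper_bound n r + M2 ^+ n.+1 +
  \sum_(j < n.+1) 'C(n.+1, j.+1)%:R * M2 ^+ (n - j) * (T j.+1 * r `^ (r2 * j.+1%:R)).
Proof.
rewrite /upper_bound (binomial_sum_succ n M2 (fun j => T j * r `^ (r2 * j%:R))).
by rewrite mulr0 powRr0 mulr1 (wright_coef0 _ r20) mulr1.
Qed.

(** Induction on n, splitting the convolution of f and f^{n*}. If |y| < 1 or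
    |x - y| > |x| then f(x - y) <= C1 f(x), and if |y| > |x| - 1 then f^{n*}(y) is
    at most C1 f(x) times the bound of rank n: each part costs a factor M2. In
    the remaining region the bulk integrals raise each power of |y| by one step.
    The three contributions add up by Pascal's rule. *)
Lemma convn_le_upper_bound n x : 1 <= enorm x ->
  (convn f n.+1 x <= (f x * upper_bound n (enorm x))%:E)%E.
Proof.
elim: n x => [|n IH] x x1.
  rewrite [leLHS](_ : _ = (f x)%:E)// lee_fin /upper_bound big_ord1 /= subnn binn expr0 !mul1r.
  by rewrite mulr0 powRr0 mulr1 (wright_coef0 _ r20) mulr1.
have x0 : 0 < enorm x by exact: lt_le_trans x1.
have [x2|x2] := leP (enorm x) 2.
  apply: le_trans (convn_near_origin n.+1 x0 x2) _.
  rewrite lee_fin mulrC; apply: ler_wpM2l; first exact: density_ge0.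
  rewrite /upper_bound big_ord_recl /= bin1 subn0 mulr0 powRr0 mulr1 wright_coef0// mulr1.
  rewrite lerDl; apply: sumr_ge0 => j _.
  rewrite mulrA; apply: mulr_ge0; last exact: powR_ge0.
  exact: c_ge0.
have [C1_ge1 C1P] := hC1.
have C10 : 0 <= C1 by exact: le_trans C1_ge1.
set N := enorm x in x1 x0 x2 *.
have fx0 : 0 <= f x by exact: density_ge0.
set K := fun y : 'rV[R]_d.+1 => (\sum_(j < n.+1) c n j *
      bulk_kernel m gamma (r2 * j.+1%:R - r2 - gamma) N (sqn (x - y)) (sqn y))%:E.
have B0 (j : 'I_n.+1) p q : 0 <= c n j * bulk_kernel m gamma (r2 * j.+1%:R - r2 - gamma) N p q.
  by apply: mulr_ge0; [exact: c_ge0|exact: bulk_kernel_ge0].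
have K0 y : (0 <= K y)%E by rewrite lee_fin; apply: sumr_ge0 => j _; exact: B0.
have mK : measurable_fun setT K.
  rewrite /K; apply/measurable_EFinP; apply: measurable_sum => j.
  have := measurable_bulk_kernel m gamma (r2 * j.+1%:R - r2 - gamma) N.
  by set B := bulk_kernel _ _ _ _; move=> mB; mes.
have IK : (\int[leb d.+1]_y K y <= _)%E := integral_bulk_sum n x2.
set P := upper_bound n N.
have P0 : 0 <= P by exact: upper_bound_ge0.
have CP0 : 0 <= C1 * f x * P by rewrite mulr_ge0// mulr_ge0.
have Cx0 : 0 <= C1 * f x by rewrite mulr_ge0.
have fxE : f x = expR (- (m * N)) * N `^ (- gamma) by exact: density_ge1E.
rewrite convnS.
have f0 y : 0 <= f y by exact: density_ge0.
have c0 := density_convn_ge0 n.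
have := @conv_le_split _ _ f (convn f n.+1) K (C1 * f x) (C1 * f x * P) x measurable_density f0
  (measurable_density_convn n) c0 mK K0 Cx0 CP0.
move=> H; apply: le_trans (H _) _ => {H}.
  move=> y; have [hA|hA] := boolP ((enorm y < 1) || (N < enorm (x - y))).
    apply: le_trans (leeDl _ (K0 y)); apply: le_trans (leeDl _ _); last first.
      by rewrite -EFinM lee_fin; exact: mulr_ge0.
    apply: lee_wpmul2r; first exact: c0.
    rewrite lee_fin; have [h|h] := leP N (enorm (x - y)).
      apply: (@le_trans _ _ (f x)); last by rewrite ler_peMl.
      exact: (density_decreasing k m0 gamma0 x0).
    have y1 : enorm y < 1 by case/orP: hA => // hh; have := lt_trans hh h; rewrite ltxx.
    have t := enorm_triangle x y; rewrite -/N in t.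
    by apply: C1P; rewrite -/N; lra.
  move: hA; rewrite negb_or -!leNgt => /andP[y1 xyN].
  have [hB|hB] := ltP (N - 1) (enorm y).
    apply: le_trans (leeDl _ (K0 y)); apply: le_trans (leeDr _ _); last first.
      by apply: mule_ge0; rewrite ?lee_fin.
    rewrite muleC; apply: lee_wpmul2r; first by rewrite lee_fin.
    have [yN|yN] := leP (enorm y) N.
      apply: le_trans (IH y y1) _; rewrite lee_fin.
      have fyx : f y <= C1 * f x by apply: C1P; rewrite -/N; lra.
      have yy : 0 < enorm y by lra.
      exact: (ler_pM (f0 y) (upper_bound_ge0 n _) fyx (upper_bound_mono n yy yN)).
    apply: le_trans (density_convn_le n x0 (ltW yN)) _.
    apply: le_trans (IH x x1) _; rewrite lee_fin -/N -/P.
    by apply: ler_wpM2r => //; rewrite ler_peMl.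
  apply: le_trans (leeDr _ _); last first.
    by apply: adde_ge0; apply: mule_ge0; rewrite ?lee_fin; [|exact: c0| |exact: f0].
  apply: le_trans (lee_wpmul2l _ (IH y y1)) _; first by rewrite lee_fin.
  rewrite -EFinM lee_fin.
  have y0 : 0 < enorm y by lra.
  have xy1 : 1 <= enorm (x - y) by have := enorm_triangle x y; rewrite -/N; lra.
  rewrite mulrA /upper_bound mulr_sumr; apply: ler_sum => j _.
  rewrite [_ * (T j * _)]mulrA [_ * (c n j * _)]mulrCA; apply: ler_wpM2l; first exact: c_ge0.
  rewrite /bulk_kernel !ifT; last first.
    apply/and3P; split; rewrite -enorm_sqr.
    - by rewrite -[leLHS](expr1n _ 2) ler_pXn2r ?nnegrE ?enorm_ge0.
    - by rewrite ler_pXn2r ?nnegrE ?enorm_ge0//; lra.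
    - by rewrite ler_pXn2r ?nnegrE ?enorm_ge0//; lra.
  rewrite -!enormE (density_ge1E m gamma k xy1) (density_ge1E m gamma k y1) -!mulrA.
  have -> : r2 * j.+1%:R - r2 - gamma = - gamma + r2 * j%:R.
    by rewrite -[j.+1%:R]natr1; ring.
  by rewrite (gt0_powRD (- gamma) (r2 * j%:R) y0).
rewrite integral_density_convn integral_density -!EFinM -EFinD.
apply: le_trans (leeD2l _ IK) _; rewrite -EFinD lee_fin.
rewrite -mulr_suml -/N -fxE upper_boundS -/P [leRHS]mulrC !mulrDl; apply: lerD; last exact: lexx.
rewrite [leLHS]addrC; apply: lerD.
  have -> : C1 * f x * P * I = C1 * I * P * f x by ring.
  by apply: ler_wpM2r => //; apply: ler_wpM2r => //; exact: (M2_ge (or_introl erefl)).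
have -> : C1 * f x * I ^+ n.+1 = C1 * I ^+ n.+1 * f x by ring.
by apply: ler_wpM2r => //; apply: expI_le => //; exact: (M2_ge (or_introl erefl)).
Qed.

End UpperBound.

Transparent density convn cst_M2 L1norm wright_coef.

(** * The volume of balls *)

Section BallVolume.
Context {R : realType}.
Local Notation mu := (@lebesgue_measure R).
Local Notation leb n := (@lebesgue_rV R n).

Lemma integral_ppow0 (Z : R) : 0 <= Z ->
  (\int[mu]_t (ppow 0 t * ppow 0 (Z - t))%:E = Z%:E)%E.
Proof.
move=> Z0; transitivity (\int[mu]_(t in `]0%R, Z[) (cst 1%E t))%E.
  rewrite [RHS](@integral_if _ _ _ mu _ (fun t : R => 0 < t < Z)); last first.
    by move=> t; rewrite /= in_itv.
  apply: eq_integral; rint t; rewrite /ppow subr_gt0 !powRr0.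
  by case: (0 < t); case: (t < Z); rewrite /= ?mul1r ?mul0r.
rewrite integral_cst; last exact: measurable_itv.
by rewrite mul1e /= lebesgue_measure_itv/= lte_fin; case: ltgtP Z0 => // [z0 _|<- _]; rewrite -?EFinD ?subr0.
Qed.

Lemma Gamma2 : Gamma (2 : R) = 1.
Proof.
have := @ppow_beta R 1 1 1 ltr01 ltr01; rewrite subrr integral_ppow0//.
have -> : 1 + 1 - 1 = 1 :> R by ring.
rewrite (_ : 1 + 1 = 2 :> R)// Gamma1 ppow_pos// powR1 mulr1 mulr1 => -[].
by rewrite div1r => h; rewrite -[LHS]invrK -h invr1.
Qed.

(** The ratio Gamma(s + 1) / Gamma(s) is additive, by B(a, b) = B(a + 1, b) + B(a, b + 1). *)
Lemma Gamma_ratioD (a b : R) : 0 < a -> 0 < b ->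
  Gamma (a + b + 1) / Gamma (a + b) = Gamma (a + 1) / Gamma a + Gamma (b + 1) / Gamma b.
Proof.
move=> a0 b0; have a1 : 0 < a + 1 by exact: addr_gt0.
have b1 : 0 < b + 1 by exact: addr_gt0.
have ab0 : 0 < a + b by exact: addr_gt0.
have H : (\int[mu]_t (ppow (a - 1) t * ppow (b - 1) (1 - t))%:E =
   \int[mu]_t (ppow (a + 1 - 1) t * ppow (b - 1) (1 - t))%:E +
   \int[mu]_t (ppow (a - 1) t * ppow (b + 1 - 1) (1 - t))%:E)%E.
  rewrite -ge0_integralD; last 5 first.
  - exact: measurableT.
  - by move=> t _; rewrite lee_fin mulr_ge0 ?ppow_ge0.
  - by mes.
  - by move=> t _; rewrite lee_fin mulr_ge0 ?ppow_ge0.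
  - by mes.
  apply: eq_integral; rint t; rewrite -EFinD; congr (_%:E).
  have [t0|t0] := ltP 0 t; last by rewrite !(ppow_npos _ t0) !mul0r addr0.
  have [t1|t1] := ltP 0 (1 - t); last by rewrite !(ppow_npos _ t1) !mulr0 addr0.
  rewrite !ppow_pos//.
  have -> : a + 1 - 1 = (a - 1) + 1 by ring.
  have -> : b + 1 - 1 = (b - 1) + 1 by ring.
  rewrite (gt0_powRD (a - 1) 1 t0) (gt0_powRD (b - 1) 1 t1) !powRr1 ?ltW//; ring.
move: H; rewrite !ppow_beta// !ppow_pos// !powR1 !mulr1 -EFinD => -[].
have -> : a + 1 + b = a + b + 1 by ring.
have -> : a + (b + 1) = a + b + 1 by ring.
have alg (g0 g1 g2 g3 g4 g5 : R) : 0 < g0 -> 0 < g1 -> 0 < g2 -> 0 < g3 ->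
    g2 * g3 / g1 = g4 * g3 / g0 + g2 * g5 / g0 -> g0 / g1 = g4 / g2 + g5 / g3.
  move=> p0 p1 p2 p3 H.
  have e : g4 / g2 + g5 / g3 = (g4 * g3 / g0 + g2 * g5 / g0) * g0 / (g2 * g3).
    by field; rewrite !gt_eqF.
  by rewrite e -H; field; rewrite !gt_eqF.
by apply: alg; apply: Gamma_gt0 => //; exact: addr_gt0.
Qed.

(** The ratio is additive and equals 1 at 1, hence is n / 2 at n / 2. *)
Lemma Gamma_half_succ n : Gamma (n.+1%:R / 2 + 1 : R) = n.+1%:R / 2 * Gamma (n.+1%:R / 2).
Proof.
have g0 i : 0 < i.+1%:R / 2 :> R by exact: divr_gt0.
have half : Gamma (1 / 2 + 1) / Gamma (1 / 2) = 1 / 2 :> R.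
  have h : 0 < 1 / 2 :> R by exact: divr_gt0.
  have := Gamma_ratioD h h; have -> : 1 / 2 + 1 / 2 = 1 :> R by field.
  by rewrite (_ : 1 + 1 = 2)// Gamma1 Gamma2; lra.
have : Gamma (n.+1%:R / 2 + 1) / Gamma (n.+1%:R / 2) = n.+1%:R / 2 :> R.
  elim: n => [//|n IH].
  have -> : n.+2%:R / 2 = n.+1%:R / 2 + 1 / 2 :> R by rewrite -[n.+2%:R]natr1; field.
  by rewrite Gamma_ratioD// IH half.
by move=> h; rewrite -[X in _ = X * _]h divfK// gt_eqF// Gamma_gt0.
Qed.

Definition ball_volume n : R := if n is 0 then 1 else 2 * kap n / n%:R.

Lemma kap_ge0 n : 0 <= kap n.+1 :> R.
Proof. by rewrite /kap divr_ge0 ?powR_ge0// ltW// Gamma_gt0// divr_gt0. Qed.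

Lemma ball_volume_ge0 n : 0 <= ball_volume n.
Proof. by case: n => [|n] //=; rewrite divr_ge0// mulr_ge0// kap_ge0. Qed.

Lemma ball_volume_le n Z : 0 <= Z ->
  ((ball_volume n * Z `^ (n%:R / 2))%:E <= \int[leb n]_w (if (sqn w <= Z)%R then 1 else 0)%:E)%E.
Proof.
move=> Z0; case: n => [|n].
  by rewrite integral_rV0 sqn0 Z0 mul0r powRr0 mulr1.
rewrite (@ge0_integral_radial _ n (fun v => (if v <= Z then 1 else 0)%:E)); last 2 first.
- by mes.
- by move=> v; rewrite lee_fin; case: ifP.
have h0 : 0 < n.+1%:R / 2 :> R by exact: divr_gt0.
have k0 := kap_ge0 n.
transitivity_le ((kap n.+1)%:E * \int[mu]_v (ppow (n.+1%:R / 2 - 1) v * ppow (1 - 1) (Z - v))%:E)%E.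
  rewrite ppow_beta// Gamma_half_succ Gamma1 mulr1 -EFinM lee_fin addrK.
  have [Z1|Z1] := ltP 0 Z; last first.
    rewrite (ppow_npos _ Z1) (_ : Z = 0); last by apply/eqP; rewrite eq_le Z0 Z1.
    by rewrite powR0 ?mulr0// gt_eqF.
  rewrite ppow_pos// mulrA; apply: ler_wpM2r; first exact: powR_ge0.
  apply/eq_ler; rewrite /ball_volume; have := Gamma_gt0 h0; set g := Gamma _ => g1.
  by have := ltr0Sn R n; move: (n.+1%:R : R) (kap _) => t K t0; field; rewrite !gt_eqF.
apply: lee_wpmul2l; first by rewrite lee_fin.
apply: ge0_le_integral.
- exact: measurableT.
- by move=> v _; rewrite lee_fin mulr_ge0 ?ppow_ge0.
- by mes.
- by mes.
rint v; rewrite -EFinM lee_fin; apply: ler_wpM2l; first exact: ppow_ge0.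
rewrite subrr /ppow subr_gt0 powRr0; case: ltgtP => //.
Qed.

End BallVolume.

(** * Lower bound for the convolution powers *)

Section LowerBound.
Context {R : realType} (d : nat) (m gamma : R) (k : profile).
Hypotheses (m0 : 0 < m) (gamma0 : 0 <= gamma) (hgamma : gamma < (d.+1%:R + 1) / 2).
Local Notation mu := (@lebesgue_measure R).
Local Notation leb n := (@lebesgue_rV R n).
Local Notation radial := (radial gamma k).
Local Notation r1 := (rho1 d.+1 gamma k).
Local Notation r2 := (rho2 d.+1 gamma).
Local Notation prof := (profile_sqr m gamma k).

Lemma rho1_gt0 : 0 < r1.
Proof.
rewrite /rho1; case: k => //; move: hgamma.
by rewrite -natr1; have : 0 <= d%:R :> R by []; lra.
Qed.

Lemma rho2_gt0 : 0 < r2.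
Proof. by rewrite /rho2; move: hgamma; lra. Qed.

Lemma rho2_le_rho1 : r2 <= r1.
Proof.
have d0 : 0 <= d%:R :> R by [].
by rewrite /rho1 /rho2 -[d.+1%:R]natr1; move: gamma0; case: k; lra.
Qed.

(** The gain of one convolution: |x|^rho2 at infinity, |x|^rho1 near 0. For
    |x| >= 1 the minimum is the first of these, but the induction evaluates the
    previous power at points arbitrarily close to 0. *)
Definition growth (r : R) : R := Num.min (r `^ r1) (r `^ r2).

Lemma growth_ge0 r : 0 <= growth r.
Proof. by rewrite le_min !powR_ge0. Qed.

Lemma growth_mono r s : 0 < r -> r <= s -> growth r <= growth s.
Proof.
move=> r0 rs; have s0 : 0 < s by exact: lt_le_trans rs.
have H (a : R) : 0 < a -> r `^ a <= s `^ a.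
  by move=> a0; apply: (ge0_ler_powR (ltW a0)) rs; rewrite nnegrE ltW.
by rewrite le_min !ge_min (H _ rho1_gt0) (H _ rho2_gt0) orbT.
Qed.

Lemma growth_scale u N : 0 < u -> u <= 1 -> 0 < N -> u `^ r1 * growth N <= growth (u * N).
Proof.
move=> u0 u1 N0; rewrite le_min !powRM ?(ltW u0) ?(ltW N0)//.
have p0 : 0 <= u `^ r1 by exact: powR_ge0.
apply/andP; split; first by apply: ler_wpM2l => //; rewrite ge_min lexx.
apply: (@le_trans _ _ (u `^ r1 * N `^ r2)).
  by apply: ler_wpM2l => //; rewrite ge_min lexx orbT.
apply: ler_wpM2r; first exact: powR_ge0.
by apply: ger_powR rho2_le_rho1; rewrite u0 u1.
Qed.

Lemma growth_le N : 0 < N -> growth N <= radial N * (N * Num.min N (N ^+ 2) `^ (d%:R / 2)).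
Proof.
move=> N0; rewrite /growth; have [N1|N1] := leP 1 N.
  have -> : Num.min N (N ^+ 2) = N by apply/min_idPl; rewrite expr2 ler_peMr// ltW.
  rewrite radial_ge1// ge_min; apply/orP; right; apply/eq_ler.
  rewrite -[X in X * _ `^ _](powRr1 (ltW N0)) -!gt0_powRD//; congr (_ `^ _).
  by rewrite /rho2 -[d.+1%:R]natr1; field.
have -> : Num.min N (N ^+ 2) = N ^+ 2 by apply/min_idPr; rewrite expr2 ler_piMr// ltW.
have H : N * (N ^+ 2) `^ (d%:R / 2) = N `^ d.+1%:R.
  rewrite -[N ^+ 2]powR_mulrn ?(ltW N0)// -powRrM -[X in X * _](powRr1 (ltW N0)) -gt0_powRD//.
  by congr (_ `^ _); rewrite -[d.+1%:R]natr1; field.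
rewrite H ge_min; apply/orP; left; apply/eq_ler; rewrite /Defs.radial /rho1; case: k.
  by rewrite -gt0_powRD//; congr (_ `^ _); ring.
by rewrite (max_idPl (ltW N1)) powR1 mul1r.
Qed.

(** The lower bound only uses the points y of a thin tube around the segment from 0
    to x; s is the coordinate along the segment and Z the squared distance to it.
    The bound on Z makes the path through y longer than the segment by at most
    c / 8, while the section of the tube is a ball of radius proportional to
    u v, which is what produces the Beta integral. *)
Section Tube.
Variables (c N s Z : R).
Hypotheses (c0 : 0 <= c) (c5 : c <= 5) (s0 : 0 < s) (sN : s < N) (Z0 : 0 <= Z).
Let u := s / N.
Let v := (N - s) / N.
Hypothesis ZP : Z <= c * Num.min N (N ^+ 2) * (u * v) ^+ 2.

Let N0 : 0 < N. Proof. exact: lt_trans sN. Qed.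
Let Ns : 0 < N - s. Proof. by rewrite subr_gt0. Qed.
Let u0 : 0 < u. Proof. exact: divr_gt0. Qed.
Let v0 : 0 < v. Proof. exact: divr_gt0. Qed.
Let uv : u + v = 1. Proof. by rewrite /u /v; field; rewrite gt_eqF. Qed.
Let sE : s = N * u. Proof. by rewrite /u; field; rewrite gt_eqF. Qed.
Let NsE : N - s = N * v. Proof. by rewrite /v; field; rewrite gt_eqF. Qed.
Let uv4 : u * v <= 1 / 4. Proof. by have := sqr_ge0 (u - v); have := uv; nra. Qed.
Let uv0 : 0 < u * v. Proof. exact: mulr_gt0. Qed.

Let Z1 : Z <= c * N * (u * v) ^+ 2.
Proof.
apply: le_trans ZP _; apply: ler_wpM2r; first exact: sqr_ge0.
by apply: ler_wpM2l => //; rewrite ge_min lexx.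
Qed.

Let Z2 : Z <= c * N ^+ 2 * (u * v) ^+ 2.
Proof.
apply: le_trans ZP _; apply: ler_wpM2r; first exact: sqr_ge0.
by apply: ler_wpM2l => //; rewrite ge_min lexx orbT.
Qed.

Let sqrt_le (a : R) : 0 < a -> Num.sqrt (a ^+ 2 + Z) <= a + Z / (2 * a).
Proof.
move=> a0; have h : 0 <= a + Z / (2 * a) by rewrite addr_ge0 ?divr_ge0 ?mulr_ge0// ltW.
rewrite -[leRHS](ger0_norm h) -sqrtr_sqr ler_wsqrtr//.
have -> : (a + Z / (2 * a)) ^+ 2 = a ^+ 2 + Z + (Z / (2 * a)) ^+ 2.
  by field; rewrite gt_eqF.
by rewrite lerDl sqr_ge0.
Qed.

Lemma tube_path_le : Num.sqrt ((N - s) ^+ 2 + Z) + Num.sqrt (s ^+ 2 + Z) <= N + c / 8.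
Proof.
apply: le_trans (lerD (sqrt_le Ns) (sqrt_le s0)) _.
have -> : N - s + Z / (2 * (N - s)) + (s + Z / (2 * s)) = N + Z / (2 * N * (u * v)).
  by rewrite /u /v; field; rewrite !gt_eqF.
rewrite lerD2l ler_pdivrMr; last by rewrite mulr_gt0// mulr_gt0.
apply: (le_trans Z1).
have -> : c / 8 * (2 * N * (u * v)) = c * N * (u * v) * (1 / 4) by field.
rewrite expr2 mulrA; apply: ler_wpM2l => //.
by apply: mulr_ge0 (ltW uv0); apply: mulr_ge0 c0 (ltW N0).
Qed.

Lemma tube_product_le : ((N - s) ^+ 2 + Z) * (s ^+ 2 + Z) <= (1 + c) * (N ^+ 2 * (u * v)) ^+ 2.
Proof.
have -> : ((N - s) ^+ 2 + Z) * (s ^+ 2 + Z) =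
    (N ^+ 2 * (u * v)) ^+ 2 + Z * (N ^+ 2 * (1 - 2 * (u * v)) + Z).
  have gen (a b : R) : a + b = 1 -> ((N * b) ^+ 2 + Z) * ((N * a) ^+ 2 + Z) =
      (N ^+ 2 * (a * b)) ^+ 2 + Z * (N ^+ 2 * (1 - 2 * (a * b)) + Z).
    by move=> ab; have -> : b = 1 - a by [rewrite -ab addrAC subrr add0r]; ring.
  by rewrite -(gen u v uv) -NsE -sE.
have h : Z <= N ^+ 2 * (2 * (u * v)).
  apply: (le_trans Z2).
  have -> : c * N ^+ 2 * (u * v) ^+ 2 = N ^+ 2 * ((c * (u * v)) * (u * v)) by ring.
  apply: ler_wpM2l; first exact: sqr_ge0.
  by apply: ler_wpM2r; [exact: ltW|move: c0 c5 uv4 uv0; set t := u * v; nra].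
have -> : (1 + c) * (N ^+ 2 * (u * v)) ^+ 2 = (N ^+ 2 * (u * v)) ^+ 2 + c * N ^+ 2 * (u * v) ^+ 2 * N ^+ 2.
  by ring.
rewrite lerD2l; apply: ler_pM => //.
  by apply: addr_ge0 => //; apply: mulr_ge0; [exact: sqr_ge0|move: uv4; set t := u * v; lra].
by move: h; set t := u * v; set n := N ^+ 2; move=> h; lra.
Qed.

Lemma tube_radius_le (a b : R) : 0 < a -> 0 < b -> a + b = 1 -> a * b = u * v -> (N * a) ^+ 2 + Z <= N ^+ 2.
Proof.
move=> a0 b0 ab abE.
apply: (@le_trans _ _ ((N * a) ^+ 2 + 5 * N ^+ 2 * (u * v) ^+ 2)).
  rewrite lerD2l; apply: (le_trans Z2); apply: ler_wpM2r; first exact: sqr_ge0.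
  by apply: ler_wpM2r => //; exact: sqr_ge0.
have -> : (N * a) ^+ 2 + 5 * N ^+ 2 * (u * v) ^+ 2 = N ^+ 2 * (a ^+ 2 + 5 * (u * v) ^+ 2) by ring.
rewrite -[leRHS]mulr1; apply: ler_wpM2l; first exact: sqr_ge0.
rewrite -abE; have b1 : b = 1 - a by lra.
have h : a * b <= 1 / 4 by rewrite abE.
have : 0 < a * b by exact: mulr_gt0.
rewrite b1 in h b0 *; nra.
Qed.

(** For the pure power this is the bound on the product of the two distances; for
    the cut power both distances are at most N. *)
Lemma tube_radial_ge :
  (1 + c) `^ (- (gamma / 2)) * radial N ^+ 2 * (u * v) `^ (r1 - d.+1%:R) <=
  radial (Num.sqrt ((N - s) ^+ 2 + Z)) * radial (Num.sqrt (s ^+ 2 + Z)).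
Proof.
have p0 : 0 < (N - s) ^+ 2 + Z by rewrite ltr_pwDl// exprn_gt0.
have q0 : 0 < s ^+ 2 + Z by rewrite ltr_pwDl// exprn_gt0.
have c1 : 0 < 1 + c by rewrite ltr_pwDl.
have radial_mono a : 0 < a -> a <= N ^+ 2 -> radial N <= radial (Num.sqrt a).
  move=> a0 aN; apply: radial_decreasing_profile; rewrite ?sqrtr_gt0//.
  by rewrite -[leRHS](ger0_norm (ltW N0)) -sqrtr_sqr ler_wsqrtr.
have tp := tube_radius_le v0 u0 (etrans (addrC _ _) uv) (mulrC _ _).
have tq := tube_radius_le u0 v0 uv erefl.
have tpq := tube_product_le.
rewrite -NsE -?sE in tp tq.
move: radial_mono; rewrite /Defs.radial /rho1; case: k => radial_mono.
  have -> : d.+1%:R - gamma - d.+1%:R = - gamma by ring.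
  rewrite -powRM ?sqrtr_ge0// -sqrtrM ?(ltW p0)//.
  have P0 : 0 <= N ^+ 2 * (u * v) by apply: mulr_ge0; [exact: sqr_ge0|exact: ltW].
  apply: (@le_trans _ _ ((Num.sqrt (1 + c) * (N ^+ 2 * (u * v))) `^ (- gamma))).
    rewrite (powRM _ (sqrtr_ge0 _) P0) (powRM _ (sqr_ge0 N) (ltW uv0)) -(powR12_sqrt (ltW c1)).
    rewrite -[N ^+ 2]powR_mulrn ?(ltW N0)// -[N `^ (- gamma) ^+ 2]powR_mulrn ?powR_ge0// -!powRrM.
    rewrite -mulrA; apply/eq_ler; congr (_ `^ _ * (_ `^ _ * _)); [by field|ring].
  apply: powRN_decreasing => //; first by rewrite sqrtr_gt0 mulr_gt0.
  rewrite -[X in _ <= _ * X](ger0_norm P0) -sqrtr_sqr -sqrtrM ?(ltW c1)//.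
  exact: ler_wsqrtr.
rewrite subrr powRr0 mulr1.
apply: (@le_trans _ _ (Num.max 1 N `^ (- gamma) ^+ 2)).
  rewrite ler_piMl ?sqr_ge0// powRN invf_le1 ?powR_gt0//.
  by rewrite -[leLHS](powRr0 (1 + c)); apply: ler_powR; rewrite ?lerDl ?divr_ge0.
rewrite expr2; apply: ler_pM; rewrite ?powR_ge0//.
- exact: radial_mono.
- exact: radial_mono.
Qed.

Lemma tube_bound n :
  expR (- (m * N)) * expR (- (m * (c / 8))) *
    ((1 + c) `^ (- (gamma / 2)) * radial N ^+ 2 * (u * v) `^ (r1 - d.+1%:R)) *
    (u `^ r1 * growth N) ^+ n <=
  prof ((N - s) ^+ 2 + Z) * (prof (s ^+ 2 + Z) * growth (Num.sqrt (s ^+ 2 + Z)) ^+ n).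
Proof.
rewrite /profile_sqr; set P := Num.sqrt _; set Q := Num.sqrt _.
have h1 : expR (- (m * N)) * expR (- (m * (c / 8))) <= expR (- (m * P)) * expR (- (m * Q)).
  by rewrite -!expRD ler_expR; have := tube_path_le; rewrite -/P -/Q; move: m0; nra.
have h2 := tube_radial_ge; rewrite -/P -/Q in h2.
have u1 : u <= 1 by have := uv; have := v0; lra.
have h3 : (u `^ r1 * growth N) ^+ n <= growth Q ^+ n.
  have g0 : 0 <= u `^ r1 * growth N by rewrite mulr_ge0 ?powR_ge0 ?growth_ge0.
  case: n => [|n]; first by rewrite !expr0.
  rewrite ler_pXn2r ?nnegrE ?growth_ge0//; apply: le_trans (growth_scale u0 u1 N0) _.
  apply: growth_mono; first exact: mulr_gt0.
  by rewrite mulrC -sE -[leLHS](ger0_norm (ltW s0)) -sqrtr_sqr ler_wsqrtr// lerDl.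
have e0 (a : R) : 0 <= expR a by exact: expR_ge0.
have q1 : 0 <= radial N ^+ 2 by rewrite sqr_ge0.
have L1 := mulr_ge0 (e0 (- (m * N))) (e0 (- (m * (c / 8)))).
have L2 := mulr_ge0 (mulr_ge0 (powR_ge0 (1 + c) (- (gamma / 2))) q1) (powR_ge0 (u * v) (r1 - d.+1%:R)).
have h12 := ler_pM L1 L2 h1 h2.
have g1 : 0 <= (u `^ r1 * growth N) ^+ n by rewrite exprn_ge0// mulr_ge0 ?powR_ge0 ?growth_ge0.
have h := ler_pM (mulr_ge0 L1 L2) g1 h12 h3.
apply: le_trans h _; apply/eq_ler.
by rewrite -!mulrA; congr (_ * _); rewrite mulrCA.
Qed.

End Tube.

Definition tube_cst (c : R) : R :=
  expR (- (m * (c / 8))) * (1 + c) `^ (- (gamma / 2)) * (c `^ (d%:R / 2) * ball_volume d).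

Lemma tube_cst_ge0 c : 0 <= tube_cst c.
Proof. by rewrite /tube_cst !mulr_ge0 ?expR_ge0 ?powR_ge0 ?ball_volume_ge0. Qed.

(** The tube_bound is integrated over the section of the tube, a ball of squared
    radius c min(N, N^2) (u v)^2, and then over s, which is a Beta integral; by
    growth_le the powers of N that remain are at least growth N. *)
Lemma tube_integral_ge (c a N : R) n (H : R -> \bar R) :
  0 <= c -> c <= 5 -> 0 <= a -> 0 < N -> measurable_fun setT H -> (forall q, 0 <= H q)%E ->
  (forall q, 0 < q -> ((a * (prof q * growth (Num.sqrt q) ^+ n))%:E <= H q)%E) ->
  ((a * (tube_cst c * (Gamma (r1 * n.+1%:R) * Gamma r1 / Gamma (r1 * n.+1%:R + r1))) *
     (expR (- (m * N)) * radial N * growth N ^+ n.+1))%:E <=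
   \int[mu]_s \int[leb d]_w ((prof ((N - s) ^+ 2 + sqn w))%:E * H (s ^+ 2 + sqn w)%R))%E.
Proof.
move=> c0 c5 a0 N0 mH H0 HP.
have mF := measurable_profile_sqr m gamma k.
have F0 := profile_sqr_ge0 m gamma k.
have s1 : 0 < r1 by exact: rho1_gt0.
have s2 : 0 < r1 * n.+1%:R by exact: mulr_gt0.
pose A := a * tube_cst c * (expR (- (m * N)) * radial N ^+ 2 * growth N ^+ n *
   Num.min N (N ^+ 2) `^ (d%:R / 2) * N `^ (- (r1 * n.+1%:R + r1 - 2))).
have nn0 : 0 <= growth N ^+ n by rewrite exprn_ge0// growth_ge0.
have A0 : 0 <= A.
  apply: mulr_ge0; first exact: mulr_ge0 a0 (tube_cst_ge0 c).
  by repeat first [exact: powR_ge0 | exact: expR_ge0 | exact: sqr_ge0 | exact: nn0 | apply: mulr_ge0].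
transitivity_le (\int[mu]_s (A * (ppow (r1 * n.+1%:R - 1) s * ppow (r1 - 1) (N - s)))%:E)%E; last first.
  apply: ge0_le_integral.
  - exact: measurableT.
  - by move=> s _; rewrite lee_fin; apply: mulr_ge0 A0 _; rewrite mulr_ge0 ?ppow_ge0.
  - by mes.
  - apply: measurable_integral2; first by mes.
    by move=> s w; apply: mule_ge0; [rewrite lee_fin; exact: F0|exact: H0].
  rint s.
  have FH0 w : (0 <= (prof ((N - s) ^+ 2 + sqn (w : 'rV[R]_d)))%:E * H (s ^+ 2 + sqn w)%R)%E.
    by apply: mule_ge0; [rewrite lee_fin; exact: F0|exact: H0].
  have [s0|s0] := leP s 0.
    by rewrite (ppow_npos _ s0) mul0r mulr0; apply: integral_ge0 => w _; exact: FH0.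
  have [sN|sN] := leP (N - s) 0.
    by rewrite (ppow_npos _ sN) !mulr0; apply: integral_ge0 => w _; exact: FH0.
  have sN' : s < N by rewrite -subr_gt0.
  set Zs := c * Num.min N (N ^+ 2) * (s / N * ((N - s) / N)) ^+ 2.
  have min0 : 0 <= Num.min N (N ^+ 2) by rewrite le_min ltW// sqr_ge0.
  have Zs0 : 0 <= Zs by rewrite /Zs; apply: mulr_ge0 (sqr_ge0 _); exact: mulr_ge0.
  set u := s / N in Zs Zs0 *; set v := (N - s) / N in Zs Zs0 *.
  have u0 : 0 < u by exact: divr_gt0.
  have v0 : 0 < v by exact: divr_gt0.
  set KK := expR (- (m * N)) * expR (- (m * (c / 8))) *
    ((1 + c) `^ (- (gamma / 2)) * radial N ^+ 2 * (u * v) `^ (r1 - d.+1%:R)) *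
    (u `^ r1 * growth N) ^+ n.
  have KK0 : 0 <= KK.
    rewrite /KK; apply: mulr_ge0; last by rewrite exprn_ge0// mulr_ge0 ?powR_ge0 ?growth_ge0.
    by repeat first [exact: powR_ge0 | exact: expR_ge0 | exact: sqr_ge0 | apply: mulr_ge0].
  have aK0 : 0 <= a * KK by exact: mulr_ge0.
  transitivity_le ((a * KK)%:E * \int[leb d]_w (if (sqn w <= Zs)%R then 1 else 0)%:E)%E.
    apply: le_trans (lee_wpmul2l _ (ball_volume_le d Zs0)); last by rewrite lee_fin.
    rewrite -EFinM lee_fin; apply/eq_ler.
    have uv0 : 0 < u * v by exact: mulr_gt0.
    have e1 : Zs `^ (d%:R / 2) = c `^ (d%:R / 2) * Num.min N (N ^+ 2) `^ (d%:R / 2) * (u * v) `^ d%:R.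
      rewrite /Zs powRM ?sqr_ge0//; last exact: mulr_ge0.
      rewrite powRM// -[(u * v) ^+ 2]powR_mulrn ?(ltW uv0)// -powRrM; congr (_ * _ `^ _).
      by field.
    have e2 : (u * v) `^ (r1 - d.+1%:R) * (u * v) `^ d%:R = u `^ (r1 - 1) * v `^ (r1 - 1).
      rewrite -(gt0_powRD _ _ uv0) -powRM ?ltW//; congr (_ `^ _).
      by rewrite -[d.+1%:R]natr1; ring.
    have e3 : (u `^ r1 * growth N) ^+ n = u `^ (r1 * n%:R) * growth N ^+ n.
      by rewrite exprMn powRrM powR_mulrn// powR_ge0.
    have divN (x e : R) : 0 < x -> (x / N) `^ e = x `^ e * N `^ (- e).
      move=> x0; rewrite powRM ?invr_ge0 ?ltW//; congr (_ * _).
      by rewrite -(powR_inv1 (ltW N0)) -powRrM mulN1r.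
    have e4 : u `^ (r1 - 1) * u `^ (r1 * n%:R) = s `^ (r1 * n.+1%:R - 1) * N `^ (- (r1 * n.+1%:R - 1)).
      rewrite -(gt0_powRD (r1 - 1) (r1 * n%:R) u0) -(divN _ _ s0) -/u; congr (_ `^ _).
      by rewrite -[n.+1%:R]natr1; ring.
    have e5 : v `^ (r1 - 1) = (N - s) `^ (r1 - 1) * N `^ (- (r1 - 1)) by exact: divN.
    have e6 : N `^ (- (r1 * n.+1%:R + r1 - 2)) = N `^ (- (r1 * n.+1%:R - 1)) * N `^ (- (r1 - 1)).
      by rewrite -(gt0_powRD (- (r1 * n.+1%:R - 1)) (- (r1 - 1)) N0); congr (_ `^ _); ring.
    rewrite (ppow_pos _ s0) (ppow_pos _ sN) /A /KK /tube_cst e1 e3 e6.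
    move: e2 e4 e5; set w1 := (u * v) `^ _; set w2 := (u * v) `^ _; set w3 := u `^ _; set w4 := v `^ _.
    set w5 := u `^ _; set w6 := s `^ _; set w7 := N `^ _; set w8 := (N - s) `^ _; set w9 := N `^ _.
    set w10 := expR _; set w11 := expR _; set w12 := _ `^ _; set w13 := c `^ _; set w14 := _ `^ _.
    set w15 := growth N ^+ n; set w16 := radial N ^+ 2; set w17 := ball_volume d.
    move=> e2 e4 e5.
    transitivity (a * w10 * w11 * w12 * w13 * w14 * w15 * w16 * w17 * ((w6 * w7) * (w8 * w9))).
      by ring.
    rewrite -e4 -e5.
    transitivity (a * w10 * w11 * w12 * w13 * w14 * w15 * w16 * w17 * ((w3 * w4) * w5)).
      by ring.
    by rewrite -e2; ring.
  rewrite -ge0_integralZl_EFin; last 4 first.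
  - exact: measurableT.
  - by move=> w _; rewrite lee_fin; case: ifP.
  - by mes.
  - exact: aK0.
  apply: ge0_le_integral.
  - exact: measurableT.
  - by move=> w _; rewrite -EFinM lee_fin; apply: mulr_ge0 aK0 _; case: ifP.
  - by mes.
  - by mes.
  move=> w _; have [hw|hw] := leP (sqn w) Zs; last by rewrite mule0; exact: FH0.
  rewrite mule1.
  have q0 : 0 < s ^+ 2 + sqn w by rewrite ltr_pwDl ?sqn_ge0// exprn_gt0.
  have tb := tube_bound c0 c5 s0 sN' (sqn_ge0 w) hw n.
  apply: le_trans (lee_wpmul2l _ (HP _ q0)); last by rewrite lee_fin; exact: F0.
  rewrite -EFinM lee_fin [leRHS]mulrCA; exact: (ler_wpM2l a0 tb).
transitivity_le (A%:E * (Gamma (r1 * n.+1%:R) * Gamma r1 / Gamma (r1 * n.+1%:R + r1) *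
   ppow (r1 * n.+1%:R + r1 - 1) N)%:E)%E; last first.
  rewrite EFinM -ppow_beta// -ge0_integralZl_EFin; last 4 first.
  - exact: measurableT.
  - by move=> w _; rewrite lee_fin mulr_ge0 ?ppow_ge0.
  - by mes.
  - exact: A0.
  by apply/eq_lee; apply: eq_integral; rint s; rewrite EFinM.
rewrite -EFinM lee_fin ppow_pos//.
have e6 : N `^ (- (r1 * n.+1%:R + r1 - 2)) * N `^ (r1 * n.+1%:R + r1 - 1) = N.
  rewrite -(gt0_powRD (- (r1 * n.+1%:R + r1 - 2)) (r1 * n.+1%:R + r1 - 1) N0).
  have -> : - (r1 * n.+1%:R + r1 - 2) + (r1 * n.+1%:R + r1 - 1) = 1 by ring.
  by rewrite powRr1 ?ltW.
have B0 : 0 <= Gamma (r1 * n.+1%:R) * Gamma r1 / Gamma (r1 * n.+1%:R + r1).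
  by rewrite divr_ge0 ?mulr_ge0// ltW// Gamma_gt0// addr_gt0.
move: e6 B0; rewrite /A; set B := Gamma _ * _ / _; set w1 := N `^ _; set w2 := N `^ _.
have := growth_le N0; set w3 := _ `^ _; set t := tube_cst c; set e := expR _.
have t0 : 0 <= t by exact: tube_cst_ge0.
have e0 : 0 <= e by exact: expR_ge0.
have := radial_ge0 gamma k N; set g := radial N => g0 gl e6 B0.
have -> : a * t * (e * g ^+ 2 * growth N ^+ n * w3 * w1) * (B * w2) =
    a * t * B * e * g * growth N ^+ n * (g * ((w1 * w2) * w3)) by ring.
have -> : a * (t * B) * (e * g * growth N ^+ n.+1) = a * t * B * e * g * growth N ^+ n * growth N.
  by rewrite exprSr; ring.
rewrite e6; apply: ler_wpM2l gl.
by rewrite !(mulr_ge0 _ nn0, mulr_ge0 _ g0, mulr_ge0 _ e0, mulr_ge0 _ B0, mulr_ge0 a0 t0).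
Qed.

(** f^{n*} is radial, so in axial coordinates the induction hypothesis can be used
    at a vector of any prescribed norm. *)
Lemma convn_ge_lower (D c : R) n (x : 'rV[R]_d.+1) : 0 < D -> 0 <= c -> c <= 5 -> D <= tube_cst c ->
  0 < enorm x ->
  ((wright_coef D r1 n * (density m gamma k x * growth (enorm x) ^+ n))%:E <=
    convn (density m gamma k) n.+1 x)%E.
Proof.
move=> D0 c0 c5 Dc; have s1 := rho1_gt0.
elim: n x => [|n IH] x x0.
  by rewrite wright_coef0// expr0 mulr1 mul1r lexx.
set N := enorm x in x0 *.
have mF := measurable_profile_sqr m gamma k.
have F0 := profile_sqr_ge0 m gamma k.
have [H [mH H0 _ HE]] := radial_decreasing_convn d mF F0 (profile_sqr_decreasing k m0 gamma0) n.
rewrite convnS /Defs.conv.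
have -> : (\int[leb d.+1]_y ((density m gamma k (x - y))%:E * convn (density m gamma k) n.+1 y) =
  \int[leb d.+1]_y ((prof (sqn (x - y)))%:E * H (sqn y)))%E.
  by apply: eq_integral => y _; congr (_ * _)%E; exact: HE.
rewrite (@ge0_integral_axis _ _ x (fun p q => (prof p)%:E * H q)%E); last 2 first.
- by mes.
- by move=> p q; apply: mule_ge0; [rewrite lee_fin; exact: F0|exact: H0].
rewrite -/N.
have a0 : 0 <= wright_coef D r1 n by apply: ltW; exact: wright_coef_gt0.
have HP q : 0 < q -> ((wright_coef D r1 n * (prof q * growth (Num.sqrt q) ^+ n))%:E <= H q)%E.
  move=> q0; pose y := (Num.sqrt q / N) *: x.
  have sq0 : 0 < Num.sqrt q by rewrite sqrtr_gt0.
  have yE : enorm y = Num.sqrt q by rewrite /y enormZ ?divr_ge0 ?ltW// -/N divfK// gt_eqF.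
  have yq : sqn y = q by rewrite -enorm_sqr yE sqr_sqrtr// ltW.
  have := IH y; rewrite yE => /(_ sq0); rewrite HE yq densityE yq.
  by [].
apply: le_trans (tube_integral_ge c0 c5 a0 x0 mH H0 HP).
rewrite lee_fin -wright_coefS// -[leLHS]mulrA -[leRHS]mulrA; apply: (ler_wpM2l a0).
rewrite -[leLHS]mulrA -[leRHS]mulrA; apply: ler_pM.
- exact: ltW.
- apply: mulr_ge0; first by rewrite divr_ge0 ?mulr_ge0// ltW// Gamma_gt0// ?addr_gt0// ?mulr_gt0.
  by rewrite mulr_ge0 ?density_ge0// exprn_ge0// growth_ge0.
- exact: Dc.
- by [].
Qed.

Lemma cst_r0_ge1 : 1 <= cst_r0 d.+1 gamma k.
Proof.
rewrite /cst_r0.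
have b0 : 0 < cst_b d.+1 gamma k by have := rho1_gt0; rewrite /rho1 /cst_b.
have a0 : 0 < cst_a0 d.+1 gamma k by have := rho1_gt0; rewrite /rho1 /cst_a0; case: k.
have ab : cst_a0 d.+1 gamma k <= 1 \/ cst_a0 d.+1 gamma k = cst_b d.+1 gamma k.
  by rewrite /cst_a0 /cst_b; case: k; [right|left; rewrite lexx].
move: b0 a0 ab; set a := cst_a0 _ _ _; set b := cst_b _ _ _ => b0 a0 ab.
have [n fE] : exists n : nat, Num.floor b = n by exists `|Num.floor b|%N; rewrite gez0_abs// floor_ge0 ltW.
have [c cE] : exists c : nat, Num.ceil b = c.
  by exists `|Num.ceil b|%N; rewrite gez0_abs// -(ler_int R) (le_trans (ltW b0))// ceil_ge.
have cb : b <= c%:R by have := ceil_ge b; rewrite cE.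
have c1 : 1 <= c%:R :> R.
  by rewrite ler1n lt0n; apply/eqP => c0; move: cb; rewrite c0; lra.
have nb : n%:R <= b by have := ge_floor b; rewrite fE.
have bn : b < n%:R + 1 by have := floorD1_gt b; rewrite fE intrD.
rewrite fE cE /= -!pmulrn.
have aV : 1 <= 2 `^ a^-1 :> R.
  by rewrite -[leLHS](powRr0 2) ler_powR ?ler1n// invr_ge0 ltW.
rewrite -[leLHS]mul1r; apply: ler_pM => //; last first.
  rewrite -exprnP exprn_ege1//; rewrite -[leLHS]mul1r; apply: ler_pM => //.
  by rewrite -expR0 ler_expR invr_ge0 expR_ge0.
rewrite -exprnP.
have cn1 : 1 <= c%:R ^+ n :> R by exact: exprn_ege1.
have p0 : 0 < a `^ (1 - (b - n%:R)) by exact: powR_gt0.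
have q1 : a `^ (1 - (b - n%:R)) <= 8 * c%:R ^+ n.
  have [a1|a1] := leP a 1.
    apply: (@le_trans _ _ 1); last by lra.
    by rewrite -[leRHS](powRr0 a) ger_powR ?a0 ?a1//; lra.
  have abE : a = b by case: ab => // a1'; lra.
  apply: (@le_trans _ _ (a `^ 1)); first by apply: ler_powR; [exact: ltW|lra].
  rewrite (powRr1 (ltW a0)) abE; apply: (le_trans cb).
  have n1 : (0 < n)%N.
    by rewrite lt0n; apply/eqP => n0; move: bn a1; rewrite n0 -abE; lra.
  have : c%:R ^+ 1 <= c%:R ^+ n :> R by rewrite ler_weXn2l.
  by rewrite expr1; lra.
apply: (@le_trans _ _ (1 `^ a^-1)); first by rewrite powR1 lexx.
apply: ge0_ler_powR; rewrite ?nnegrE ?invr_ge0.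
- exact: ltW.
- exact: ler01.
- by apply: divr_ge0 (ltW p0); lra.
- by rewrite ler_pdivlMr// mul1r.
Qed.

Variable C3 : R.
Hypothesis hC3 : (2 <= d.+1)%N -> 1 <= C3 /\ forall r : R, 0 < r -> radial r <= C3 * radial (2 * r).
Local Notation D1 := (cst_D1 d.+1 m gamma k C3).

Lemma doubling_cst_ge : (2 <= d.+1)%N -> 2 `^ gamma <= C3.
Proof.
move=> /hC3[_ /(_ 1 ltr01)]; rewrite mulr1 !radial_ge1 ?ler1n// powR1 powRN.
by rewrite ler_pdivlMr ?powR_gt0// mul1r.
Qed.

Lemma cst_D1_gt0 : 0 < D1.
Proof.
rewrite /cst_D1 /cst_C eqSS; have [d1|d1] := eqVneq d 0%N; first by rewrite divr_gt0.
have d2 : (2 <= d.+1)%N by rewrite ltnS lt0n.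
have [C31 _] := hC3 d2; have C30 : 0 < C3 by exact: lt_le_trans C31.
have dR : 0 < d%:R :> R by rewrite ltr0n.
have dE : d.+1%:R - 1 = d%:R :> R by rewrite -natr1 addrK.
rewrite dE divr_gt0// mulr_gt0//; first by rewrite divr_gt0 ?expR_gt0.
rewrite /cst_M4 lt_min ltr01 divr_gt0 ?exprn_gt0//.
rewrite mulr_gt0//; last by rewrite dE Gamma_gt0// divr_gt0.
by rewrite mulr_gt0// powR_gt0// pi_gt0.
Qed.

Lemma cst_D1_le1 : D1 <= 1.
Proof.
rewrite /cst_D1 /cst_C eqSS; have [d1|d1] := eqVneq d 0%N; first by lra.
have d2 : (1 <= d)%N by rewrite lt0n.
have dE : d.+1%:R - 1 = d%:R :> R by rewrite -natr1 addrK.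
have dR : 1 <= d%:R :> R by rewrite ler1n.
have e1 : expR (- (m * cst_r0 d.+1 gamma k)) <= 1.
  rewrite -[leRHS]expR0 ler_expR lerNl oppr0 mulr_ge0 ?(ltW m0)//.
  exact: le_trans cst_r0_ge1.
have M41 : cst_M4 d.+1 C3 <= 1 by rewrite /cst_M4 ge_min lexx.
have h : expR (- (m * cst_r0 d.+1 gamma k)) / (d.+1%:R - 1) <= 1.
  by rewrite dE ler_pdivrMr ?mul1r; [exact: le_trans dR|exact: lt_le_trans dR].
have h0 : 0 <= expR (- (m * cst_r0 d.+1 gamma k)) / (d.+1%:R - 1).
  by rewrite dE divr_ge0 ?expR_ge0// (le_trans ler01).
move: M41 h h0; set M := cst_M4 _ _; set E := _ / _ => M41 h h0.
have : E * M <= 1 * 1.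
  apply: (@le_trans _ _ (E * 1)); first exact: ler_wpM2l.
  by rewrite mul1r mulr1.
lra.
Qed.

(** In dimension 1 the tube is the segment itself. Otherwise, with n = d - 1 and
    C3 >= 2^gamma, and with exp(- m r0) <= exp(- 5 m / 8), which
    holds since r0 >= 1, the claim reduces to 2^n <= 4 (2/3)^n 5^(n/2) pi^(n-1). *)
Lemma cst_D1_le_tube_cst : D1 <= tube_cst (if d == 0 then 0 else 5).
Proof.
have := hC3; have := doubling_cst_ge; have := cst_r0_ge1; have := hgamma.
rewrite /cst_D1 /cst_C /tube_cst; case: d => [|n] hg r01 hd hC /=.
  rewrite mul0r mulr0 oppr0 expR0 addr0 powR1 mul0r powRr0 !mulr1.
  by lra.
have [C31 _] := hC isT; have C32 := hd isT.
have dE : n.+2%:R - 1 = n.+1%:R :> R by rewrite -[n.+2%:R]natr1 addrK.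
have n1 : 0 < n.+1%:R :> R by [].
set h : R := n.+1%:R / 2; have h0 : 0 < h by exact: divr_gt0.
have pi2 := @pi_ge2 R; have pi0 := @pi_gt0 R.
have E1 : expR (- (m * cst_r0 n.+2 gamma k)) <= expR (- (m * (5 / 8))).
  by rewrite ler_expR lerN2; apply: ler_wpM2l; [exact: ltW|lra].
have hE : (n.+2%:R - 3) / 2 = h - 1 :> R.
  by rewrite /h -[n.+2%:R]natr1 -[n.+1%:R]natr1; field.
have pE : pi `^ (h - 1) = pi `^ h / pi :> R.
  by rewrite (gt0_powRD h (- 1) pi0) powR_inv1// ltW.
have p2 : pi `^ h * pi `^ h = pi ^+ n.+1 :> R.
  rewrite -(gt0_powRD h h pi0) -powR_mulrn ?ltW//; congr (_ `^ _).
  by rewrite /h; field.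
(* C3 >= 2^gamma turns 6^(-gamma/2) into (2/3)^(gamma/2) *)
have k1 : (2 / 3) ^+ n.+1 <= C3 * 6 `^ (- (gamma / 2)).
  apply: (@le_trans _ _ ((2 / 3) `^ (gamma / 2))).
    rewrite -powR_mulrn; last by lra.
    apply: ger_powR; first by lra.
    by move: hg; rewrite -[n.+2%:R]natr1 -[n.+1%:R]natr1; have : 0 <= n%:R :> R by []; lra.
  apply: (@le_trans _ _ (2 `^ gamma * 6 `^ (- (gamma / 2)))); last first.
    by apply: ler_wpM2r C32; exact: powR_ge0.
  have -> : 2 `^ gamma = 4 `^ (gamma / 2) :> R.
    rewrite (_ : 4 = 2 ^+ 2); last by ring.
    by rewrite -powR_mulrn// -powRrM; congr (_ `^ _); field.
  have -> : 6 `^ (- (gamma / 2)) = 6^-1 `^ (gamma / 2).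
    by rewrite -(powR_inv1 (ler0n R 6)) -powRrM mulN1r.
  rewrite -powRM ?invr_ge0//; apply/eq_ler; congr (_ `^ _).
  by field.
have k5 : 2 ^+ n.+1 <= 5 `^ h.
  apply: (@le_trans _ _ (4 `^ h)); last by apply: ge0_ler_powR; rewrite ?nnegrE ?ltW//; lra.
  rewrite (_ : 4 = 2 ^+ 2); last by ring.
  by rewrite -powR_mulrn// -powR_mulrn// -powRrM; apply/eq_ler; congr (_ `^ _); rewrite /h; field.
have kp : (3 / 2) ^+ n <= pi ^+ n :> R by case: (n) => // i; rewrite ler_pXn2r ?nnegrE//; lra.
have -> : 1 + 5 = 6 :> R by ring.
rewrite /cst_M4 dE hE pE -/h subn1 /=; set E := expR _ in E1 *; set E' := expR _ in E1 *.
set M := Num.min _ _; set G := Gamma h; rewrite /kap -/h -/G.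
have G0 : 0 < G by exact: Gamma_gt0.
have p0 : 0 < pi `^ h :> R by exact: powR_gt0.
have M1 : M <= 2 ^+ n.+1 / (C3 * (pi `^ h / pi) * G) by rewrite /M ge_min lexx orbT.
have C30 : 0 < C3 by exact: lt_le_trans C31.
have key : 2 ^+ n.+1 * pi <= 4 * (C3 * 6 `^ (- (gamma / 2)) * 5 `^ h) * (pi `^ h * pi `^ h).
  have q0 : 0 <= 2 / 3 :> R by lra.
  have q1 : 0 <= 3 / 2 :> R by lra.
  have h1 := ler_pM (exprn_ge0 _ q0) (exprn_ge0 _ (ler0n R 2)) k1 k5.
  have h2 := ler_pM (mulr_ge0 (exprn_ge0 _ q0) (exprn_ge0 _ (ler0n R 2))) (exprn_ge0 _ q1) h1 kp.
  have h3 : (2 / 3) ^+ n.+1 * 2 ^+ n.+1 * (3 / 2) ^+ n = 2 / 3 * 2 ^+ n.+1 :> R.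
    rewrite exprS -!mulrA; congr (_ * (_ * _)); rewrite mulrCA -exprMn.
    by rewrite (_ : 2 / 3 * (3 / 2) = 1) ?expr1n ?mulr1//; field.
  rewrite h3 in h2; rewrite p2 [pi ^+ n.+1]exprSr.
  move: h2; set x := 2 ^+ n.+1; set y := _ * 5 `^ h; set z := pi ^+ n => h2.
  have x0 : 0 <= x by exact: exprn_ge0.
  rewrite [leRHS]mulrA ler_pM2r// -mulrA; lra.
move: key M1 E1 p0; rewrite /M; set x := 2 ^+ n.+1; set p := pi `^ h; set s6 := 6 `^ _; set f5 := 5 `^ _.
set a := n.+1%:R in n1 *; move: (pi : R) pi0 => P P0 key M1 E1 p0.
have E0 : 0 <= E' by exact: expR_ge0.
have E00 : 0 <= E by exact: expR_ge0.
rewrite -/G in M1 *; set Y := x / _ in M1 *; set mn := Num.min 1 Y.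
have Y0 : 0 <= Y.
  exact: divr_ge0 (exprn_ge0 _ (ler0n R 2)) (ltW (mulr_gt0 (mulr_gt0 C30 (divr_gt0 p0 P0)) G0)).
have mn0 : 0 <= mn by rewrite le_min ler01.
apply: (@le_trans _ _ (E' / a * Y / 2)).
  apply: ler_wpM2r; first by rewrite invr_ge0.
  apply: ler_pM => //; first by rewrite divr_ge0// ltW.
  by apply: ler_wpM2r E1; rewrite invr_ge0 ltW.
have -> : E' / a * Y / 2 = E' * (x * P) / (2 * a * C3 * p * G).
  by rewrite /Y; field; rewrite !gt_eqF.
have -> : E' * s6 * (f5 * (2 * (p / G) / a)) = E' * (4 * (C3 * s6 * f5) * (p * p)) / (2 * a * C3 * p * G).
  by field; rewrite !gt_eqF.
apply: ler_wpM2r; last exact: ler_wpM2l.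
by rewrite invr_ge0 ltW// !mulr_gt0.
Qed.

End LowerBound.

Opaque density convn cst_M2 L1norm.

(** * Limits at infinity and series *)

Section LimitsAtInfinity.
Context {R : realType} (d : nat).
Implicit Types (f : 'rV[R]_d.+1 -> \bar R) (c : \bar R).

Lemma enorm_unbounded (r : R) : exists x : 'rV[R]_d.+1, r <= enorm x.
Proof.
exists (consrV (r, 0)); rewrite enormE sqn_cons; apply: le_trans (ler_norm r) _.
by rewrite -sqrtr_sqr ler_wsqrtr// lerDl sqn_ge0.
Qed.

Lemma limf_einf_ge f c (r : R) : (forall x, r <= enorm x -> (c <= f x)%E) ->
  (c <= limf_einf f enorm_pinfty)%E.
Proof.
move=> H; rewrite limf_einfE; apply: le_ereal_sup_tmp.
exists (ereal_inf [set f x | x in [set x | r <= enorm x]]).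
  by exists [set x | r <= enorm x] => //; exists r.
by apply: le_ereal_inf_tmp => _ [x xr <-]; exact: H.
Qed.

Lemma limf_esup_le f c (r : R) : (forall x, r <= enorm x -> (f x <= c)%E) ->
  (limf_esup f enorm_pinfty <= c)%E.
Proof.
move=> H; rewrite /limf_esup; apply: ge_ereal_inf.
exists (ereal_sup [set f x | x in [set x | r <= enorm x]]).
  by exists [set x | r <= enorm x] => //; exists r.
by apply: ge_ereal_sup => _ [x xr <-]; exact: H.
Qed.

Lemma limf_einf_le_esup f : (limf_einf f enorm_pinfty <= limf_esup f enorm_pinfty)%E.
Proof.
rewrite limf_einfE /limf_esup; apply: ge_ereal_sup => _ [V [r _ rV] <-].
apply: le_ereal_inf_tmp => _ [W [s _ sW] <-].
have [x] := enorm_unbounded (Num.max r s); rewrite ge_max => /andP[xr xs].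
apply: (@le_trans _ _ (f x)).
  by apply: ereal_inf_lbound; exists x => //; exact: rV.
by apply: ereal_sup_ubound; exists x => //; exact: sW.
Qed.

End LimitsAtInfinity.

(** The triangle k + i < N, summed by rows and by columns. *)
Lemma cauchy_product_sum (R : comRingType) (a b : nat -> R) N :
  \sum_(n < N) \sum_(k < n.+1) a k * b (n - k)%N = \sum_(k < N) a k * \sum_(i < N - k) b i.
Proof.
elim: N => [|N IH]; first by rewrite !big_ord0.
rewrite big_ord_recr /= IH [in RHS]big_ord_recr /= subSnn big_ord1.
rewrite [X in _ + X]big_ord_recr /= subnn addrA; congr (_ + _).
rewrite -big_split /=; apply: eq_bigr => k _.
by rewrite subSn ?(ltnW (ltn_ord k))// big_ord_recr /= mulrDr.
Qed.

Lemma expR_partial_sum_le (R : realType) (t : R) N : 0 <= t ->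
  \sum_(i < N) t ^+ i / i`!%:R <= expR t.
Proof.
move=> t0; rewrite /expR.
apply: (@le_trans _ _ (series (exp_coeff t) N)).
  rewrite /series /= big_mkord; apply: ler_sum => i _.
  by rewrite exp_coeffE /= mulrC.
apply: nondecreasing_cvgn_le; last exact: is_cvg_series_exp_coeff.
by apply: nondecreasing_series => n _ _; exact: exp_coeff_ge0.
Qed.

(** * The estimates *)

Section Ratio.
Context {R : realType} (d : nat) (m gamma : R) (k : profile) (C1 C2 C3 : R).
Hypotheses (m0 : 0 < m) (gamma0 : 0 <= gamma) (hgamma : gamma < (d.+1%:R + 1) / 2).
Local Notation f := (density m gamma k : 'rV[R]_d.+1 -> R).
Local Notation I := (L1norm f).
Local Notation M2 := (cst_M2 d.+1 m gamma k C1 C2).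
Local Notation D1 := (cst_D1 d.+1 m gamma k C3).
Local Notation D2 := (cst_D2 d.+1 m).
Local Notation r1 := (rho1 d.+1 gamma k).
Local Notation r2 := (rho2 d.+1 gamma).
Hypothesis hC1 : 1 <= C1 /\ forall x y : 'rV[R]_d.+1,
  1 <= enorm x -> enorm x <= enorm y -> enorm y <= enorm x + 1 -> f x <= C1 * f y.
Hypothesis hC2 : 1 <= C2 /\ forall x : 'rV[R]_d.+1, enorm x <= 1 -> f x <= C2 * f (2 *: x).
Hypothesis hC3 : (2 <= d.+1)%N -> 1 <= C3 /\ forall r : R, 0 < r ->
  radial gamma k r <= C3 * radial gamma k (2 * r).

Let r20 : 0 < r2. Proof. exact: rho2_gt0. Qed.
Let r10 : 0 < r1. Proof. exact: rho1_gt0. Qed.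
Let D10 : 0 < D1. Proof. exact: cst_D1_gt0. Qed.
Let D20 : 0 < D2. Proof. exact: lt_le_trans (cst_D2_ge1 _ _). Qed.

Lemma cst_M2_ge0 : 0 <= M2.
Proof.
Transparent cst_M2.
rewrite /cst_M2; apply: mulr_ge0; last exact: L1norm_density_ge0.
by rewrite le_max (le_trans ler01)//; case: hC1.
Qed.
Opaque cst_M2.

Lemma growth_ge1 r : 1 <= r -> growth d gamma k r = r `^ r2.
Proof. by move=> r_ge1; apply/min_idPr; apply: ler_powR => //; exact: rho2_le_rho1. Qed.

Lemma convn_ge_wright_coef n x : 1 <= enorm x ->
  ((wright_coef D1 r1 n * (f x * enorm x `^ (r2 * n%:R)))%:E <= convn f n.+1 x)%E.
Proof.
move=> x1; have x0 : 0 < enorm x by exact: lt_le_trans x1.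
rewrite powRrM powR_mulrn ?powR_ge0// -growth_ge1//.
set c : R := if d == 0%N then 0 else 5.
have c0 : 0 <= c by rewrite /c; case: ifP.
have c5 : c <= 5 by rewrite /c; case: ifP => _; rewrite ?lexx.
have Dc : D1 <= tube_cst d m gamma c by exact: cst_D1_le_tube_cst.
exact: (convn_ge_lower k m0 gamma0 hgamma n D10 c0 c5 Dc x0).
Qed.

(** The last term of upper_bound is the main term. In the others, 1 / Gamma <= 2
    and C(n, k) <= n C(n-1, k) leave terms of the expansion of
    (M2 + D2 Gamma(rho2))^(n-1), with one factor M2 to spare. *)
Lemma upper_bound_ratio_le n r : 1 <= r ->
  upper_bound d m gamma k C1 C2 n r / r `^ (r2 * n%:R) <=
  wright_coef D2 r2 n + 2 * M2 * n.+1%:R * (M2 + D2 * Gamma r2) ^+ n / (D2 * r `^ r2).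
Proof.
move=> r_ge1; have r0 : 0 < r by exact: lt_le_trans r_ge1.
have M20 := cst_M2_ge0.
have nn (x y : R) : 0 <= x -> 0 <= y -> 0 <= x * y by exact: mulr_ge0.
have p0 (e : R) : 0 < r `^ e by exact: powR_gt0.
have g0 : 0 < Gamma r2 by exact: Gamma_gt0.
have kap0 : 0 <= D2 * Gamma r2 by apply: mulr_ge0; exact: ltW.
rewrite ler_pdivrMr// mulrDl /upper_bound big_ord_recr /= subnn expr0 mulr1 binn mul1r [leLHS]addrC lerD2l.
case: n => [|n].
  rewrite big_ord0; apply: mulr_ge0 (ltW (p0 _)); apply: divr_ge0; last by rewrite mulr_ge0 ?ltW.
  by rewrite expr0 mulr1; exact: (nn _ _ (nn _ _ (ler0n R 2) M20) ler01).
set P := r `^ (r2 * n%:R).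
have PE : r `^ (r2 * n.+1%:R) = P * r `^ r2.
  by rewrite /P -(gt0_powRD (r2 * n%:R) r2 r0); congr (_ `^ _); rewrite -natr1; ring.
have -> : 2 * M2 * n.+2%:R * (M2 + D2 * Gamma r2) ^+ n.+1 / (D2 * r `^ r2) * r `^ (r2 * n.+1%:R) =
   2 * M2 * n.+2%:R / D2 * P * (M2 + D2 * Gamma r2) ^+ n.+1.
  rewrite PE; have := p0 r2; move: (r `^ r2) => y y0; move: (Gamma r2) => g.
  move: (_ ^+ n.+1) (n.+2%:R) => z N; move: M2 D2 D20 => M D DD.
  by field; rewrite !gt_eqF.
rewrite exprDn [in leRHS]big_ord_recl /= mulrDr; apply: ler_wpDl.
  rewrite subn0 expr0 mulr1 bin0 mulr1n; apply: mulr_ge0; last exact: exprn_ge0.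
  apply: mulr_ge0 (ltW (p0 _)); apply: divr_ge0 (ltW D20).
  exact: (nn _ _ (nn _ _ (ler0n R 2) M20) (ler0n R _)).
rewrite mulr_sumr; apply: ler_sum => j _; rewrite /bump /= add1n.
have jn : (j <= n)%N by rewrite -ltnS.
have T2 : wright_coef D2 r2 j <= 2 * (D2 * Gamma r2) ^+ j.+1 / D2.
  Transparent wright_coef.
  rewrite /wright_coef exprMn [D2 ^+ j.+1]exprS.
  have h1 : (Gamma (r2 * j.+1%:R))^-1 <= 2.
    have := @Gamma_ge_half R (r2 * j.+1%:R) (mulr_gt0 r20 (ltr0Sn _ _)).
    by rewrite -[X in _ -> _ <= X]invrK lef_pV2 ?posrE ?invr_gt0// Gamma_gt0// mulr_gt0.
  have -> : 2 * (D2 * D2 ^+ j * Gamma r2 ^+ j.+1) / D2 = D2 ^+ j * (Gamma r2 ^+ j.+1 * 2).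
    by move: D2 D20 (Gamma r2) => D DD g; field; rewrite gt_eqF.
  apply: ler_wpM2l; first by rewrite exprn_ge0// ltW.
  by apply: ler_wpM2l h1; rewrite exprn_ge0// ltW.
have C2' : 'C(n.+2, j.+1)%:R <= n.+2%:R * 'C(n.+1, j.+1)%:R :> R.
  rewrite -natrM ler_nat mul_bin_down -[leqLHS]mul1n leq_mul2r; apply/orP; right.
  by rewrite subSS subn_gt0 ltnS.
have P2 : r `^ (r2 * j%:R) <= P.
  by rewrite /P; apply: ler_powR => //; rewrite ler_pM2l// ler_nat.
have T0 : 0 <= wright_coef D2 r2 j by apply: ltW; exact: wright_coef_gt0.
have h := ler_pM T0 (ltW (p0 _)) T2 P2.
have h' := ler_pM (ler0n _ _) (nn _ _ T0 (ltW (p0 _))) C2' h.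
have := ler_wpM2r (exprn_ge0 (n.+1 - j) M20) h'.
apply: ler_eq2; first by ring.
rewrite subSS subSn// [M2 ^+ (n - j).+1]exprS -[_ *+ 'C(_, _)]mulr_natr.
have := D20; move: ((D2 * _) ^+ _) (n.+2%:R : R) ('C(n.+1, _)%:R : R) (M2 ^+ _) => x1 x2 x3 x4.
clear PE P2 h h'; move: M2 D2 P => M D p DD.
by field; rewrite gt_eqF.
Qed.

Local Notation ratio n x := (convn f n.+1 x / (f x * enorm x `^ (r2 * n%:R))%:E)%E.

Let den_gt0 n x : 1 <= enorm x -> 0 < f x * enorm x `^ (r2 * n%:R).
Proof.
move=> x1; have x0 : 0 < enorm x by exact: lt_le_trans x1.
by apply: mulr_gt0; [exact: density_gt0|exact: powR_gt0].
Qed.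

Lemma ratio_ge n x : 1 <= enorm x -> ((wright_coef D1 r1 n)%:E <= ratio n x)%E.
Proof.
move=> x1; have D0 := den_gt0 n x1.
by rewrite inver gt_eqF// lee_pdivlMr// -EFinM; exact: convn_ge_wright_coef.
Qed.

Local Notation err n r := (2 * M2 * n.+1%:R * (M2 + D2 * Gamma r2) ^+ n / (D2 * r `^ r2)).

Lemma ratio_le n x : 1 <= enorm x ->
  (ratio n x <= (wright_coef D2 r2 n + err n (enorm x))%:E)%E.
Proof.
move=> x1; have D0 := den_gt0 n x1.
have x0 : 0 < enorm x by exact: lt_le_trans x1.
rewrite inver gt_eqF// lee_pdivrMr// -EFinM.
apply: le_trans (convn_le_upper_bound m0 gamma0 hgamma hC1 hC2 n x1) _.
rewrite lee_fin mulrCA; apply: ler_wpM2l; first exact: density_ge0.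
by rewrite -ler_pdivrMr ?powR_gt0//; exact: upper_bound_ratio_le.
Qed.

Let err_num_ge0 n : 0 <= 2 * M2 * n.+1%:R * (M2 + D2 * Gamma r2) ^+ n.
Proof.
have M20 := cst_M2_ge0.
have nn (x y : R) : 0 <= x -> 0 <= y -> 0 <= x * y by exact: mulr_ge0.
apply: mulr_ge0; first exact: (nn _ _ (nn _ _ (ler0n R 2) M20) (ler0n R _)).
by apply: exprn_ge0; apply: addr_ge0 M20 _; apply: mulr_ge0; apply: ltW => //; exact: Gamma_gt0.
Qed.

Lemma limf_einf_ratio_ge n :
  ((wright_coef D1 r1 n)%:E <= limf_einf (fun x => ratio n x) enorm_pinfty)%E.
Proof. by apply: (limf_einf_ge (r := 1)) => x x1; exact: ratio_ge. Qed.

Lemma limf_esup_ratio_le n :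
  (limf_esup (fun x => ratio n x) enorm_pinfty <= (wright_coef D2 r2 n)%:E)%E.
Proof.
apply/lee_addgt0Pr => e e0; have := err_num_ge0 n; set A := _ * _ ^+ n => A0.
have De0 : 0 < D2 * e by exact: mulr_gt0.
pose s := Num.max 1 ((A / (D2 * e)) `^ r2^-1).
apply: (limf_esup_le (r := s)) => x; rewrite ge_max => /andP[x1 xs].
apply: le_trans (ratio_le n x1) _; rewrite -EFinD lee_fin lerD2l -/A.
have x0 : 0 < enorm x by exact: lt_le_trans x1.
rewrite ler_pdivrMr; last by apply: mulr_gt0 => //; exact: powR_gt0.
have h0 : 0 <= A / (D2 * e) by apply: divr_ge0 => //; exact: ltW.
have : A / (D2 * e) <= enorm x `^ r2.
  rewrite -[leLHS](powRr1 h0) -[X in _ `^ X](mulVf (lt0r_neq0 r20)) powRrM.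
  by apply: (ge0_ler_powR (ltW r20)) xs; rewrite nnegrE ?powR_ge0// ltW.
by rewrite ler_pdivrMr// => h; apply: (le_trans h); apply/eq_ler; ring.
Qed.

Let W (x : 'rV[R]_d.+1) := expR (- (m * enorm x)) * enorm x `^ (- ((d.+1%:R + 1) / 2)).

Let densityW x : 1 <= enorm x -> f x = W x * enorm x `^ r2.
Proof.
move=> x1; have x0 : 0 < enorm x by exact: lt_le_trans x1.
rewrite density_ge1E// /W -mulrA -(gt0_powRD (- ((d.+1%:R + 1) / 2)) r2 x0); congr (_ * _ `^ _).
by rewrite /rho2; ring.
Qed.

Definition wright_term (rho t : R) n : R := t ^+ n * invGamma (rho * n%:R + 0) / n`!%:R.

Lemma wright_term0 rho t : wright_term rho t 0 = 0.
Proof. by rewrite /wright_term /invGamma mulr0 addr0 eqxx mulr0 mul0r. Qed.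

Lemma wright_term_ge0 rho t n : 0 < rho -> 0 <= t -> 0 <= wright_term rho t n.
Proof.
move=> rho0 t0; case: n => [|n]; first by rewrite wright_term0.
have h : 0 < rho * n.+1%:R by exact: mulr_gt0.
rewrite /wright_term /invGamma addr0 gt_eqF// divr_ge0// mulr_ge0 ?exprn_ge0// invr_ge0 ltW//.
exact: Gamma_gt0.
Qed.

Lemma wright_termE D rho (lambda r : R) n : 0 < rho -> 0 < r ->
  wright_term rho (D * Gamma rho * lambda * r `^ rho2 d.+1 gamma) n.+1 =
  lambda ^+ n.+1 / n.+1`!%:R * (D * wright_coef D rho n) * (r `^ r2 * r `^ (r2 * n%:R)).
Proof.
move=> rho0 r0; have h : 0 < rho * n.+1%:R by exact: mulr_gt0.
rewrite /wright_term /invGamma addr0 gt_eqF// /wright_coef.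
have -> : r `^ (r2 * n%:R) = (r `^ r2) ^+ n by rewrite powRrM powR_mulrn// powR_ge0.
rewrite -exprS !exprMn [D ^+ n.+1]exprS; move: (_ `^ _ ^+ _) => x1.
move: (Gamma rho ^+ _) (Gamma (rho * _)) (D ^+ n) (lambda ^+ _) => x2 x3 x4 x5; ring.
Qed.

Local Notation poisson_series lambda x :=
  (\sum_(1 <= n <oo) ((lambda ^+ n / n`!%:R)%:E * convn f n x))%E.

Let W_gt0 x : 1 <= enorm x -> 0 < W x.
Proof. by move=> x1; rewrite mulr_gt0 ?expR_gt0 ?powR_gt0// (lt_le_trans ltr01). Qed.

Let poisson_term_ge0 (lambda : R) n x : 0 < lambda -> (0 <= (lambda ^+ n / n`!%:R)%:E * convn f n x)%E.
Proof.
move=> l0; apply: mule_ge0; first by rewrite lee_fin divr_ge0// exprn_ge0// ltW.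
case: n => [|n]; last exact: density_convn_ge0.
exact: (density_convn_ge0 k m0 gamma0 0).
Qed.

(** Compared term by term; D1 <= 1 absorbs the difference between D1^n and D1^(n-1). *)
Lemma poisson_series_ge (lambda : R) x : 0 < lambda -> 1 <= enorm x ->
  ((W x)%:E * wright r1 0 (D1 * Gamma r1 * lambda * enorm x `^ r2) <= poisson_series lambda x)%E.
Proof.
move=> l0 x1; have x0 : 0 < enorm x by exact: lt_le_trans x1.
have W0 := W_gt0 x1.
set t := D1 * Gamma r1 * lambda * enorm x `^ r2.
have t0 : 0 <= t by rewrite mulr_ge0 ?powR_ge0// mulr_ge0 ?(ltW l0)// mulr_ge0 ?ltW// Gamma_gt0.
have T0 n : (0 <= (wright_term r1 t n)%:E)%E by rewrite lee_fin; exact: wright_term_ge0.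
rewrite [wright _ _ _](_ : _ = \sum_(0 <= n <oo) (wright_term r1 t n)%:E)%E//.
rewrite nneseries_recl//.
rewrite wright_term0 add0e -nneseriesZl; last by move=> n _; exact: T0.
apply: lee_nneseries; first by move=> n _ _; apply: mule_ge0 (T0 n); rewrite lee_fin ltW.
move=> [|n] _; first by rewrite wright_term0 mule0; exact: poisson_term_ge0.
rewrite /t wright_termE//.
have c0 : 0 <= lambda ^+ n.+1 / n.+1`!%:R by rewrite divr_ge0// exprn_ge0// ltW.
apply: le_trans (lee_wpmul2l _ (convn_ge_wright_coef n x1)); last by rewrite lee_fin.
rewrite -!EFinM lee_fin (densityW x1).
have w0 : 0 <= wright_coef D1 r1 n by apply: ltW; exact: wright_coef_gt0.
have D11 : D1 <= 1 by exact: cst_D1_le1.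
move: c0; set c := _ / _ => c0; set p := _ `^ r2; set q := _ `^ _; set w := wright_coef _ _ _ in w0 *.
have -> : W x * (c * (D1 * w) * (p * q)) = c * (w * (W x * p * q)) * D1 by ring.
apply: ler_piMr => //; apply: mulr_ge0 => //; apply: mulr_ge0 => //.
by rewrite mulr_ge0 ?powR_ge0// mulr_ge0 ?powR_ge0// ltW.
Qed.

(** Divided by n!, upper_bound becomes the n-th term of the Cauchy product of the
    Wright series with the exponential series at M2 lambda. *)
Lemma poisson_term_le (lambda : R) n x : 0 < lambda -> 1 <= enorm x ->
  ((lambda ^+ n.+1 / n.+1`!%:R)%:E * convn f n.+1 x <=
   (W x * \sum_(j < n.+2) wright_term r2 (D2 * Gamma r2 * lambda * enorm x `^ r2) j *
       ((M2 * lambda) ^+ (n.+1 - j) / (n.+1 - j)`!%:R))%:E)%E.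
Proof.
move=> l0 x1; have x0 : 0 < enorm x by exact: lt_le_trans x1.
have c0 : 0 <= lambda ^+ n.+1 / n.+1`!%:R by rewrite divr_ge0// exprn_ge0// ltW.
have U := convn_le_upper_bound m0 gamma0 hgamma hC1 hC2 n x1.
apply: le_trans (lee_wpmul2l _ U) _; first by rewrite lee_fin.
rewrite -EFinM lee_fin (densityW x1) big_ord_recl wright_term0 mul0r add0r.
have -> : lambda ^+ n.+1 / n.+1`!%:R * (W x * enorm x `^ r2 * upper_bound d m gamma k C1 C2 n (enorm x)) =
    W x * (lambda ^+ n.+1 / n.+1`!%:R * enorm x `^ r2 * upper_bound d m gamma k C1 C2 n (enorm x)) by ring.
apply: ler_wpM2l; first by rewrite ltW// W_gt0.
rewrite /upper_bound mulr_sumr; apply: ler_sum => j _.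
rewrite /= /bump /= add1n subSS wright_termE//.
have jn : (j <= n)%N by rewrite -ltnS.
have binE : 'C(n.+1, j.+1)%:R / n.+1`!%:R = (j.+1`!%:R * (n - j)`!%:R)^-1 :> R.
  have alg (a b c : nat) : (0 < a)%N -> (0 < b)%N -> (0 < c)%N ->
      c%:R / (c * (a * b))%:R = (a%:R * b%:R)^-1 :> R.
    rewrite -!(ltr0n R) !natrM; move: (a%:R : R) (b%:R : R) (c%:R : R) => a' b' c' a0 b0 c0'.
    by field; rewrite !gt_eqF.
  have := @bin_fact n.+1 j.+1 jn; rewrite subSS => <-.
  by apply: alg; rewrite ?fact_gt0// bin_gt0.
have lE : lambda ^+ n.+1 = lambda ^+ j.+1 * lambda ^+ (n - j).
  by rewrite -exprD addSn subnKC.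
have M20 := cst_M2_ge0.
have w0 : 0 <= wright_coef D2 r2 j by apply: ltW; exact: wright_coef_gt0.
have D21 : 1 <= D2 by exact: cst_D2_ge1.
have p0 : 0 <= enorm x `^ r2 by exact: powR_ge0.
have q0 : 0 <= enorm x `^ (r2 * j%:R) by exact: powR_ge0.
have m1 : 0 <= M2 ^+ (n - j) by exact: exprn_ge0.
have l1 : 0 <= lambda ^+ j.+1 by rewrite exprn_ge0// ltW.
have l2 : 0 <= lambda ^+ (n - j) by rewrite exprn_ge0// ltW.
rewrite lE [(M2 * lambda) ^+ _]exprMn.
move: binE l1 l2 m1 p0 q0 w0 D21; set p := enorm x `^ r2; set q := enorm x `^ _; set w := wright_coef _ _ _.
set L1 := lambda ^+ j.+1; set L2 := lambda ^+ (n - j); set M := M2 ^+ (n - j); set D := D2.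
set a : R := 'C(_, _)%:R; set b : R := n.+1`!%:R; set u : R := j.+1`!%:R; set v : R := (n - j)`!%:R.
move=> binE l1 l2 m1 p0 q0 w0 D21.
have nn (y z : R) : 0 <= y -> 0 <= z -> 0 <= y * z by exact: mulr_ge0.
have -> : L1 * L2 / b * p * (a * M * (w * q)) = a / b * (L1 * L2 * p * M * w * q) by ring.
have -> : L1 / u * (D * w) * (p * q) * (M * L2 / v) = (u * v)^-1 * (L1 * L2 * p * M * w * q) * D.
  by rewrite invfM; ring.
rewrite binE; apply: ler_peMr => //; apply: mulr_ge0.
  by rewrite invr_ge0; exact: (nn _ _ (ler0n _ _) (ler0n _ _)).
exact: (nn _ _ (nn _ _ (nn _ _ (nn _ _ (nn _ _ l1 l2) p0) m1) w0) q0).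
Qed.

(** A partial sum of a Cauchy product is at most the product of the sums. *)
Lemma poisson_series_le (lambda : R) x : 0 < lambda -> 1 <= enorm x ->
  (poisson_series lambda x <=
   (W x)%:E * ((expR (M2 * lambda))%:E * wright r2 0 (D2 * Gamma r2 * lambda * enorm x `^ r2)))%E.
Proof.
move=> l0 x1; have x0 : 0 < enorm x by exact: lt_le_trans x1.
have W0 := W_gt0 x1.
have Ml0 : 0 <= M2 * lambda by rewrite mulr_ge0 ?cst_M2_ge0// ltW.
set t := D2 * Gamma r2 * lambda * enorm x `^ r2.
have t0 : 0 <= t by rewrite mulr_ge0 ?powR_ge0// mulr_ge0 ?(ltW l0)// mulr_ge0 ?ltW// Gamma_gt0.
have T0 n : 0 <= wright_term r2 t n by exact: wright_term_ge0.
apply: lime_le.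
  by apply: is_cvg_nneseries => n _ _; exact: poisson_term_ge0.
apply: nearW => N.
pose b i := (M2 * lambda) ^+ i / i`!%:R.
have b0 i : 0 <= b i by rewrite /b divr_ge0// exprn_ge0.
pose cc n := \sum_(j < n.+1) wright_term r2 t j * b (n - j)%N.
apply: (@le_trans _ _ (W x * \sum_(n < N) cc n)%:E).
  have c0 n : 0 <= W x * cc n.
    by apply: mulr_ge0 (ltW W0) _; apply: sumr_ge0 => j _; exact: mulr_ge0.
  rewrite mulr_sumr -sumEFin -(big_mkord xpredT (fun n => (W x * cc n)%:E)).
  case: N => [|N]; first by rewrite !big_geq.
  rewrite [leRHS]big_ltn//; apply: le_trans (leeDr _ _); last by rewrite lee_fin; exact: c0.
  rewrite !big_nat; apply: lee_sum => -[|n] // _.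
  exact: poisson_term_le.
rewrite EFinM; apply: lee_wpmul2l; first by rewrite lee_fin ltW.
rewrite (cauchy_product_sum (wright_term r2 t) b N).
apply: (@le_trans _ _ (expR (M2 * lambda) * \sum_(j < N) wright_term r2 t j)%:E).
  rewrite lee_fin mulr_sumr; apply: ler_sum => j _; rewrite [leRHS]mulrC.
  by apply: ler_wpM2l => //; exact: expR_partial_sum_le.
rewrite EFinM; apply: lee_wpmul2l; first by rewrite lee_fin expR_ge0.
rewrite -sumEFin -(big_mkord xpredT (fun n => (wright_term r2 t n)%:E)).
by apply: (nneseries_lim_ge (u_ := fun n => (wright_term r2 t n)%:E)) => n _ _; rewrite lee_fin.
Qed.

Lemma cpoisson_ratio_bounds (lambda : R) x : 0 < lambda -> 1 <= enorm x ->
  let q := (cpoisson_density f lambda x / (expR (- (lambda * I)) * expR (- (m * enorm x)) *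
     enorm x `^ (- ((d.+1%:R + 1) / 2)))%:E)%E in
  (wright r1 0 (D1 * Gamma r1 * lambda * enorm x `^ r2) <= q)%E /\
  (q <= (expR (M2 * lambda))%:E * wright r2 0 (D2 * Gamma r2 * lambda * enorm x `^ r2))%E.
Proof.
move=> l0 x1 q; have W0 := W_gt0 x1.
have E0 : 0 < expR (- (lambda * I)) by exact: expR_gt0.
have qE : q = (poisson_series lambda x * ((W x)^-1)%:E)%E.
  rewrite /q /cpoisson_density -mulrA -/(W x) inver gt_eqF; last exact: mulr_gt0.
  rewrite invfM EFinM muleCA !muleA -EFinM mulVf ?gt_eqF// mul1e.
  by [].
rewrite qE lee_pdivlMr// lee_pdivrMr//; split; first by rewrite muleC; exact: poisson_series_ge.
by rewrite [leRHS]muleC; exact: poisson_series_le.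
Qed.

End Ratio.

Theorem theorem4p10 (R : realType) (d : nat) (m gamma : R) (k : profile)
    (C1 C2 C3 : R)
    (hd : (1 <= d)%N) (hm : 0 < m)
    (hgamma0 : 0 <= gamma) (hgamma : gamma < (d%:R + 1) / 2)
    (hC1 : 1 <= C1 /\ forall x y : 'rV[R]_d,
       1 <= enorm x -> enorm x <= enorm y -> enorm y <= enorm x + 1 ->
       density m gamma k x <= C1 * density m gamma k y)
    (hC2 : 1 <= C2 /\ forall x : 'rV[R]_d, enorm x <= 1 ->
       density m gamma k x <= C2 * density m gamma k (2 *: x))
    (hC3 : (2 <= d)%N -> 1 <= C3 /\ forall r : R, 0 < r ->
       radial gamma k r <= C3 * radial gamma k (2 * r)) :
  let f : 'rV[R]_d -> R := density m gamma k in
  let D1 := cst_D1 d m gamma k C3 in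
  let D2 := cst_D2 d m in
  let M2 := cst_M2 d m gamma k C1 C2 in
  let r1 := rho1 d gamma k in
  let r2 := rho2 d gamma in
  let kappa1 := D1 * Gamma r1 in
  let kappa2 := D2 * Gamma r2 in
  let lower (n : nat) : R := D1 ^+ n.-1 * (Gamma r1 ^+ n / Gamma (r1 * n%:R)) in
  let upper (n : nat) : R := D2 ^+ n.-1 * (Gamma r2 ^+ n / Gamma (r2 * n%:R)) in
  let ratio (n : nat) (x : 'rV[R]_d) : \bar R :=
    (convn f n x / (f x * enorm x `^ (r2 * n.-1%:R))%:E)%E in
  (forall n : nat, (1 <= n)%N ->
     (forall x : 'rV[R]_d, 1 <= enorm x ->
        ((lower n)%:E <= ratio n x)%E /\
        (ratio n x <= (upper n + 2 * M2 * n%:R * (M2 + kappa2) ^+ n.-1 /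
                        (D2 * enorm x `^ r2))%:E)%E) /\
     [/\ ((lower n)%:E <= limf_einf (ratio n) enorm_pinfty)%E,
         (limf_einf (ratio n) enorm_pinfty
            <= limf_esup (ratio n) enorm_pinfty)%E &
         (limf_esup (ratio n) enorm_pinfty <= (upper n)%:E)%E]) /\
  (forall (lambda : R) (x : 'rV[R]_d), 0 < lambda -> 1 <= enorm x ->
     let q := (cpoisson_density f lambda x /
        (expR (- (lambda * L1norm f)) * expR (- (m * enorm x)) *
           enorm x `^ (- ((d%:R + 1) / 2)))%:E)%E in
     (wright r1 0 (kappa1 * lambda * enorm x `^ r2) <= q)%E /\
     (q <= (expR (M2 * lambda))%:E *
             wright r2 0 (kappa2 * lambda * enorm x `^ r2))%E).
Proof.
case: d hd hgamma hC1 hC2 hC3 => [//|d] _ hgamma hC1 hC2 hC3 f D1 D2 M2 r1 r2 kappa1 kappa2.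
move=> lower upper ratio; split; last first.
  move=> lambda x l0 x1.
  exact: (cpoisson_ratio_bounds hm hgamma0 hgamma hC1 hC2 hC3 l0 x1).
case=> [//|n] _; split=> [x x1|]; first split.
- exact: (ratio_ge hm hgamma0 hgamma hC3 n x1).
- exact: (ratio_le hm hgamma0 hgamma hC1 hC2 n x1).
split.
- exact: (limf_einf_ratio_ge hm hgamma0 hgamma hC3 n).
- exact: limf_einf_le_esup.
- exact: (limf_esup_ratio_le hm hgamma0 hgamma hC1 hC2 n).
Qed.
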